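(* Let $\varphi$ be real analytic on an open interval $I$, let $A,B:\,]-\varepsilon,\varepsilon[\to\mathbb{R}$ be real analytic with $A^2+B^2>0$, and let $(p_1,p_2,p_3)\in\mathbb{R}^3$ with $p_3\in I$. Consider the Cauchy problem, for $\psi=(x,y,z)$, $$\begin{cases}\Delta\psi=-\dot\varphi(z)\big(\langle\nabla x,\nabla z\rangle,\ \langle\nabla y,\nabla z\rangle,\ -|\nabla x|^2-|\nabla y|^2+|\nabla z|^2\big),\\ \psi(u,0)=(p_1,p_2,p_3)+\int_0^u(B(t)\sin t,B(t)\cos t,A(t))\,dt,\\ \psi_v(u,0)=(-A(u)\sin u,-A(u)\cos u,B(u)),\end{cases}$$ where $\Delta,\nabla$ are the Euclidean Laplacian and gradient in $(u,v)$. Then for $R$ small enough there exists a unique real analytic solution $\psi:D_R\to\mathbb{R}^3$ on the disk $D_R=\{(u,v):\|(u,v)\|<R\}$, and it defines a conformally immersed $[\varphi,\vec e_3]$-minimal surface in $\mathbb{R}^3$ whose angle function $\eta$ satisfies $\eta(u,v)\neq0$ if $v\neq0$, $\eta(u,0)=0$ and $\eta_v(u,0)=1$ for all $u$.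
   Context: $\vec e_3=(0,0,1)$. An immersion $\psi=(x,y,z)$ into $\mathbb{R}^3$ is $[\varphi,\vec e_3]$-minimal if its mean curvature vector is $\dot\varphi(z)\vec e_3^\perp$; equivalently, for every conformal parameter $\xi$: $2x_{\xi\bar\xi}+\dot\varphi(z)(z_\xi x_{\bar\xi}+z_{\bar\xi}x_\xi)=0$, $2y_{\xi\bar\xi}+\dot\varphi(z)(z_\xi y_{\bar\xi}+z_{\bar\xi}y_\xi)=0$, $2z_{\xi\bar\xi}-\dot\varphi(z)(|x_\xi|^2+|y_\xi|^2-|z_\xi|^2)=0$. The angle function is $\eta=\langle N,\vec e_3\rangle$ with $N=\frac{\psi_u\wedge\psi_v}{\|\psi_u\wedge\psi_v\|}$.
   Formalization: The third component of the system carries a factor 1/2, Δz = φ'(z)(|∇x|²+|∇y|²−|∇z|²)/2, as minimality requires; as printed, without 1/2, the solution cannot be conformal and minimal with η≠0 off v=0 when φ is nonconstant (e.g. φ(t)=t). *)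

(* Defs.v *)
From Stdlib Require Import Reals.
From Coquelicot Require Import Coquelicot.
Open Scope R_scope.

Definition rbar_open_interval (a b : Rbar) (t : R) : Prop :=
  Rbar_lt a t /\ Rbar_lt t b.

Definition analytic1 (S : R -> Prop) (f : R -> R) : Prop :=
  forall a, S a -> exists r, 0 < r /\ exists c : nat -> R,
    forall t, Rabs (t - a) < r -> is_series (fun n => c n * (t - a) ^ n) (f t).

Definition analytic2 (U : R -> R -> Prop) (f : R -> R -> R) : Prop :=
  forall a b, U a b -> exists r, 0 < r /\ exists c : nat -> nat -> R,
    forall u v, Rabs (u - a) < r -> Rabs (v - b) < r ->
      ex_series (fun n => sum_f_R0 (fun i =>
          Rabs (c i (n - i)%nat) * Rabs (u - a) ^ i * Rabs (v - b) ^ (n - i)) n) /\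
      is_series (fun n => sum_f_R0 (fun i =>
          c i (n - i)%nat * (u - a) ^ i * (v - b) ^ (n - i)) n) (f u v).

Definition disk (R0 : R) (u v : R) : Prop := u ^ 2 + v ^ 2 < R0 ^ 2.

Definition d_u (f : R -> R -> R) (u v : R) : R := Derive (fun s => f s v) u.
Definition d_v (f : R -> R -> R) (u v : R) : R := Derive (fun s => f u s) v.
Definition lap (f : R -> R -> R) (u v : R) : R :=
  Derive (fun s => d_u f s v) u + Derive (fun s => d_v f u s) v.
Definition grad_dot (f g : R -> R -> R) (u v : R) : R :=
  d_u f u v * d_u g u v + d_v f u v * d_v g u v.

Definition conformal_immersion (U : R -> R -> Prop) (x y z : R -> R -> R) : Prop :=
  forall u v, U u v ->
    d_u x u v * d_v x u v + d_u y u v * d_v y u v + d_u z u v * d_v z u v = 0 /\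
    d_u x u v ^ 2 + d_u y u v ^ 2 + d_u z u v ^ 2
      = d_v x u v ^ 2 + d_v y u v ^ 2 + d_v z u v ^ 2 /\
    0 < d_u x u v ^ 2 + d_u y u v ^ 2 + d_u z u v ^ 2.

(* [phi, e3]-minimality, written for the conformal parameter xi = u + i v,
   via the Wirtinger derivatives f_xi = (f_u - i f_v)/2:
     2 f_{xi xibar} = (lap f)/2,
     z_xi f_xibar + z_xibar f_xi = <grad z, grad f>/2,
     |f_xi|^2 = |grad f|^2/4.
   The system of the context
     2x_{xi xibar} + phi'(z)(z_xi x_xibar + z_xibar x_xi) = 0,
     2y_{xi xibar} + phi'(z)(z_xi y_xibar + z_xibar y_xi) = 0,
     2z_{xi xibar} - phi'(z)(|x_xi|^2 + |y_xi|^2 - |z_xi|^2) = 0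
   thus reads as below. *)
Definition phi_e3_minimal_eqs (phi : R -> R) (U : R -> R -> Prop)
    (x y z : R -> R -> R) : Prop :=
  forall u v, U u v ->
    lap x u v / 2 + Derive phi (z u v) * (grad_dot z x u v / 2) = 0 /\
    lap y u v / 2 + Derive phi (z u v) * (grad_dot z y u v / 2) = 0 /\
    lap z u v / 2 - Derive phi (z u v) *
      (grad_dot x x u v / 4 + grad_dot y y u v / 4 - grad_dot z z u v / 4) = 0.

Definition conformal_phi_e3_minimal (phi : R -> R) (U : R -> R -> Prop)
    (x y z : R -> R -> R) : Prop :=
  conformal_immersion U x y z /\ phi_e3_minimal_eqs phi U x y z.

Definition cross3 (x y z : R -> R -> R) (u v : R) : R * R * R :=
  (d_u y u v * d_v z u v - d_u z u v * d_v y u v,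
   d_u z u v * d_v x u v - d_u x u v * d_v z u v,
   d_u x u v * d_v y u v - d_u y u v * d_v x u v).
Definition angle_fun (x y z : R -> R -> R) (u v : R) : R :=
  let '(n1, n2, n3) := cross3 x y z u v in
  n3 / sqrt (n1 ^ 2 + n2 ^ 2 + n3 ^ 2).

(* The Cauchy problem of the theorem on the disk D_R.  The PDE
   Delta psi = -phi'(z) (<grad x, grad z>, <grad y, grad z>,
                         -(|grad x|^2 + |grad y|^2 - |grad z|^2)/2)
   is the (u,v)-form of the [phi,e3]-minimal system above. *)
Definition cauchy_solution (phi : R -> R) (Ia Ib : Rbar) (A B : R -> R)
    (p1 p2 p3 R0 : R) (x y z : R -> R -> R) : Prop :=
  analytic2 (disk R0) x /\ analytic2 (disk R0) y /\ analytic2 (disk R0) z /\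
  (forall u v, disk R0 u v -> rbar_open_interval Ia Ib (z u v)) /\
  (forall u v, disk R0 u v ->
     lap x u v = - Derive phi (z u v) * grad_dot x z u v /\
     lap y u v = - Derive phi (z u v) * grad_dot y z u v /\
     lap z u v = - Derive phi (z u v) *
        (- grad_dot x x u v - grad_dot y y u v + grad_dot z z u v) / 2) /\
  (forall u, Rabs u < R0 ->
     x u 0 = p1 + RInt (fun t => B t * sin t) 0 u /\
     y u 0 = p2 + RInt (fun t => B t * cos t) 0 u /\
     z u 0 = p3 + RInt (fun t => A t) 0 u /\
     d_v x u 0 = - A u * sin u /\
     d_v y u 0 = - A u * cos u /\
     d_v z u 0 = B u).

(* Main.v *)
Require Import Defs.
From Stdlib Require Import Reals Lra Lia Arith FunctionalExtensionality.
From Coquelicot Require Import Coquelicot.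
Open Scope R_scope.

(* Cauchy-Kovalevskaya for the unknown [w = psi_vv].  Formally, the Cauchy data and [w]
   determine [psi = psi_0 + v psi_1 + Jv (Jv w)] ([Jv] integrates in [v]), and the system
   reads [w = picard w], where the coefficients of [picard w] of order at most [n] in [v]
   only involve those of [w] of order less than [n]; so there is exactly one formal
   solution.  It converges because [picard] preserves a ball for the domination by
   [F = sum_n (rho (u + 2v))^n / (n+1)^2]: this series satisfies [F * F <= 8 F], the operator
   [d/du Jv] has norm [1/2] (so the top order term [(d/du Jv)^2 w] has norm [1/4]), and [Jv]
   has norm [2/rho], small for large [rho].

   Two analytic solutions on a disk have the same formal series at the origin, hence agree
   near the origin, hence along every ray.

   With [P = |psi_u|^2 - |psi_v|^2] and [S = <psi_u, psi_v>], the quantity [Q = P - 2iS]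
   solves a linear Cauchy-Riemann equation and vanishes on [v = 0], so [Q = 0].  Then
   [eta = (x_u y_v - y_u x_v) / |psi_u|^2]; the numerator is [v K] with [K] analytic and
   equal to [A^2 + B^2 = |psi_u|^2 > 0] on the axis. *)

(** The obstacle is that the equation for [psi_vv] contains [psi_uu], and differentiation in [u] is
    not bounded for a weighted norm on coefficients. With [psi_vv] as the unknown, every [Du] acting
    on it is paired with a [Jv], and the majorant depends on [u + 2v] only, so [d/dv F = 2 d/du F]:
    a [v]-integration followed by a [u]-derivative gains the factor 1/2 whatever [rho] is. The
    weights [1/(n+1)^2] make the norm submultiplicative up to a constant, which also controls
    substitution into the series of [phi'] at [p3].

    No contraction estimate is used: successive iterates agree on more and more rows, which defines
    the limit, and domination is a condition on single coefficients, which the limit inherits.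

    The algebra (conformality, rows on the axis) is carried out on formal series, taken as series in
    [v] over the ring of series in [u], so that [ring] applies; evaluation transfers it to
    functions. Since analyticity is required at every point of the disk, the sum of the series must
    also be re-expanded away from the origin. *)

Section FormalSeries.

(** * Formal power series over a commutative ring *)

Variable A : Type.
Variables (zero one : A) (add mul sub : A -> A -> A) (opp : A -> A).
Hypothesis Aring : ring_theory zero one add mul sub opp (@eq A).
Add Ring Aring : Aring.

Definition shift (a : nat -> A) : nat -> A := fun n => a (S n).
Definition lift2 (f : A -> A -> A) (a b : nat -> A) : nat -> A :=
  fun n => f (a n) (b n).
Definition cst (c : A) : nat -> A :=
  fun n => match n with O => c | S _ => zero end.

(** The Cauchy product, by [(a_0 + t a') b = a_0 b + t (a' b)]. Peeling off the head of the left
    factor lets the ring laws follow by induction on the index with [a] generalized, without double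
    sums. *)
Fixpoint conv (a b : nat -> A) (n : nat) : A :=
  match n with
  | O => mul (a O) (b O)
  | S m => add (mul (a O) (b (S m))) (conv (shift a) b m)
  end.

Fixpoint fsum (f : nat -> A) (n : nat) : A :=
  match n with O => f O | S m => add (fsum f m) (f (S m)) end.

Lemma fsum_ext (f g : nat -> A) n :
  (forall k, (k <= n)%nat -> f k = g k) -> fsum f n = fsum g n.
Proof.
  induction n as [|n IH]; intros H; simpl.
  - apply H; lia.
  - rewrite IH by (intros; apply H; lia). now rewrite H by lia.
Qed.

Lemma fsum_S_l (f : nat -> A) n : fsum f (S n) = add (f O) (fsum (shift f) n).
Proof.
  induction n as [|n IH]; [reflexivity|].
  change (fsum f (S (S n))) with (add (fsum f (S n)) (f (S (S n)))).
  rewrite IH. simpl. unfold shift. ring.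
Qed.

Lemma conv_fsum (a b : nat -> A) n :
  conv a b n = fsum (fun k => mul (a k) (b (n - k)%nat)) n.
Proof.
  revert a; induction n as [|n IH]; intros a; [reflexivity|].
  rewrite fsum_S_l. simpl conv. rewrite IH.
  f_equal.
Qed.

Lemma conv_ext (a a' b b' : nat -> A) n :
  (forall k, (k <= n)%nat -> a k = a' k) -> (forall k, (k <= n)%nat -> b k = b' k) ->
  conv a b n = conv a' b' n.
Proof.
  intros Ha Hb. rewrite !conv_fsum. apply fsum_ext. intros k Hk.
  rewrite Ha, Hb by lia. reflexivity.
Qed.

(** The mirror image of the defining recursion; commutativity follows by playing one against the
    other. *)
Lemma conv_S_r (a b : nat -> A) n :
  conv a b (S n) = add (mul (a (S n)) (b O)) (conv a (shift b) n).
Proof.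
  revert a; induction n as [|n IH]; intros a.
  - simpl. unfold shift. ring.
  - change (conv a b (S (S n))) with
      (add (mul (a O) (b (S (S n)))) (conv (shift a) b (S n))).
    rewrite IH. simpl. unfold shift. ring.
Qed.

Lemma conv_comm (a b : nat -> A) n : conv a b n = conv b a n.
Proof.
  revert b; induction n as [|n IH]; intros b.
  - simpl. ring.
  - rewrite conv_S_r. simpl. rewrite IH. ring.
Qed.

Lemma conv_add_l (a b c : nat -> A) n :
  conv (lift2 add a b) c n = add (conv a c n) (conv b c n).
Proof.
  revert a b; induction n as [|n IH]; intros a b; simpl.
  - unfold lift2. ring.
  - change (shift (lift2 add a b)) with (lift2 add (shift a) (shift b)).
    rewrite IH. unfold lift2. ring.
Qed.

Lemma conv_scal_l (x : A) (a c : nat -> A) n :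
  conv (fun k => mul x (a k)) c n = mul x (conv a c n).
Proof.
  revert a; induction n as [|n IH]; intros a; simpl.
  - ring.
  - change (shift (fun k => mul x (a k))) with (fun k => mul x (shift a k)).
    rewrite IH. ring.
Qed.

Lemma conv_assoc (a b c : nat -> A) n :
  conv (conv a b) c n = conv a (conv b c) n.
Proof.
  revert a b; induction n as [|n IH]; intros a b.
  - simpl. ring.
  - simpl. change (shift (conv a b)) with
      (lift2 add (fun k => mul (a O) (shift b k)) (conv (shift a) b)).
    rewrite conv_add_l, conv_scal_l, IH. ring.
Qed.

Lemma conv_zero_l (b : nat -> A) n : conv (fun _ => zero) b n = zero.
Proof.
  induction n as [|n IH]; simpl; [ring|].
  change (shift (fun _ => zero)) with (fun _ : nat => zero). rewrite IH. ring.
Qed.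

Lemma conv_one_l (b : nat -> A) n : conv (cst one) b n = b n.
Proof.
  destruct n as [|n]; simpl; [ring|].
  change (shift (cst one)) with (fun _ : nat => zero). rewrite conv_zero_l. ring.
Qed.

(** The ring is abstract so that the construction can be applied twice, to [R] for series in [u] and
    then to those for series in [(u, v)]. Functional extensionality makes the laws Leibniz
    equalities, usable by [ring] and [rewrite]. *)
Lemma series_ring_theory :
  ring_theory (fun _ => zero) (cst one) (lift2 add) conv (lift2 sub)
    (fun a n => opp (a n)) (@eq (nat -> A)).
Proof.
  constructor; intros; apply functional_extensionality; intros n; unfold lift2.
  - ring.
  - ring.
  - ring.
  - apply conv_one_l.
  - apply conv_comm.
  - symmetry; apply conv_assoc.
  - apply conv_add_l.
  - ring.
  - ring.
Qed.

(** Iterated addition is the only multiplication by an integer that an abstract ring offers; over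
    the reals it becomes the factor [INR n]. *)
Fixpoint ntimes (n : nat) (x : A) : A :=
  match n with O => zero | S m => add x (ntimes m x) end.

Lemma ntimes_add n x y : ntimes n (add x y) = add (ntimes n x) (ntimes n y).
Proof. induction n as [|n IH]; simpl; [ring|]. rewrite IH; ring. Qed.

Lemma ntimes_mul_r n x y : ntimes n (mul x y) = mul x (ntimes n y).
Proof. induction n as [|n IH]; simpl; [ring|]. rewrite IH; ring. Qed.

(* The Euler operator [t d/dt] is the derivation for which the induction on the
   index goes through; [dif] is its shift. *)
Definition euler (a : nat -> A) : nat -> A := fun n => ntimes n (a n).
Definition dif (a : nat -> A) : nat -> A := fun n => ntimes (S n) (a (S n)).

Lemma euler_conv (a b : nat -> A) n :
  euler (conv a b) n = add (conv (euler a) b n) (conv a (euler b) n).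
Proof.
  revert a; induction n as [|n IH]; intros a.
  - unfold euler; simpl. ring.
  - assert (Hs : shift (euler a) = lift2 add (shift a) (euler (shift a))) by reflexivity.
    assert (H1 : conv (euler a) b (S n) =
                 add (mul (euler a O) (b (S n)))
                     (add (conv (shift a) b n) (conv (euler (shift a)) b n)))
      by (simpl; now rewrite Hs, conv_add_l).
    assert (H2 : conv a (euler b) (S n) =
                 add (mul (a O) (euler b (S n))) (conv (shift a) (euler b) n)) by reflexivity.
    assert (H3 : euler (conv a b) (S n) =
                 add (mul (a O) (euler b (S n)))
                     (add (conv (shift a) b n) (euler (conv (shift a) b) n))).
    { unfold euler at 1. simpl conv. rewrite ntimes_add, ntimes_mul_r. reflexivity. }
    rewrite H1, H2, H3, IH. unfold euler at 4. simpl. ring.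
Qed.

Lemma dif_conv (a b : nat -> A) :
  dif (conv a b) = lift2 add (conv (dif a) b) (conv a (dif b)).
Proof.
  apply functional_extensionality; intros n.
  change (dif (conv a b) n) with (euler (conv a b) (S n)).
  rewrite euler_conv. rewrite (conv_S_r a (euler b)). simpl conv at 1.
  change (shift (euler a)) with (dif a). change (shift (euler b)) with (dif b).
  unfold lift2, euler. simpl. ring.
Qed.

Lemma dif_add (a b : nat -> A) : dif (lift2 add a b) = lift2 add (dif a) (dif b).
Proof.
  apply functional_extensionality; intros n. apply (ntimes_add (S n)).
Qed.

(** Leibniz rule for a derivation of the coefficients, which is what [d/du] is on series in [v];
    [dif_conv] treats the derivation in the series variable itself. *)
Lemma map_derivation_conv (d : A -> A)
  (d_add : forall x y, d (add x y) = add (d x) (d y))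
  (d_mul : forall x y, d (mul x y) = add (mul (d x) y) (mul x (d y)))
  (a b : nat -> A) n :
  d (conv a b n) =
  add (conv (fun k => d (a k)) b n) (conv a (fun k => d (b k)) n).
Proof.
  revert a; induction n as [|n IH]; intros a; simpl.
  - apply d_mul.
  - rewrite d_add, d_mul, IH. unfold shift. ring.
Qed.

End FormalSeries.

(** * Real series in one and in two variables, and their derivations *)

Arguments shift {A}.
Arguments lift2 {A}.
Arguments cst {A}.

(* A series in [u] is [a : nat -> R]; a series in [(u, v)] is
   [a : nat -> nat -> R] with [a j i] the coefficient of [u^i v^j]. *)
Notation ser1 := (nat -> R).
Notation ser2 := (nat -> nat -> R).

Definition mul1 : ser1 -> ser1 -> ser1 := conv R Rplus Rmult.
Definition add1 : ser1 -> ser1 -> ser1 := lift2 Rplus.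
Definition sub1 : ser1 -> ser1 -> ser1 := lift2 Rminus.
Definition opp1 (a : ser1) : ser1 := fun n => - a n.
Definition zero1 : ser1 := fun _ => 0.
Definition one1 : ser1 := cst 0 1.

Definition mul2 : ser2 -> ser2 -> ser2 := conv ser1 add1 mul1.
Definition add2 : ser2 -> ser2 -> ser2 := lift2 add1.
Definition sub2 : ser2 -> ser2 -> ser2 := lift2 sub1.
Definition opp2 (a : ser2) : ser2 := fun n => opp1 (a n).
Definition zero2 : ser2 := fun _ => zero1.
Definition one2 : ser2 := cst zero1 one1.
Definition cst2 (c : R) : ser2 := cst zero1 (cst 0 c).

Definition ring1 : ring_theory zero1 one1 add1 mul1 sub1 opp1 eq :=
  series_ring_theory R 0 1 Rplus Rmult Rminus Ropp RTheory.
Definition ring2 : ring_theory zero2 one2 add2 mul2 sub2 opp2 eq :=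
  series_ring_theory ser1 zero1 one1 add1 mul1 sub1 opp1 ring1.
Add Ring ring1 : ring1.
Add Ring ring2 : ring2.

Definition D1 (a : ser1) : ser1 := fun n => INR (S n) * a (S n).
Definition Du (a : ser2) : ser2 := fun j => D1 (a j).
Definition Dv (a : ser2) : ser2 := fun j i => INR (S j) * a (S j) i.

Lemma ntimes_R n x : ntimes R 0 Rplus n x = INR n * x.
Proof.
  induction n as [|n IH]; [simpl; ring|].
  change (ntimes R 0 Rplus (S n) x) with (x + ntimes R 0 Rplus n x).
  rewrite IH, S_INR. ring.
Qed.

Lemma ntimes_ser1 n (a : ser1) : ntimes ser1 zero1 add1 n a = fun i => INR n * a i.
Proof.
  apply functional_extensionality; intros i.
  induction n as [|n IH]; [unfold zero1; simpl; unfold zero1; ring|].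
  change (a i + ntimes ser1 zero1 add1 n a i = INR (S n) * a i).
  rewrite IH, S_INR. ring.
Qed.

Lemma D1_dif : D1 = dif R 0 Rplus.
Proof.
  apply functional_extensionality; intros a.
  apply functional_extensionality; intros n.
  unfold D1, dif. now rewrite ntimes_R.
Qed.

Lemma Dv_dif : Dv = dif ser1 zero1 add1.
Proof.
  apply functional_extensionality; intros a.
  apply functional_extensionality; intros j.
  unfold Dv, dif. now rewrite ntimes_ser1.
Qed.

Lemma D1_add a b : D1 (add1 a b) = add1 (D1 a) (D1 b).
Proof. rewrite D1_dif. apply (dif_add _ _ _ _ _ _ _ RTheory). Qed.

Lemma D1_mul a b : D1 (mul1 a b) = add1 (mul1 (D1 a) b) (mul1 a (D1 b)).
Proof. rewrite D1_dif. apply (dif_conv _ _ _ _ _ _ _ RTheory). Qed.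

Lemma Dv_add a b : Dv (add2 a b) = add2 (Dv a) (Dv b).
Proof. rewrite Dv_dif. apply (dif_add _ _ _ _ _ _ _ ring1). Qed.

Lemma Dv_mul a b : Dv (mul2 a b) = add2 (mul2 (Dv a) b) (mul2 a (Dv b)).
Proof. rewrite Dv_dif. apply (dif_conv _ _ _ _ _ _ _ ring1). Qed.

Lemma Du_add a b : Du (add2 a b) = add2 (Du a) (Du b).
Proof. apply functional_extensionality; intros j. apply D1_add. Qed.

Lemma Du_mul a b : Du (mul2 a b) = add2 (mul2 (Du a) b) (mul2 a (Du b)).
Proof.
  apply functional_extensionality; intros j.
  apply (map_derivation_conv _ _ _ _ _ _ _ ring1 D1 D1_add D1_mul).
Qed.

Lemma Du_sub a b : Du (sub2 a b) = sub2 (Du a) (Du b).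
Proof.
  apply functional_extensionality; intros j; apply functional_extensionality; intros i.
  unfold Du, D1, sub2, sub1, lift2. ring.
Qed.

Lemma Dv_sub a b : Dv (sub2 a b) = sub2 (Dv a) (Dv b).
Proof.
  apply functional_extensionality; intros j; apply functional_extensionality; intros i.
  unfold Dv, sub2, sub1, lift2. ring.
Qed.

Lemma Du_Dv a : Du (Dv a) = Dv (Du a).
Proof.
  apply functional_extensionality; intros j; apply functional_extensionality; intros i.
  unfold Du, Dv, D1. ring.
Qed.

(** * Substitution, and congruence modulo powers of [v] *)

Fixpoint pow2 (a : ser2) (n : nat) : ser2 :=
  match n with O => one2 | S m => mul2 a (pow2 a m) end.

(** The substitution [c(a)], intended for [a O O = 0]. As [Series] is total, congruent arguments
    give congruent results before any convergence is known. *)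
Definition comp (c : ser1) (a : ser2) : ser2 :=
  fun j i => Series (fun n => c n * pow2 a n j i).

(** Congruence modulo [v^n]. The ring operations and [Du] respect it, [Dv] loses one order and [Jv]
    gains one; this is the whole bookkeeping behind formal existence and uniqueness. *)
Definition agree (n : nat) (a b : ser2) : Prop := forall j, (j < n)%nat -> a j = b j.

Lemma agree_mul n a a' b b' :
  agree n a a' -> agree n b b' -> agree n (mul2 a b) (mul2 a' b').
Proof.
  intros Ha Hb j Hj. apply conv_ext with (1 := ring1); intros; [apply Ha|apply Hb]; lia.
Qed.

Lemma agree_add n a a' b b' :
  agree n a a' -> agree n b b' -> agree n (add2 a b) (add2 a' b').
Proof. intros Ha Hb j Hj. unfold add2, lift2. now rewrite Ha, Hb. Qed.

Lemma agree_sub n a a' b b' :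
  agree n a a' -> agree n b b' -> agree n (sub2 a b) (sub2 a' b').
Proof. intros Ha Hb j Hj. unfold sub2, lift2. now rewrite Ha, Hb. Qed.

Lemma agree_opp n a a' : agree n a a' -> agree n (opp2 a) (opp2 a').
Proof. intros Ha j Hj. unfold opp2. now rewrite Ha. Qed.

Lemma agree_Du n a a' : agree n a a' -> agree n (Du a) (Du a').
Proof. intros Ha j Hj. unfold Du. now rewrite Ha. Qed.

Lemma agree_Dv n a a' : agree (S n) a a' -> agree n (Dv a) (Dv a').
Proof. intros Ha j Hj. unfold Dv. now rewrite Ha by lia. Qed.

Lemma agree_refl n a : agree n a a.
Proof. intros j Hj; reflexivity. Qed.

Lemma agree_sym n a b : agree n a b -> agree n b a.
Proof. intros H j Hj; symmetry; now apply H. Qed.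

Lemma agree_trans n a b c : agree n a b -> agree n b c -> agree n a c.
Proof. intros H H' j Hj; rewrite H by easy; now apply H'. Qed.

Lemma agree_le n m a b : (n <= m)%nat -> agree m a b -> agree n a b.
Proof. intros Hn H j Hj; apply H; lia. Qed.

Lemma agree_all a b : (forall n, agree n a b) -> a = b.
Proof. intros H; apply functional_extensionality; intros j; apply (H (S j)); lia. Qed.

Lemma agree_pow n k a a' : agree n a a' -> agree n (pow2 a k) (pow2 a' k).
Proof.
  intros H; induction k as [|k IH]; simpl; [apply agree_refl|now apply agree_mul].
Qed.

Lemma agree_comp n c a a' : agree n a a' -> agree n (comp c a) (comp c a').
Proof.
  intros H j Hj. apply functional_extensionality; intros i. unfold comp.
  apply Series_ext; intros k. now rewrite (agree_pow n k a a' H j Hj).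
Qed.

Lemma agree_S_Dv n a b : (forall i, a O i = b O i) -> agree n (Dv a) (Dv b) -> agree (S n) a b.
Proof.
  intros H0 H [|j] Hj; apply functional_extensionality; intros i; [apply H0|].
  assert (E : Dv a j i = Dv b j i) by (rewrite H by lia; reflexivity).
  unfold Dv in E. apply Rmult_eq_reg_l in E; [exact E|]. apply not_0_INR; lia.
Qed.

(** * Conformality *)

(* [G] stands for [phi'(z)]. *)
Definition pde_lin (G X Z : ser2) : ser2 :=
  add2 (add2 (Du (Du X)) (Dv (Dv X)))
    (mul2 G (add2 (mul2 (Du X) (Du Z)) (mul2 (Dv X) (Dv Z)))).
Definition grad2 (X : ser2) : ser2 :=
  add2 (mul2 (Du X) (Du X)) (mul2 (Dv X) (Dv X)).
(** The coefficient 1/2 is that of the minimality equation for [z]; the cancellation in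
    [conf_system] rests on it. *)
Definition pde_z (G X Y Z : ser2) : ser2 :=
  add2 (add2 (Du (Du Z)) (Dv (Dv Z)))
    (mul2 (cst2 (/ 2)) (mul2 G (sub2 (grad2 Z) (add2 (grad2 X) (grad2 Y))))).

Lemma half2 : add2 (cst2 (/ 2)) (cst2 (/ 2)) = one2.
Proof.
  apply functional_extensionality; intros [|j]; apply functional_extensionality; intros [|i];
  unfold add2, add1, lift2, cst2, one2, one1, cst, zero1; lra.
Qed.

Definition conf_S (X Y Z : ser2) : ser2 :=
  add2 (mul2 (Du X) (Dv X)) (add2 (mul2 (Du Y) (Dv Y)) (mul2 (Du Z) (Dv Z))).
Definition conf_P (X Y Z : ser2) : ser2 :=
  sub2 (add2 (mul2 (Du X) (Du X)) (add2 (mul2 (Du Y) (Du Y)) (mul2 (Du Z) (Du Z))))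
       (add2 (mul2 (Dv X) (Dv X)) (add2 (mul2 (Dv Y) (Dv Y)) (mul2 (Dv Z) (Dv Z)))).

(* [Q = P - 2iS] satisfies [Q_xibar = - phi'(z) z_xibar Q]; this is its real part and
   its imaginary part. *)
Lemma conf_system G X Y Z :
  pde_lin G X Z = zero2 -> pde_lin G Y Z = zero2 -> pde_z G X Y Z = zero2 ->
  let P := conf_P X Y Z in let S := conf_S X Y Z in
  Dv P = sub2 (add2 (Du S) (Du S))
           (mul2 G (sub2 (mul2 (Dv Z) P) (add2 (mul2 (Du Z) S) (mul2 (Du Z) S)))) /\
  add2 (Dv S) (Dv S) = opp2 (add2 (Du P)
           (mul2 G (add2 (mul2 (Du Z) P) (add2 (mul2 (Dv Z) S) (mul2 (Dv Z) S))))).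
Proof.
  intros H1 H2 H3 P S0.
  assert (E1 : Dv (Dv X) = sub2 (opp2 (Du (Du X)))
    (mul2 G (add2 (mul2 (Du X) (Du Z)) (mul2 (Dv X) (Dv Z))))).
  { transitivity (add2 (Dv (Dv X)) (opp2 (pde_lin G X Z))).
    - rewrite H1. ring. - unfold pde_lin. ring. }
  assert (E2 : Dv (Dv Y) = sub2 (opp2 (Du (Du Y)))
    (mul2 G (add2 (mul2 (Du Y) (Du Z)) (mul2 (Dv Y) (Dv Z))))).
  { transitivity (add2 (Dv (Dv Y)) (opp2 (pde_lin G Y Z))).
    - rewrite H2. ring. - unfold pde_lin. ring. }
  assert (E3 : Dv (Dv Z) = sub2 (opp2 (Du (Du Z)))
    (mul2 (cst2 (/2)) (mul2 G (sub2 (grad2 Z) (add2 (grad2 X) (grad2 Y)))))).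
  { transitivity (add2 (Dv (Dv Z)) (opp2 (pde_z G X Y Z))).
    - rewrite H3. ring. - unfold pde_z. ring. }
  pose proof half2 as Hh.
  (* To [ring] the constant series is opaque: 1/2 becomes a variable [h] known only through
     [h + h = 1]. *)
  generalize dependent (cst2 (/2)). intros h E3 Hh.
  unfold P, S0, conf_P, conf_S.
  repeat rewrite ?Du_add, ?Dv_add, ?Du_sub, ?Dv_sub, ?Du_mul, ?Dv_mul.
  rewrite <- !Du_Dv in *. unfold grad2 in E3.
  rewrite E1, E2, E3.
  generalize (Du (Dv X)) (Du (Dv Y)) (Du (Dv Z)) (Du (Du X)) (Du (Du Y)) (Du (Du Z)).
  generalize (Du X) (Du Y) (Du Z) (Dv X) (Dv Y) (Dv Z).
  intros xu yu zu xv yv zv xuv yuv zuv xuu yuu zuu.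
  split.
  (* The two sides differ by a multiple of [h + h - 1]. The multiplier is read off from the term
     [z_v z_vv] of [P_v], the only place where [h] enters; for the second identity it comes from
     [z_u z_vv]. *)
  - match goal with |- ?l = ?r => transitivity (sub2 l (mul2 (sub2 (add2 h h) one2)
      (mul2 G (mul2 zv (sub2 (add2 (mul2 zu zu) (mul2 zv zv)) (add2 (add2 (mul2 xu xu) (mul2 xv xv)) (add2 (mul2 yu yu) (mul2 yv yv)))))))) end.
    + rewrite Hh. ring.
    + ring.
  - match goal with |- ?l = ?r => transitivity (add2 l (mul2 (sub2 (add2 h h) one2)
      (mul2 G (mul2 zu (sub2 (add2 (mul2 zu zu) (mul2 zv zv)) (add2 (add2 (mul2 xu xu) (mul2 xv xv)) (add2 (mul2 yu yu) (mul2 yv yv)))))))) end.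
    + rewrite Hh. ring.
    + ring.
Qed.

(** Induction on the order in [v]: the system is linear, homogeneous and solved for the
    [v]-derivatives, so if [P] and [S] vanish modulo [v^n] their [v]-derivatives do too, and with
    the zero rows they vanish modulo [v^(n+1)]. *)
Lemma conf_zero G X Y Z :
  pde_lin G X Z = zero2 -> pde_lin G Y Z = zero2 -> pde_z G X Y Z = zero2 ->
  conf_P X Y Z O = zero1 -> conf_S X Y Z O = zero1 ->
  conf_P X Y Z = zero2 /\ conf_S X Y Z = zero2.
Proof.
  intros H1 H2 H3 HP HS.
  destruct (conf_system G X Y Z H1 H2 H3) as [EP ES].
  set (P := conf_P X Y Z) in *. set (S0 := conf_S X Y Z) in *.
  assert (H : forall n, agree n P zero2 /\ agree n S0 zero2).
  { induction n as [|n [IP IS]]; [split; intros j Hj; lia|].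
    assert (DuZ0 : Du zero2 = zero2).
    { apply functional_extensionality; intros j; apply functional_extensionality; intros i.
      unfold Du, D1, zero2, zero1. ring. }
    split; (apply agree_S_Dv; [intros i|]).
    - now rewrite HP.
    - rewrite EP. apply agree_trans with (Dv zero2).
      2: apply agree_refl.
      replace (Dv zero2) with (sub2 (add2 (Du zero2) (Du zero2))
           (mul2 G (sub2 (mul2 (Dv Z) zero2) (add2 (mul2 (Du Z) zero2) (mul2 (Du Z) zero2))))).
      + repeat first [ assumption | apply agree_refl | apply agree_sub | apply agree_add
                     | apply agree_mul | apply agree_Du ].
      + rewrite DuZ0. transitivity zero2; [ring|].
        apply functional_extensionality; intros j; apply functional_extensionality; intros i.
        unfold Dv, zero2, zero1. ring.
    - now rewrite HS.
    - assert (E : agree n (add2 (Dv S0) (Dv S0)) zero2).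
      { rewrite ES.
        replace zero2 with (opp2 (add2 (Du zero2)
           (mul2 G (add2 (mul2 (Du Z) zero2) (add2 (mul2 (Dv Z) zero2) (mul2 (Dv Z) zero2)))))) at 1.
        + repeat first [ assumption | apply agree_refl | apply agree_opp | apply agree_add
                     | apply agree_mul | apply agree_Du ].
        + rewrite DuZ0. ring. }
      intros j Hj. specialize (E j Hj). apply functional_extensionality; intros i.
      apply (f_equal (fun a => a i)) in E.
      unfold add2, add1, lift2, zero2, zero1 in E. unfold Dv, zero2, zero1 in *. lra. }
  split; apply agree_all; intros n; apply (H n).
Qed.

(** * Formal solutions and their uniqueness *)

Definition formal_solution (c : ser1) (X Y Z : ser2) : Prop :=
  let G := comp c (sub2 Z (cst2 (Z O O))) in
  pde_lin G X Z = zero2 /\ pde_lin G Y Z = zero2 /\ pde_z G X Y Z = zero2.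

(** Modulo [v^(n+2)] the unknowns determine their first [v]-derivatives, and [G], modulo [v^(n+1)],
    hence also the second [v]-derivatives given by the equations, hence themselves modulo [v^(n+3)].
    The series [c] stands for [phi'] expanded at [Z O O], a value which both solutions share. *)
Lemma formal_unique c X Y Z X' Y' Z' :
  formal_solution c X Y Z -> formal_solution c X' Y' Z' ->
  agree 2 X X' -> agree 2 Y Y' -> agree 2 Z Z' -> X = X' /\ Y = Y' /\ Z = Z'.
Proof.
  intros (H1 & H2 & H3) (H1' & H2' & H3') AX AY AZ.
  assert (E0 : Z O O = Z' O O) by (rewrite AZ by lia; reflexivity).
  set (G := comp c (sub2 Z (cst2 (Z O O)))) in *.
  set (G' := comp c (sub2 Z' (cst2 (Z' O O)))) in *.
  assert (H : forall n, agree (S (S n)) X X' /\ agree (S (S n)) Y Y' /\ agree (S (S n)) Z Z').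
  { induction n as [|n (IX & IY & IZ)]; [now repeat split|].
    assert (AG : agree (S n) G G').
    { unfold G, G'. rewrite E0. apply agree_comp, agree_sub; [|apply agree_refl].
      apply agree_le with (2 := IZ); lia. }
    assert (affine_v : forall U U' , pde_lin G U Z = zero2 -> pde_lin G' U' Z' = zero2 ->
       agree (S (S n)) U U' -> agree (S n) (Dv (Dv U)) (Dv (Dv U'))).
    { intros U U' HU HU' AU.
      replace (Dv (Dv U)) with (sub2 (opp2 (Du (Du U)))
         (mul2 G (add2 (mul2 (Du U) (Du Z)) (mul2 (Dv U) (Dv Z))))).
      2:{ transitivity (sub2 (Dv (Dv U)) (pde_lin G U Z)); [unfold pde_lin|rewrite HU]; ring. }
      replace (Dv (Dv U')) with (sub2 (opp2 (Du (Du U')))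
         (mul2 G' (add2 (mul2 (Du U') (Du Z')) (mul2 (Dv U') (Dv Z'))))).
      2:{ transitivity (sub2 (Dv (Dv U')) (pde_lin G' U' Z')); [unfold pde_lin|rewrite HU']; ring. }
      repeat first [ assumption | apply agree_refl | apply agree_opp | apply agree_add
                   | apply agree_sub | apply agree_mul | apply agree_Du | apply agree_Dv
                   | (eapply agree_le; [|eassumption]; lia)]. }
    assert (conc : forall U U', agree (S (S n)) U U' -> agree (S n) (Dv (Dv U)) (Dv (Dv U')) ->
       agree (S (S (S n))) U U').
    { intros U U' AU AD. apply agree_S_Dv; [intros i; now rewrite AU by lia|].
      apply agree_S_Dv; [intros i; unfold Dv; now rewrite AU by lia|exact AD]. }
    repeat split; apply conc; auto.
    replace (Dv (Dv Z)) with (sub2 (opp2 (Du (Du Z)))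
      (mul2 (cst2 (/ 2)) (mul2 G (sub2 (grad2 Z) (add2 (grad2 X) (grad2 Y)))))).
    2:{ transitivity (sub2 (Dv (Dv Z)) (pde_z G X Y Z)); [unfold pde_z|rewrite H3]; ring. }
    replace (Dv (Dv Z')) with (sub2 (opp2 (Du (Du Z')))
      (mul2 (cst2 (/ 2)) (mul2 G' (sub2 (grad2 Z') (add2 (grad2 X') (grad2 Y')))))).
    2:{ transitivity (sub2 (Dv (Dv Z')) (pde_z G' X' Y' Z')); [unfold pde_z|rewrite H3']; ring. }
    unfold grad2.
    repeat first [ assumption | apply agree_refl | apply agree_opp | apply agree_add
                 | apply agree_sub | apply agree_mul | apply agree_Du | apply agree_Dv
                 | (eapply agree_le; [|eassumption]; lia)]. }
  repeat split; apply agree_all; intros n; apply agree_le with (m := S (S n)); try lia; apply (H n).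
Qed.

(** * Majorants *)

Lemma mul1_dom (a b f g : ser1) n :
  (forall k, Rabs (a k) <= f k) -> (forall k, Rabs (b k) <= g k) ->
  Rabs (mul1 a b n) <= mul1 f g n.
Proof.
  revert a f; induction n as [|n IH]; intros a f Ha Hb; unfold mul1; simpl.
  - rewrite Rabs_mult. apply Rmult_le_compat; auto using Rabs_pos.
  - eapply Rle_trans; [apply Rabs_triang|]. apply Rplus_le_compat.
    + rewrite Rabs_mult. apply Rmult_le_compat; auto using Rabs_pos.
    + apply IH; auto. intros k; apply Ha.
Qed.

Lemma mul2_dom (a b f g : ser2) j i :
  (forall l k, Rabs (a l k) <= f l k) -> (forall l k, Rabs (b l k) <= g l k) ->
  Rabs (mul2 a b j i) <= mul2 f g j i.
Proof.
  revert a f; induction j as [|j IH]; intros a f Ha Hb; unfold mul2; simpl.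
  - apply mul1_dom; auto.
  - unfold add1 at 1, lift2 at 1. eapply Rle_trans; [apply Rabs_triang|].
    unfold add1 at 2, lift2 at 1.
    apply Rplus_le_compat; [apply mul1_dom; auto|].
    apply IH; auto. intros l k; apply Ha.
Qed.

Lemma fsum_le (f g : nat -> R) n :
  (forall k, (k <= n)%nat -> f k <= g k) -> fsum R Rplus f n <= fsum R Rplus g n.
Proof.
  induction n as [|n IH]; intros H; simpl; [apply H; lia|].
  apply Rplus_le_compat; [apply IH; intros; apply H; lia|apply H; lia].
Qed.

Lemma fsum_plus (f g : nat -> R) n :
  fsum R Rplus (fun k => f k + g k) n = fsum R Rplus f n + fsum R Rplus g n.
Proof. induction n as [|n IH]; simpl; [reflexivity|]. rewrite IH; ring. Qed.

Lemma fsum_scal (c : R) (f : nat -> R) n :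
  fsum R Rplus (fun k => c * f k) n = c * fsum R Rplus f n.
Proof. induction n as [|n IH]; simpl; [reflexivity|]. rewrite IH; ring. Qed.

Definition wt (rho : R) : ser1 := fun n => rho ^ n / (INR n + 1) ^ 2.

(** Telescoping of [1/(n+2)^2 <= 1/(n+1) - 1/(n+2)]. The bound 2, used for each of two sums,
    together with the factor 2 of the elementary inequality, yields the constant 8 of [wt_mul]. *)
Lemma sum_inv_sq n : fsum R Rplus (fun k => / (INR k + 1) ^ 2) n <= 2 - / (INR n + 1).
Proof.
  induction n as [|n IH]; [simpl; lra|].
  change (fsum R Rplus (fun k => / (INR k + 1) ^ 2) (S n)) with
    (fsum R Rplus (fun k => / (INR k + 1) ^ 2) n + / (INR (S n) + 1) ^ 2).
  rewrite S_INR. pose proof (pos_INR n) as Hn.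
  apply Rle_trans with (2 - / (INR n + 1) + / (INR n + 1 + 1) ^ 2); [lra|].
  assert (H : / (INR n + 1 + 1) ^ 2 <= / (INR n + 1) - / (INR n + 1 + 1)).
  { replace (/ (INR n + 1) - / (INR n + 1 + 1)) with (/ ((INR n + 1) * (INR n + 1 + 1))).
    - apply Rinv_le_contravar; nra.
    - field; lra. }
  lra.
Qed.

Lemma wt_pos rho n : 0 < rho -> 0 < wt rho n.
Proof.
  intros H. unfold wt. pose proof (pos_INR n).
  apply Rdiv_lt_0_compat; apply pow_lt; lra.
Qed.

(* With [s = k+1], [t = n-k+1]: [1/(st)^2 = (1/s + 1/t)^2/(s+t)^2 <= 2(1/s^2 + 1/t^2)/(s+t)^2]. *)
Lemma wt_mul rho n : 0 < rho -> mul1 (wt rho) (wt rho) n <= 8 * wt rho n.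
Proof.
  intros Hr. set (g := fun k : nat => / (INR k + 1) ^ 2).
  set (e := fun _ : nat => 1).
  set (K := rho ^ n * (2 / (INR n + 2) ^ 2)).
  pose proof (pos_INR n) as Hn.
  assert (HK : 0 <= K).
  { apply Rmult_le_pos; [apply pow_le; lra|]. apply Rlt_le, Rdiv_lt_0_compat; [lra|].
    apply pow_lt; lra. }
  apply Rle_trans with (K * (mul1 g e n + mul1 e g n)).
  - unfold mul1. rewrite !(conv_fsum _ _ _ _ _ _ _ RTheory).
    rewrite <- fsum_plus, <- fsum_scal. apply fsum_le. intros k Hk.
    unfold wt, g, e, K.
    replace (rho ^ n) with (rho ^ k * rho ^ (n - k)) by (rewrite <- pow_add; f_equal; lia).
    rewrite minus_INR by lia.
    assert (Hk' : INR k <= INR n) by (apply le_INR; lia).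
    pose proof (pos_INR k).
    set (s := INR k + 1). set (t := INR n - INR k + 1).
    assert (Hs : 0 < s) by (unfold s; lra). assert (Ht : 0 < t) by (unfold t; lra).
    replace (INR n + 2) with (s + t) by (unfold s, t; ring).
    apply Rle_trans with (rho ^ k * rho ^ (n - k) * (/ s ^ 2 * / t ^ 2)).
    { right. field. lra. }
    rewrite Rmult_assoc with (r1 := rho ^ k * rho ^ (n - k)).
    apply Rmult_le_compat_l; [apply Rmult_le_pos; apply pow_le; lra|].
    apply Rminus_le_0.
    replace (2 / (s + t) ^ 2 * (/ s ^ 2 * 1 + 1 * / t ^ 2) - / s ^ 2 * / t ^ 2)
      with ((s - t) ^ 2 / ((s + t) ^ 2 * s ^ 2 * t ^ 2)) by (field; lra).
    apply Rmult_le_pos; [apply pow2_ge_0|]. apply Rlt_le, Rinv_0_lt_compat.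
    repeat (apply Rmult_lt_0_compat; [|apply pow_lt; lra]). apply pow_lt; lra.
  - assert (E : mul1 e g n = mul1 g e n) by apply (conv_comm _ _ _ _ _ _ _ RTheory).
    rewrite E. assert (Hg : mul1 g e n <= 2).
    { unfold mul1. rewrite (conv_fsum _ _ _ _ _ _ _ RTheory).
      rewrite (fsum_ext _ Rplus _ g) by (intros; unfold e; ring).
      eapply Rle_trans; [apply sum_inv_sq|]. pose proof (Rinv_0_lt_compat (INR n + 1) ltac:(lra)). lra. }
    apply Rle_trans with (K * 4).
    { apply Rmult_le_compat_l; lra. }
    unfold K, wt.
    apply Rle_trans with (rho ^ n * (8 * / (INR n + 2) ^ 2)).
    + right. field. lra.
    + unfold Rdiv. replace (8 * (rho ^ n * / (INR n + 1) ^ 2)) with (rho ^ n * (8 * / (INR n + 1) ^ 2)) by ring.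
      apply Rmult_le_compat_l; [apply pow_le; lra|]. apply Rmult_le_compat_l; [lra|].
      apply Rinv_le_contravar; [apply pow_lt; lra|]. apply pow_incr; lra.
Qed.

(* The coefficients of [sum_n w_n (u + 2 v)^n]. *)
Definition lin_ext (w : ser1) : ser2 :=
  fun j i => w (i + j)%nat * 2 ^ j * (INR (fact (i + j)) / (INR (fact i) * INR (fact j))).

Lemma lin_ext_S w j i :
  lin_ext w (S j) i = 2 * (INR (S i) / INR (S j)) * lin_ext w j (S i).
Proof.
  unfold lin_ext. replace (i + S j)%nat with (S i + j)%nat by lia.
  rewrite (fact_simpl i), (fact_simpl j), !mult_INR. simpl pow.
  assert (H := INR_fact_neq_0 i). assert (H' := INR_fact_neq_0 j).
  assert (Hi := not_0_INR (S i) ltac:(lia)). assert (Hj := not_0_INR (S j) ltac:(lia)).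
  field. auto.
Qed.

Lemma lin_ext_Dv w : Dv (lin_ext w) = add2 (Du (lin_ext w)) (Du (lin_ext w)).
Proof.
  apply functional_extensionality; intros j; apply functional_extensionality; intros i.
  unfold Dv, Du, D1, add2, add1, lift2. rewrite lin_ext_S.
  field. apply not_0_INR; lia.
Qed.

Lemma lin_ext_0 w : lin_ext w O = w.
Proof.
  apply functional_extensionality; intros i. unfold lin_ext.
  rewrite Nat.add_0_r. simpl. field. apply INR_fact_neq_0.
Qed.

(* Both sides solve the transport equation [d/dv = 2 d/du] with the same initial row. *)
Lemma lin_ext_mul w w' : mul2 (lin_ext w) (lin_ext w') = lin_ext (mul1 w w').
Proof.
  set (W := mul2 (lin_ext w) (lin_ext w')).
  assert (E : Dv W = add2 (Du W) (Du W)).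
  { unfold W. rewrite Dv_mul, Du_mul, !lin_ext_Dv. ring. }
  assert (E0 : W O = mul1 w w').
  { unfold W, mul2. simpl. now rewrite !lin_ext_0. }
  apply agree_all. induction n as [|n IH]; [intros j Hj; lia|].
  apply agree_S_Dv.
  - intros i. now rewrite E0, lin_ext_0.
  - rewrite E, lin_ext_Dv. apply agree_add; apply agree_Du; exact IH.
Qed.

Lemma fact_mul_le i j : (fact i * fact j <= fact (i + j))%nat.
Proof.
  induction i as [|i IH]; [simpl; lia|].
  change (S i + j)%nat with (S (i + j)). rewrite !fact_simpl. nia.
Qed.

(** [C(i+j, i) <= 2^(i+j)], by Pascal's rule. *)
Lemma fact_add_le i j : (fact (i + j) <= 2 ^ (i + j) * (fact i * fact j))%nat.
Proof.
  remember (i + j)%nat as n eqn:En. revert i j En.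
  induction n as [|n IH]; intros i j En.
  - assert (i = O) by lia. assert (j = O) by lia. subst. simpl. lia.
  - destruct i as [|i].
    { assert (j = S n) by lia. subst j. pose proof (Nat.pow_nonzero 2 (S n)). 
      change (fact 0) with 1%nat. nia. }
    destruct j as [|j].
    { assert (i = n) by lia. subst i. pose proof (Nat.pow_nonzero 2 (S n)).
      change (fact 0) with 1%nat. nia. }
    assert (H1 := IH i (S j) ltac:(lia)). assert (H2 := IH (S i) j ltac:(lia)).
    rewrite (fact_simpl n). replace (S n) with (S i + S j)%nat at 1 by lia.
    rewrite Nat.pow_succ_r'. rewrite (fact_simpl i) in *. rewrite (fact_simpl j) in *.
    set (p := (2 ^ n)%nat) in *. nia.
Qed.

(** * The weighted norm attached to the majorant *)

Section Weights.

Variable rho : R.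
Hypothesis rho_pos : 0 < rho.

(** The coefficients of the majorant [F]. *)
Definition bw : ser2 := lin_ext (wt rho).

Lemma fact_quot i j :
  1 <= INR (fact (i + j)) / (INR (fact i) * INR (fact j)) <= 2 ^ (i + j).
Proof.
  assert (H : 0 < INR (fact i) * INR (fact j)) by
    (apply Rmult_lt_0_compat; apply INR_fact_lt_0).
  split.
  - apply Rle_div_r; [exact H|]. rewrite Rmult_1_l, <- mult_INR.
    apply le_INR, fact_mul_le.
  - apply Rle_div_l; [exact H|]. rewrite <- mult_INR.
    replace (2 ^ (i + j)) with (INR (2 ^ (i + j))) by (rewrite pow_INR; reflexivity).
    rewrite <- mult_INR. apply le_INR, fact_add_le.
Qed.

Lemma bw_ge i j : wt rho (i + j) <= bw j i.
Proof.
  unfold bw, lin_ext. pose proof (wt_pos rho (i + j) rho_pos).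
  pose proof (fact_quot i j). pose proof (pow_R1_Rle 2 j ltac:(lra)).
  rewrite Rmult_assoc. rewrite <- (Rmult_1_r (wt rho (i + j))) at 1.
  apply Rmult_le_compat_l; nra.
Qed.

Lemma bw_pos j i : 0 < bw j i.
Proof. eapply Rlt_le_trans; [|apply bw_ge]. now apply wt_pos. Qed.

(** The slope contributes [2^j] and the binomial coefficient at most [2^(i+j)]. A series dominated
    by a multiple of [F] therefore converges for [|u|, |v| < 1/(4 rho)]. *)
Lemma bw_le j i : bw j i <= (4 * rho) ^ (i + j).
Proof.
  unfold bw, lin_ext, wt. pose proof (fact_quot i j) as Hf.
  pose proof (pos_INR (i + j)).
  replace ((4 * rho) ^ (i + j)) with (rho ^ (i + j) * 2 ^ (i + j) * 2 ^ (i + j)).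
  2:{ rewrite <- !Rpow_mult_distr. f_equal; ring. }
  assert (Hr : 0 < rho ^ (i + j)) by now apply pow_lt.
  assert (Hj : 2 ^ j <= 2 ^ (i + j)) by (apply Rle_pow; [lra|lia]).
  assert (Hp : 0 < 2 ^ j) by (apply pow_lt; lra).
  assert (Hq : rho ^ (i + j) / (INR (i + j) + 1) ^ 2 <= rho ^ (i + j)).
  { apply Rle_div_l; [apply pow_lt; lra|]. rewrite <- (Rmult_1_r (rho ^ (i + j))) at 1.
    apply Rmult_le_compat_l; [lra|]. apply pow_R1_Rle; lra. }
  apply Rmult_le_compat; [|lra| |lra].
  - apply Rmult_le_pos; [|lra]. apply Rlt_le, wt_pos, rho_pos.
  - apply Rmult_le_compat; try lra. apply Rlt_le, wt_pos, rho_pos.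
Qed.

(** The ball of radius [d] for the norm [sup |a j i| / bw j i]. *)
Definition bnd (d : R) (a : ser2) : Prop := forall j i, Rabs (a j i) <= d * bw j i.

Lemma bnd_nonneg d a : bnd d a -> 0 <= d.
Proof.
  intros H. specialize (H O O). pose proof (bw_pos O O). pose proof (Rabs_pos (a O O)). nra.
Qed.

Lemma bnd_le d d' a : d <= d' -> bnd d a -> bnd d' a.
Proof.
  intros H Ha j i. pose proof (bw_pos j i). specialize (Ha j i). nra.
Qed.

Lemma bnd_add d d' a b : bnd d a -> bnd d' b -> bnd (d + d') (add2 a b).
Proof.
  intros Ha Hb j i. unfold add2, add1, lift2.
  eapply Rle_trans; [apply Rabs_triang|]. specialize (Ha j i); specialize (Hb j i). lra.
Qed.

Lemma bnd_opp d a : bnd d a -> bnd d (opp2 a).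
Proof. intros Ha j i. unfold opp2, opp1. now rewrite Rabs_Ropp. Qed.

Lemma bnd_sub d d' a b : bnd d a -> bnd d' b -> bnd (d + d') (sub2 a b).
Proof.
  intros Ha Hb j i. unfold sub2, sub1, lift2, Rminus.
  eapply Rle_trans; [apply Rabs_triang|]. rewrite Rabs_Ropp.
  specialize (Ha j i); specialize (Hb j i). lra.
Qed.

Lemma mul2_scal_bw d d' j i :
  mul2 (fun l k => d * bw l k) (fun l k => d' * bw l k) j i = d * d' * mul2 bw bw j i.
Proof.
  unfold bw.
  replace (fun l k => d * lin_ext (wt rho) l k) with (lin_ext (fun n => d * wt rho n)).
  2:{ apply functional_extensionality; intros l; apply functional_extensionality; intros k.
      unfold lin_ext. ring. }
  replace (fun l k => d' * lin_ext (wt rho) l k) with (lin_ext (fun n => d' * wt rho n)).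
  2:{ apply functional_extensionality; intros l; apply functional_extensionality; intros k.
      unfold lin_ext. ring. }
  rewrite !lin_ext_mul. unfold lin_ext. unfold mul1.
  rewrite (conv_scal_l _ _ _ _ _ _ _ RTheory).
  rewrite (conv_comm _ _ _ _ _ _ _ RTheory (wt rho)).
  rewrite (conv_scal_l _ _ _ _ _ _ _ RTheory). ring.
Qed.

(** [lin_ext] is multiplicative, so [F * F] is the extension of [wt * wt] and the one-variable
    inequality suffices. *)
Lemma bnd_mul d d' a b : bnd d a -> bnd d' b -> bnd (8 * d * d') (mul2 a b).
Proof.
  intros Ha Hb j i. pose proof (bnd_nonneg _ _ Ha). pose proof (bnd_nonneg _ _ Hb).
  eapply Rle_trans; [apply (mul2_dom a b _ _ j i Ha Hb)|].
  rewrite mul2_scal_bw. unfold bw. rewrite lin_ext_mul.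
  replace (8 * d * d' * lin_ext (wt rho) j i) with (d * d' * (8 * lin_ext (wt rho) j i)) by ring.
  apply Rmult_le_compat_l; [now apply Rmult_le_pos|].
  unfold lin_ext. pose proof (wt_mul rho (i + j) rho_pos).
  pose proof (fact_quot i j). assert (0 < 2 ^ j) by (apply pow_lt; lra).
  set (q := INR (fact (i + j)) / (INR (fact i) * INR (fact j))) in *.
  replace (8 * (wt rho (i + j) * 2 ^ j * q)) with (8 * wt rho (i + j) * (2 ^ j * q)) by ring.
  rewrite (Rmult_assoc _ (2 ^ j) q).
  apply Rmult_le_compat_r; [nra|]. assumption.
Qed.

Lemma bnd_cst c : bnd (Rabs c) (cst2 c).
Proof.
  intros j i. pose proof (bw_pos j i). pose proof (Rabs_pos c).
  destruct j as [|j]; [destruct i as [|i]|]; simpl; unfold zero1.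
  - unfold bw. rewrite lin_ext_0. unfold wt. simpl. right; field.
  - rewrite Rabs_R0. nra.
  - rewrite Rabs_R0. nra.
Qed.

Lemma bnd_pow d a n : bnd d a -> bnd ((8 * d) ^ n) (pow2 a n).
Proof.
  intros Ha. induction n as [|n IH].
  - replace ((8 * d) ^ 0) with (Rabs 1) by (simpl; apply Rabs_R1). apply (bnd_cst 1).
  - apply bnd_le with (8 * d * (8 * d) ^ n); [simpl; lra|]. now apply bnd_mul.
Qed.

(** The [n]-th term is dominated by [C (8 d s)^n F]: a geometric series of ratio at most 1/2, whence
    the constant [2 C]. *)
Lemma bnd_comp C s c d a :
  0 <= s -> (forall n, Rabs (c n) <= C * s ^ n) -> 8 * d * s <= / 2 -> bnd d a ->
  (forall j i, ex_series (fun n => Rabs (c n * pow2 a n j i))) /\ bnd (2 * C) (comp c a).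
Proof.
  intros Hs Hc Hd Ha. pose proof (bnd_nonneg _ _ Ha) as Hd0.
  assert (HC : 0 <= C).
  { specialize (Hc O). pose proof (Rabs_pos (c O)). simpl in Hc. lra. }
  assert (G : ex_series (fun n => (/ 2) ^ n)).
  { apply ex_series_geom. rewrite Rabs_pos_eq; lra. }
  assert (D : forall j i n, Rabs (c n * pow2 a n j i) <= C * bw j i * (/ 2) ^ n).
  { intros j i n. pose proof (bw_pos j i). rewrite Rabs_mult.
    apply Rle_trans with ((C * s ^ n) * ((8 * d) ^ n * bw j i)).
    - apply Rmult_le_compat; auto using Rabs_pos. apply (bnd_pow d a n Ha).
    - replace (C * s ^ n * ((8 * d) ^ n * bw j i)) with (C * bw j i * (8 * d * s) ^ n)
        by (rewrite (Rpow_mult_distr (8 * d) s); ring).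
      apply Rmult_le_compat_l; [nra|]. apply pow_incr. nra. }
  assert (X : forall j i, ex_series (fun n => Rabs (c n * pow2 a n j i))).
  { intros j i. apply (ex_series_le (K := R_AbsRing) (V := R_CompleteNormedModule) _
      (fun n => C * bw j i * (/ 2) ^ n)).
    - intros n. unfold norm; simpl. unfold abs; simpl. rewrite Rabs_Rabsolu. apply D.
    - apply (ex_series_scal (V := R_NormedModule)), G. }
  split; [exact X|]. intros j i. unfold comp.
  eapply Rle_trans; [apply Series_Rabs, X|].
  eapply Rle_trans.
  { apply Series_le with (b := fun n => C * bw j i * (/ 2) ^ n).
    - intros n; split; [apply Rabs_pos|apply D].
    - apply (ex_series_scal (V := R_NormedModule)), G. }
  rewrite Series_scal_l, Series_geom by (rewrite Rabs_pos_eq; lra). right; field.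
Qed.

Definition Jv (a : ser2) : ser2 :=
  fun j i => match j with O => 0 | S j => a j i / INR (S j) end.

(** Raising the degree by one gains a factor [rho] in the weight; what remains after cancelling
    factorials is [(m+2)^2 <= 4 (m+1)^3] with [m = i + j]. *)
Lemma bnd_Jv d a : bnd d a -> bnd (d * (2 / rho)) (Jv a).
Proof.
  intros Ha [|j] i; [change (Jv a O i) with 0 | change (Jv a (S j) i) with (a j i / INR (S j))].
  - rewrite Rabs_R0. pose proof (bnd_nonneg _ _ Ha). pose proof (bw_pos O i).
    apply Rmult_le_pos; [|lra]. apply Rmult_le_pos; [lra|].
    apply Rlt_le, Rdiv_lt_0_compat; lra.
  - specialize (Ha j i) as Hji. pose proof (bnd_nonneg _ _ Ha) as Hd.
    assert (HSj : 0 < INR (S j)) by (apply lt_0_INR; lia).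
    unfold Rdiv at 1. rewrite Rabs_mult, (Rabs_pos_eq (/ INR (S j))) by (apply Rlt_le, Rinv_0_lt_compat; lra).
    apply Rle_trans with (d * (bw j i / INR (S j))).
    { unfold Rdiv. rewrite <- Rmult_assoc. apply Rmult_le_compat_r; [|exact Hji].
      apply Rlt_le, Rinv_0_lt_compat; lra. }
    rewrite Rmult_assoc. apply Rmult_le_compat_l; [exact Hd|].
    unfold bw, lin_ext, wt. replace (i + S j)%nat with (S (i + j)) by lia.
    rewrite (fact_simpl (i + j)), (fact_simpl j), !mult_INR.
    change (rho ^ S (i + j)) with (rho * rho ^ (i + j)). change (2 ^ S j) with (2 * 2 ^ j).
    set (P := rho ^ (i + j)). set (q := 2 ^ j).
    set (x := INR (fact (i + j))). set (y := INR (fact i)). set (t := INR (fact j)).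
    assert (HP : 0 < P) by (unfold P; now apply pow_lt).
    assert (Hq : 0 < q) by (unfold q; apply pow_lt; lra).
    assert (Hx : 0 < x) by apply INR_fact_lt_0.
    assert (Hy : 0 < y) by apply INR_fact_lt_0.
    assert (Ht : 0 < t) by apply INR_fact_lt_0.
    rewrite (S_INR (i + j)).
    set (m := INR (i + j)). assert (Hm : 0 <= m) by apply pos_INR.
    set (J := INR (S j)) in *.
    apply Rle_trans with ((P * q * x / (y * t * J)) * / (m + 1) ^ 2).
    { right. field. repeat split; lra. }
    apply Rle_trans with ((P * q * x / (y * t * J)) * (4 * (m + 1) / (m + 2) ^ 2)).
    2:{ right. field. repeat split; lra. }
    apply Rmult_le_compat_l.
    { apply Rlt_le, Rdiv_lt_0_compat; repeat apply Rmult_lt_0_compat; lra. }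
    apply Rminus_le_0.
    replace (4 * (m + 1) / (m + 2) ^ 2 - / (m + 1) ^ 2) with
      ((4 * (m + 1) ^ 3 - (m + 2) ^ 2) / ((m + 1) ^ 2 * (m + 2) ^ 2)) by (field; lra).
    apply Rmult_le_pos; [simpl; nra|]. apply Rlt_le, Rinv_0_lt_compat.
    apply Rmult_lt_0_compat; apply pow_lt; lra.
Qed.

(** [lin_ext_S], the coefficient form of [d/dv F = 2 d/du F], makes the two sides match exactly. A
    slope [k] in place of 2 would give [1/k]; the argument asks for [1/k^2 < 1]. *)
Lemma bnd_Du_Jv d a : bnd d a -> bnd (d / 2) (Du (Jv a)).
Proof.
  intros Ha [|j] i; unfold Du, D1;
    [change (Jv a O (S i)) with 0 | change (Jv a (S j) (S i)) with (a j (S i) / INR (S j))].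
  - rewrite Rmult_0_r, Rabs_R0. pose proof (bnd_nonneg _ _ Ha). pose proof (bw_pos O i). nra.
  - specialize (Ha j (S i)).
    assert (HSj : 0 < INR (S j)) by (apply lt_0_INR; lia).
    assert (HSi : 0 < INR (S i)) by (apply lt_0_INR; lia).
    unfold bw. rewrite lin_ext_S. fold bw.
    replace (INR (S i) * (a j (S i) / INR (S j))) with (INR (S i) / INR (S j) * a j (S i))
      by (field; lra).
    assert (0 < INR (S i) / INR (S j)) by now apply Rdiv_lt_0_compat.
    rewrite Rabs_mult, Rabs_pos_eq by lra.
    replace (d / 2 * (2 * (INR (S i) / INR (S j)) * bw j (S i)))
      with (INR (S i) / INR (S j) * (d * bw j (S i))) by (field; lra).
    apply Rmult_le_compat_l; [lra|exact Ha].
Qed.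

(** Entry into the weighted norm from a geometric bound: the denominator [(n+1)^2] is at most
    [4 * 2^n], paid for by [2 s <= rho] and the factor 4. *)
Lemma bnd_geom C s a :
  0 < s -> (forall j i, Rabs (a j i) <= C * s ^ (i + j)) -> 2 * s <= rho -> bnd (4 * C) a.
Proof.
  intros Hs Ha Hrho j i. eapply Rle_trans; [apply Ha|].
  assert (HC : 0 <= C).
  { specialize (Ha O O). pose proof (Rabs_pos (a O O)). simpl in Ha. lra. }
  rewrite (Rmult_comm 4 C), Rmult_assoc. apply Rmult_le_compat_l; [exact HC|].
  apply Rle_trans with (4 * wt rho (i + j)); [|pose proof (bw_ge i j); lra].
  set (n := (i + j)%nat). unfold wt.
  assert (K : (INR n + 1) ^ 2 <= 4 * 2 ^ n).
  { clear. induction n as [|n IH]; [simpl; lra|].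
    destruct n as [|n]; [simpl; lra|]. destruct n as [|n]; [simpl; lra|].
    rewrite S_INR. pose proof (pos_INR n). rewrite !S_INR in *. simpl pow in *. nra. }
  pose proof (pos_INR n).
  assert (0 < (INR n + 1) ^ 2) by (apply pow_lt; lra).
  apply Rle_trans with (s ^ n * (4 * 2 ^ n / (INR n + 1) ^ 2)).
  - rewrite <- (Rmult_1_r (s ^ n)) at 1. apply Rmult_le_compat_l; [apply pow_le; lra|].
    apply Rle_div_r; lra.
  - replace (s ^ n * (4 * 2 ^ n / (INR n + 1) ^ 2)) with (4 / (INR n + 1) ^ 2 * (2 * s) ^ n)
      by (rewrite Rpow_mult_distr; field; lra).
    replace (4 * (rho ^ n / (INR n + 1) ^ 2)) with (4 / (INR n + 1) ^ 2 * rho ^ n) by (field; lra).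
    apply Rmult_le_compat_l; [apply Rlt_le, Rdiv_lt_0_compat; lra|]. apply pow_incr; lra.
Qed.

(** In positive degree one factor [s] can be written [(2 s / rho) (rho / 2)], so without constant
    term the norm decays like [1/rho]. This gives the smallness that substitution requires, by
    enlarging [rho] alone. *)
Lemma bnd_geom_0 C s a :
  0 < s -> (forall j i, Rabs (a j i) <= C * s ^ (i + j)) -> a O O = 0 -> 2 * s <= rho ->
  bnd (8 * C * s / rho) a.
Proof.
  intros Hs Ha H0 Hrho.
  assert (HC : 0 <= C).
  { specialize (Ha O O). pose proof (Rabs_pos (a O O)). simpl in Ha. lra. }
  assert (H : bnd (4 * (C * (2 * s / rho))) a).
  { apply bnd_geom with (s := rho / 2); try lra. intros j i.
    destruct (Nat.eq_dec (i + j) O) as [E|E].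
    - replace j with O by lia. replace i with O by lia. rewrite H0, Rabs_R0. simpl.
      rewrite Rmult_1_r. apply Rmult_le_pos; [exact HC|]. apply Rlt_le, Rdiv_lt_0_compat; lra.
    - eapply Rle_trans; [apply Ha|]. rewrite Rmult_assoc. apply Rmult_le_compat_l; [exact HC|].
      destruct (i + j)%nat as [|n]; [lia|]. simpl pow.
      replace (2 * s / rho * (rho / 2 * (rho / 2) ^ n)) with (s * (rho / 2) ^ n) by (field; lra).
      apply Rmult_le_compat_l; [lra|]. apply pow_incr; lra. }
  apply bnd_le with (2 := H). right. field. lra.
Qed.

End Weights.

(** * Formal solution of the Cauchy problem *)

Definition affine_v (a b : ser1) : ser2 :=
  fun j => match j with O => a | S O => b | _ => zero1 end.
(* The series with rows [a], [b] of order 0, 1 in [v] and second [v]-derivative [w]. *)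
Definition from_data (a b : ser1) (w : ser2) : ser2 := add2 (affine_v a b) (Jv (Jv w)).

Lemma Dv_Jv w : Dv (Jv w) = w.
Proof.
  apply functional_extensionality; intros j; apply functional_extensionality; intros i.
  unfold Dv, Jv. field. apply not_0_INR; lia.
Qed.

Lemma Du_Jv w : Du (Jv w) = Jv (Du w).
Proof.
  apply functional_extensionality; intros j; apply functional_extensionality; intros i.
  unfold Du, D1, Jv. destruct j; [ring|]. field. apply not_0_INR; lia.
Qed.

Lemma Dv_affine_v a b : Dv (affine_v a b) = affine_v b zero1.
Proof.
  apply functional_extensionality; intros j; apply functional_extensionality; intros i.
  unfold Dv, affine_v. destruct j as [|[|j]]; unfold zero1; simpl; ring.
Qed.

Lemma Du_affine_v a b : Du (affine_v a b) = affine_v (D1 a) (D1 b).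
Proof.
  apply functional_extensionality; intros j; apply functional_extensionality; intros i.
  unfold Du, affine_v. destruct j as [|[|j]]; unfold D1, zero1; ring.
Qed.

Lemma Dv_from_data a b w : Dv (from_data a b w) = add2 (affine_v b zero1) (Jv w).
Proof. unfold from_data. now rewrite Dv_add, Dv_affine_v, Dv_Jv. Qed.

Lemma Dv_Dv_from_data a b w : Dv (Dv (from_data a b w)) = w.
Proof.
  rewrite Dv_from_data, Dv_add, Dv_affine_v, Dv_Jv. replace (affine_v zero1 zero1) with zero2; [ring|].
  apply functional_extensionality; intros [|[|j]]; reflexivity.
Qed.

Lemma Du_from_data a b w : Du (from_data a b w) = add2 (affine_v (D1 a) (D1 b)) (Du (Jv (Jv w))).
Proof. unfold from_data. now rewrite Du_add, Du_affine_v. Qed.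

Lemma Du_Du_from_data a b w :
  Du (Du (from_data a b w)) = add2 (affine_v (D1 (D1 a)) (D1 (D1 b))) (Du (Jv (Du (Jv w)))).
Proof. rewrite Du_from_data, Du_add, Du_affine_v. now rewrite (Du_Jv (Jv w)). Qed.

Lemma from_data_0 a b w : from_data a b w O = a.
Proof.
  apply functional_extensionality; intros i. unfold from_data, add2, add1, lift2, affine_v, Jv. ring.
Qed.

Lemma from_data_1 a b w : from_data a b w 1%nat = b.
Proof.
  apply functional_extensionality; intros i. unfold from_data, add2, add1, lift2, affine_v, Jv. simpl. field.
Qed.

Lemma agree_Jv n w w' : agree n w w' -> agree (S n) (Jv w) (Jv w').
Proof.
  intros H [|j] Hj; apply functional_extensionality; intros i; [reflexivity|].
  simpl. now rewrite H by lia.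
Qed.

Lemma agree_from_data n a b w w' : agree n w w' -> agree (S n) (from_data a b w) (from_data a b w').
Proof.
  intros H. apply agree_add; [apply agree_refl|].
  apply agree_le with (S (S n)); [lia|]. now apply agree_Jv, agree_Jv.
Qed.

Lemma agree_Dv_from_data n a b w w' :
  agree n w w' -> agree (S n) (Dv (from_data a b w)) (Dv (from_data a b w')).
Proof.
  intros H. rewrite !Dv_from_data. apply agree_add; [apply agree_refl|]. now apply agree_Jv.
Qed.

(** Positive radius of convergence. *)
Definition geo1 (a : ser1) : Prop :=
  exists C s, 0 < s /\ forall n, Rabs (a n) <= C * s ^ n.

Lemma geo1_D1 a : geo1 a -> geo1 (D1 a).
Proof.
  intros (C & s & Hs & H). exists (C * s), (2 * s). split; [lra|]. intros n.
  assert (HC : 0 <= C).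
  { specialize (H O). pose proof (Rabs_pos (a O)). simpl in H. lra. }
  unfold D1. rewrite Rabs_mult, Rabs_pos_eq by apply pos_INR.
  assert (K : INR (S n) <= 2 ^ n).
  { clear. induction n as [|n IH]; [simpl; lra|]. rewrite S_INR. simpl pow.
    pose proof (pow_R1_Rle 2 n ltac:(lra)). lra. }
  specialize (H (S n)). simpl pow in H. pose proof (pos_INR (S n)).
  rewrite Rpow_mult_distr.
  apply Rle_trans with (2 ^ n * (C * (s * s ^ n))); [|right; ring].
  apply Rmult_le_compat; auto using Rabs_pos.
Qed.

Lemma geo1_zero : geo1 zero1.
Proof. exists 0, 1. split; [lra|]. intros n. unfold zero1. rewrite Rabs_R0. lra. Qed.

Lemma affine_v_geom a b : geo1 a -> geo1 b ->
  exists C s, 0 < s /\ 0 <= C /\ forall j i, Rabs (affine_v a b j i) <= C * s ^ (i + j).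
Proof.
  intros (C & s & Hs & H) (C' & s' & Hs' & H').
  assert (HC : 0 <= C).
  { specialize (H O). pose proof (Rabs_pos (a O)). simpl in H. lra. }
  assert (HC' : 0 <= C').
  { specialize (H' O). pose proof (Rabs_pos (b O)). simpl in H'. lra. }
  set (t := s + s' + 1). exists (C + C'), t. split; [unfold t; lra|]. split; [lra|].
  intros j i.
  assert (P1 : 0 < t ^ (i + j)) by (apply pow_lt; unfold t; lra).
  assert (mono : forall x, 0 < x <= t -> forall n, x ^ n <= t ^ n)
    by (intros x Hx n; apply pow_incr; lra).
  destruct j as [|[|j]].
  - rewrite Nat.add_0_r in *. simpl. eapply Rle_trans; [apply H|].
    pose proof (mono s ltac:(unfold t; lra) i). pose proof (pow_lt s i Hs). nra.
  - rewrite Nat.add_1_r in *. simpl. eapply Rle_trans; [apply H'|].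
    pose proof (mono s' ltac:(unfold t; lra) i). pose proof (pow_lt s' i Hs').
    assert (1 <= t) by (unfold t; lra). simpl in P1.
    assert (t ^ i <= t * t ^ i) by nra. nra.
  - simpl affine_v. unfold zero1. rewrite Rabs_R0. nra.
Qed.

Lemma affine_v_bnd a b : geo1 a -> geo1 b ->
  exists M r, 0 <= M /\ 0 < r /\ forall rho, r <= rho -> bnd rho M (affine_v a b).
Proof.
  intros Ha Hb. destruct (affine_v_geom a b Ha Hb) as (C & s & Hs & HC & H).
  exists (4 * C), (2 * s). split; [lra|]. split; [lra|]. intros rho Hr.
  apply bnd_geom with s; auto; lra.
Qed.

Lemma affine_v_bnd_0 a b : geo1 a -> geo1 b ->
  exists K r, 0 <= K /\ 0 < r /\ forall rho, r <= rho ->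
    bnd rho (K / rho) (sub2 (affine_v a b) (cst2 (a O))).
Proof.
  intros Ha Hb. destruct (affine_v_geom a b Ha Hb) as (C & s & Hs & HC & H).
  exists (8 * C * s), (2 * s). split; [nra|]. split; [lra|]. intros rho Hr.
  assert (E : forall j i, sub2 (affine_v a b) (cst2 (a O)) j i = 0 /\ (i + j = 0)%nat \/
     sub2 (affine_v a b) (cst2 (a O)) j i = affine_v a b j i).
  { intros [|[|j]] [|i]; unfold sub2, sub1, lift2, cst2, cst, zero1; simpl; (left; split; [ring|lia]) || (right; ring). }
  apply bnd_geom_0; auto; try lra.
  - intros j i. destruct (E j i) as [[E' _]|E']; rewrite E'; [|apply H].
    rewrite Rabs_R0. apply Rmult_le_pos; [exact HC|]. apply pow_le; lra.
  - unfold sub2, sub1, lift2; simpl; ring.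
Qed.

(** [M] depends on the data only, not on [rho]. The condition [2 W <= rho] gives [Jv w] norm at most
    1, so the radius [W] survives only in the second [u]-derivative, with the factor 1/4. The
    freedom in [M'] lets the three components share one constant. *)
Lemma from_data_bnd a b : geo1 a -> geo1 b ->
  exists M r, 0 <= M /\ 0 < r /\ forall M' rho W w, M <= M' -> r <= rho -> 2 * W <= rho ->
    bnd rho W w ->
    bnd rho (M' + 1) (Du (from_data a b w)) /\ bnd rho (M' + 1) (Dv (from_data a b w)) /\
    bnd rho (M' + W / 4) (Du (Du (from_data a b w))) /\ bnd rho (M' + 2) (from_data a b w).
Proof.
  intros Ha Hb.
  destruct (affine_v_bnd a b Ha Hb) as (M0 & r0 & ? & ? & L0).
  destruct (affine_v_bnd (D1 a) (D1 b)) as (M1 & r1 & ? & ? & L1); try now apply geo1_D1.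
  destruct (affine_v_bnd b zero1) as (M2 & r2 & ? & ? & L2); [exact Hb|apply geo1_zero|].
  destruct (affine_v_bnd (D1 (D1 a)) (D1 (D1 b))) as (M3 & r3 & ? & ? & L3);
    try now apply geo1_D1, geo1_D1.
  exists (M0 + M1 + M2 + M3), (r0 + r1 + r2 + r3 + 2). split; [lra|]. split; [lra|].
  intros M' rho W w HM Hr HW Hw.
  assert (Hrho : 0 < rho) by lra.
  assert (HW0 : 0 <= W) by (apply bnd_nonneg in Hw; auto).
  assert (J1 : bnd rho 1 (Jv w)).
  { apply bnd_le with (W * (2 / rho)); [auto| |now apply bnd_Jv].
    replace (W * (2 / rho)) with (2 * W / rho) by (field; lra). apply Rle_div_l; lra. }
  repeat split.
  - rewrite Du_from_data. apply bnd_le with (M1 + 1 / 2); auto; [lra|].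
    apply bnd_add; auto; [apply L1; lra|]. now apply bnd_Du_Jv.
  - rewrite Dv_from_data. apply bnd_le with (M2 + 1); auto; [lra|].
    apply bnd_add; auto. apply L2; lra.
  - rewrite Du_Du_from_data. apply bnd_le with (M3 + W / 2 / 2); auto; [lra|].
    apply bnd_add; auto; [apply L3; lra|]. now apply bnd_Du_Jv, bnd_Du_Jv.
  - unfold from_data. apply bnd_le with (M0 + 1 * (2 / rho)); auto.
    + assert (2 / rho <= 1) by (apply Rle_div_l; lra). lra.
    + apply bnd_add; auto; [apply L0; lra|]. now apply bnd_Jv.
Qed.

Lemma from_data_bnd_0 a b : geo1 a -> geo1 b ->
  exists K r, 0 <= K /\ 0 < r /\ forall rho W w, r <= rho -> 2 * W <= rho ->
    bnd rho W w -> bnd rho (K / rho) (sub2 (from_data a b w) (cst2 (from_data a b w O O))).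
Proof.
  intros Ha Hb. destruct (affine_v_bnd_0 a b Ha Hb) as (K & r & HK & Hr & H).
  exists (K + 2), r. split; [lra|]. split; [lra|]. intros rho W w Hrho HW Hw.
  assert (0 < rho) by lra.
  assert (HW0 : 0 <= W) by (apply bnd_nonneg in Hw; auto).
  assert (J1 : bnd rho 1 (Jv w)).
  { apply bnd_le with (W * (2 / rho)); [auto| |now apply bnd_Jv].
    replace (W * (2 / rho)) with (2 * W / rho) by (field; lra). apply Rle_div_l; lra. }
  rewrite from_data_0. unfold from_data.
  replace (sub2 (add2 (affine_v a b) (Jv (Jv w))) (cst2 (a O))) with
    (add2 (sub2 (affine_v a b) (cst2 (a O))) (Jv (Jv w))) by ring.
  apply bnd_le with (K / rho + 1 * (2 / rho)); auto; [right; field; lra|].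
  apply bnd_add; auto. now apply bnd_Jv.
Qed.

(** * Existence of a formal solution with a geometric bound *)

Section Existence.

Variables (c X0 X1 Y0 Y1 Z0 Z1 : ser1).

Definition picard (w : ser2 * ser2 * ser2) : ser2 * ser2 * ser2 :=
  let '(wx, wy, wz) := w in
  let X := from_data X0 X1 wx in
  let Y := from_data Y0 Y1 wy in
  let Z := from_data Z0 Z1 wz in
  let G := comp c (sub2 Z (cst2 (Z O O))) in
  (opp2 (add2 (Du (Du X)) (mul2 G (add2 (mul2 (Du X) (Du Z)) (mul2 (Dv X) (Dv Z))))),
   opp2 (add2 (Du (Du Y)) (mul2 G (add2 (mul2 (Du Y) (Du Z)) (mul2 (Dv Y) (Dv Z))))),
   opp2 (add2 (Du (Du Z))
     (mul2 (cst2 (/ 2)) (mul2 G (sub2 (grad2 Z) (add2 (grad2 X) (grad2 Y))))))).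

Definition agree3 (n : nat) (w w' : ser2 * ser2 * ser2) : Prop :=
  agree n (fst (fst w)) (fst (fst w')) /\ agree n (snd (fst w)) (snd (fst w')) /\
  agree n (snd w) (snd w').

Lemma agree3_picard n w w' : agree3 n w w' -> agree3 (S n) (picard w) (picard w').
Proof.
  destruct w as [[wx wy] wz]; destruct w' as [[wx' wy'] wz'].
  intros (Hx & Hy & Hz); simpl in Hx, Hy, Hz.
  unfold agree3, picard, grad2; cbn [fst snd]. rewrite !from_data_0.
  repeat split;
  repeat first [ assumption | apply agree_from_data | apply agree_Dv_from_data | apply agree_refl
               | apply agree_opp | apply agree_add | apply agree_sub | apply agree_mul
               | apply agree_comp | apply agree_Du ].
Qed.

Fixpoint iterate (n : nat) : ser2 * ser2 * ser2 :=
  match n with O => (zero2, zero2, zero2) | S m => picard (iterate m) end.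

Lemma agree3_refl n w : agree3 n w w.
Proof. repeat split; apply agree_refl. Qed.

Lemma agree3_trans n w1 w2 w3 : agree3 n w1 w2 -> agree3 n w2 w3 -> agree3 n w1 w3.
Proof. intros (?&?&?) (?&?&?); repeat split; eapply agree_trans; eauto. Qed.

Lemma agree3_le n m w w' : (n <= m)%nat -> agree3 m w w' -> agree3 n w w'.
Proof. intros Hn (?&?&?); repeat split; eapply agree_le; eauto. Qed.

Lemma iterate_stable n m : (n <= m)%nat -> agree3 n (iterate n) (iterate m).
Proof.
  assert (S1 : forall k, agree3 k (iterate k) (iterate (S k))).
  { induction k as [|k IH]; [repeat split; intros j Hj; lia|].
    exact (agree3_picard k _ _ IH). }
  intros H; induction H as [|m Hm IH]; [apply agree3_refl|].
  eapply agree3_trans; [exact IH|]. eapply agree3_le; [|apply S1]; lia.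
Qed.

(** [agree n] concerns the rows below [n], so row [j] is final from iterate [j + 1] on. *)
Definition limit : ser2 * ser2 * ser2 :=
  (fun j => fst (fst (iterate (S j))) j, fun j => snd (fst (iterate (S j))) j,
   fun j => snd (iterate (S j)) j).

Lemma limit_agree n : agree3 n limit (iterate n).
Proof.
  repeat split; intros j Hj; apply (iterate_stable (S j) n); lia.
Qed.

Lemma limit_fixpoint : picard limit = limit.
Proof.
  assert (H : forall n, agree3 n (picard limit) limit).
  { intros n. apply agree3_trans with (iterate (S n)).
    - apply agree3_le with (S n); [lia|]. apply (agree3_picard n limit (iterate n)), limit_agree.
    - destruct (limit_agree (S n)) as (H1 & H2 & H3).
      apply agree3_le with (S n); [lia|]. repeat split; now apply agree_sym. }
  destruct (picard limit) as [[a b] d]. destruct limit as [[a' b'] d'].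
  repeat f_equal; apply agree_all; intros n; apply (H n).
Qed.

Definition bnd3 (rho W : R) (w : ser2 * ser2 * ser2) : Prop :=
  bnd rho W (fst (fst w)) /\ bnd rho W (snd (fst w)) /\ bnd rho W (snd w).

Hypotheses (HX0 : geo1 X0) (HX1 : geo1 X1) (HY0 : geo1 Y0) (HY1 : geo1 Y1)
  (HZ0 : geo1 Z0) (HZ1 : geo1 Z1) (Hc : geo1 c).

(** The order of choice matters: [M] comes from the data, [W] is taken large with respect to [M] and
    the nonlinear terms, and [rho] comes last, so large that the terms in [Jv w] are harmless and
    substitution into [c] is controlled. *)
Lemma picard_bnd : exists rho W, 0 < rho /\ 2 * W <= rho /\ 0 <= W /\
  (forall w, bnd3 rho W w -> bnd3 rho W (picard w)) /\
  (exists M, forall w, bnd3 rho W w -> bnd rho M (from_data X0 X1 (fst (fst w))) /\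
     bnd rho M (from_data Y0 Y1 (snd (fst w))) /\ bnd rho M (from_data Z0 Z1 (snd w))).
Proof.
  destruct (from_data_bnd X0 X1 HX0 HX1) as (Mx & rx & ? & ? & Bx).
  destruct (from_data_bnd Y0 Y1 HY0 HY1) as (My & ry & ? & ? & By).
  destruct (from_data_bnd Z0 Z1 HZ0 HZ1) as (Mz & rz & ? & ? & Bz).
  destruct (from_data_bnd_0 Z0 Z1 HZ0 HZ1) as (K & rk & ? & ? & Bk).
  destruct Hc as (C & s & Hs & HC).
  assert (HC0 : 0 <= C).
  { specialize (HC O). pose proof (Rabs_pos (c O)). simpl in HC. lra. }
  set (M := Mx + My + Mz).
  set (q := C * ((M + 1) * (M + 1))).
  assert (Hq : 0 <= q) by (apply Rmult_le_pos; [lra|apply Rmult_le_pos; unfold M; lra]).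
  (* With this choice [M + 3072 q = W / 2], which leaves room for the top order [W / 4]. The number
     3072 collects the factors 8 of the products in the third equation; the first two need only
     256. *)
  set (W := 2 * (M + 3072 * q)).
  assert (HW : 0 <= W) by (unfold W, M; lra).
  (* The last term is the requirement [8 (K / rho) s <= 1/2] of [bnd_comp]. *)
  set (rho := rx + ry + rz + rk + 2 * W + 16 * K * s).
  assert (HKs : 0 <= 16 * K * s) by (apply Rmult_le_pos; lra).
  assert (Hrho : 0 < rho) by (unfold rho; lra).
  exists rho, W. split; [exact Hrho|]. split; [unfold rho; lra|]. split; [exact HW|].
  assert (Bx' := fun w => Bx M rho W w ltac:(unfold M; lra) ltac:(unfold rho; lra) ltac:(unfold rho; lra)).
  assert (By' := fun w => By M rho W w ltac:(unfold M; lra) ltac:(unfold rho; lra) ltac:(unfold rho; lra)).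
  assert (Bz' := fun w => Bz M rho W w ltac:(unfold M; lra) ltac:(unfold rho; lra) ltac:(unfold rho; lra)).
  assert (Bk' := fun w => Bk rho W w ltac:(unfold rho; lra) ltac:(unfold rho; lra)).
  clear Bx By Bz Bk.
  split.
  - intros [[wx wy] wz] (Wx & Wy & Wz); simpl in Wx, Wy, Wz.
    destruct (Bx' wx Wx) as (Xu & Xv & Xuu & _).
    destruct (By' wy Wy) as (Yu & Yv & Yuu & _).
    destruct (Bz' wz Wz) as (Zu & Zv & Zuu & _).
    specialize (Bk' wz Wz).
    unfold picard. cbv zeta.
    set (X := from_data X0 X1 wx) in *. set (Y := from_data Y0 Y1 wy) in *.
    set (Z := from_data Z0 Z1 wz) in *.
    assert (HG : bnd rho (2 * C) (comp c (sub2 Z (cst2 (Z O O))))).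
    { apply (bnd_comp rho Hrho C s c (K / rho)); auto; [lra|].
      replace (8 * (K / rho) * s) with (8 * K * s / rho) by (field; lra).
      apply Rle_div_l; [lra|]. unfold rho. lra. }
    set (G := comp c (sub2 Z (cst2 (Z O O)))) in *.
    assert (lin_term : forall U, bnd rho (M + 1) (Du U) -> bnd rho (M + 1) (Dv U) ->
       bnd rho (M + W / 4) (Du (Du U)) -> bnd rho W (opp2 (add2 (Du (Du U))
         (mul2 G (add2 (mul2 (Du U) (Du Z)) (mul2 (Dv U) (Dv Z))))))).
    { intros U Hu Hv Huu. apply bnd_opp.
      apply bnd_le with (M + W / 4 + 8 * (2 * C) * (8 * (M + 1) * (M + 1) + 8 * (M + 1) * (M + 1))).
      - exact Hrho.
      - replace (8 * (2 * C) * (8 * (M + 1) * (M + 1) + 8 * (M + 1) * (M + 1))) with (256 * q)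
          by (unfold q; ring). unfold W. unfold W in HW. lra.
      - apply bnd_add; auto. apply bnd_mul; auto. apply bnd_add; auto; apply bnd_mul; auto. }
    unfold bnd3; cbn [fst snd]. split; [|split]; [apply lin_term; auto|apply lin_term; auto|].
    apply bnd_opp.
    set (g := 8 * (M + 1) * (M + 1) + 8 * (M + 1) * (M + 1)).
    assert (Hgr : forall U, bnd rho (M + 1) (Du U) -> bnd rho (M + 1) (Dv U) -> bnd rho g (grad2 U)).
    { intros U Hu Hv. apply bnd_add; auto; apply bnd_mul; auto. }
    apply bnd_le with (M + W / 4 + 8 * (Rabs (/ 2)) * (8 * (2 * C) * (g + (g + g)))).
    + exact Hrho.
    + rewrite Rabs_pos_eq by lra.
      replace (8 * / 2 * (8 * (2 * C) * (g + (g + g)))) with (3072 * q)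
          by (unfold q, g; field). unfold W. unfold W in HW. lra.
    + apply bnd_add; auto. apply bnd_mul; auto; [apply bnd_cst; auto|].
      apply bnd_mul; auto. apply bnd_sub; auto. apply bnd_add; auto.
  - exists (M + 2). intros w (Wx & Wy & Wz). repeat split.
    + apply Bx'; auto. + apply By'; auto. + apply Bz'; auto.
Qed.

Lemma formal_exists : exists rho M X Y Z, 0 < rho /\ formal_solution c X Y Z /\
  X O = X0 /\ X 1%nat = X1 /\ Y O = Y0 /\ Y 1%nat = Y1 /\ Z O = Z0 /\ Z 1%nat = Z1 /\
  bnd rho M X /\ bnd rho M Y /\ bnd rho M Z.
Proof.
  destruct picard_bnd as (rho & W & Hrho & HW & HW0 & Hp & M & HM).
  assert (HI : forall n, bnd3 rho W (iterate n)).
  { induction n as [|n IH]; [|now apply Hp].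
    repeat split; intros j i; simpl; unfold zero2, zero1; rewrite Rabs_R0;
      apply Rmult_le_pos; auto; apply Rlt_le, bw_pos; auto. }
  assert (HL : bnd3 rho W limit).
  { repeat split; intros j i; apply (HI (S j)). }
  specialize (HM limit HL). pose proof limit_fixpoint as HF.
  destruct limit as [[wx wy] wz]. unfold picard in HF. cbv zeta in HF.
  injection HF as Ex Ey Ez. simpl in HM.
  exists rho, M, (from_data X0 X1 wx), (from_data Y0 Y1 wy), (from_data Z0 Z1 wz).
  split; [exact Hrho|]. rewrite !from_data_0, !from_data_1.
  split; [|tauto].
  assert (aux : forall a b w, opp2 (add2 a b) = w -> add2 (add2 a w) b = zero2)
    by (intros a b w <-; ring).
  unfold formal_solution, pde_lin, pde_z. cbv zeta. rewrite !Dv_Dv_from_data.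
  repeat split.
  - apply aux, Ex.
  - apply aux, Ey.
  - apply aux, Ez.
Qed.

End Existence.

(** * Double series *)

Lemma ex_series_cmp (a b : nat -> R) :
  (forall n, Rabs (a n) <= b n) -> ex_series b -> ex_series a.
Proof.
  intros H. apply (ex_series_le (K := R_AbsRing) (V := R_CompleteNormedModule)). exact H.
Qed.

Lemma ex_series_eq (a b : nat -> R) : (forall n, a n = b n) -> ex_series a -> ex_series b.
Proof. apply ex_series_ext. Qed.

Lemma nonneg_series_bounded (a : nat -> R) M :
  (forall n, 0 <= a n) -> (forall n, sum_n a n <= M) -> ex_series a /\ Series a <= M.
Proof.
  intros Ha HM.
  assert (H : ex_finite_lim_seq (sum_n a)).
  { apply ex_finite_lim_seq_incr with M; auto. intros n. rewrite sum_Sn.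
    unfold plus; simpl. specialize (Ha (S n)). lra. }
  destruct H as [l Hl]. assert (Hs : is_series a l) by exact Hl.
  split; [now exists l|]. rewrite (is_series_unique _ _ Hs).
  apply (is_lim_seq_le (sum_n a) (fun _ => M) l M); auto. apply is_lim_seq_const.
Qed.

Lemma series_ge_term (a : nat -> R) n :
  (forall k, 0 <= a k) -> ex_series a -> a n <= Series a.
Proof.
  intros Ha He.
  assert (H : forall m, (n <= m)%nat -> a n <= sum_n a m).
  { intros m Hm. induction Hm as [|m Hm IH].
    - destruct n; [rewrite sum_O; lra|]. rewrite sum_Sn. unfold plus; simpl.
      assert (0 <= sum_n a n); [|lra].
      { clear - Ha. induction n; [rewrite sum_O; auto|]. rewrite sum_Sn. unfold plus; simpl.
        specialize (Ha (S n)). lra. }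
    - rewrite sum_Sn. unfold plus; simpl. specialize (Ha (S m)). lra. }
  apply Series_correct in He.
  apply (is_lim_seq_le_loc (fun _ => a n) (sum_n a) (a n) (Series a)).
  - now exists n.
  - apply is_lim_seq_const.
  - exact He.
Qed.

Lemma series_sum_n (g : nat -> nat -> R) N :
  (forall j, ex_series (fun i => g i j)) ->
  ex_series (fun i => sum_n (g i) N) /\
  Series (fun i => sum_n (g i) N) = sum_n (fun j => Series (fun i => g i j)) N.
Proof.
  intros H. induction N as [|N [IH1 IH2]].
  - rewrite sum_O. split.
    + apply ex_series_ext with (2 := H O). intros i; now rewrite sum_O.
    + apply Series_ext. intros i; now rewrite sum_O.
  - split.
    + apply ex_series_ext with (fun i => plus (sum_n (g i) N) (g i (S N))).
      * intros i; now rewrite sum_Sn.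
      * apply (ex_series_plus (V := R_NormedModule)); auto.
    + rewrite sum_Sn, <- IH2. unfold plus; simpl. rewrite <- Series_plus; auto.
      apply Series_ext; intros i. now rewrite sum_Sn.
Qed.

(** One inequality is enough: applied to [g] and then to its transpose it gives the equality used in
    [fubini]. *)
Lemma fubini_nonneg (g : nat -> nat -> R) :
  (forall i j, 0 <= g i j) -> (forall i, ex_series (g i)) ->
  ex_series (fun i => Series (g i)) ->
  (forall j, ex_series (fun i => g i j)) /\
  ex_series (fun j => Series (fun i => g i j)) /\
  Series (fun j => Series (fun i => g i j)) <= Series (fun i => Series (g i)).
Proof.
  intros Hg Hr He.
  assert (Hc : forall j, ex_series (fun i => g i j)).
  { intros j. apply ex_series_cmp with (2 := He). intros i.
    rewrite Rabs_pos_eq by auto. now apply series_ge_term. }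
  split; [exact Hc|].
  apply nonneg_series_bounded.
  - intros j. rewrite <- (Rmult_0_l (Series (fun _ : nat => 0))), <- Series_scal_l.
    apply Series_le; [|apply Hc]. intros n; split; [lra|].
    rewrite Rmult_0_l; auto.
  - intros N. destruct (series_sum_n g N Hc) as [H1 H2]. rewrite <- H2.
    apply Series_le; [|exact He]. intros i. split.
    + clear - Hg. induction N; [rewrite sum_O; auto|]. rewrite sum_Sn.
      unfold plus; simpl. specialize (Hg i (S N)). lra.
    + assert (Hm : forall m, (N <= m)%nat -> sum_n (g i) N <= sum_n (g i) m).
      { intros m Hm; induction Hm as [|m Hm IH]; [lra|]. rewrite sum_Sn.
        unfold plus; simpl. specialize (Hg i (S m)). lra. }
      apply (is_lim_seq_le_loc (fun _ => sum_n (g i) N) (sum_n (g i)) (sum_n (g i) N) (Series (g i))).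
      * now exists N.
      * apply is_lim_seq_const.
      * apply Series_correct, Hr.
Qed.

Definition asum (g : nat -> nat -> R) : Prop :=
  (forall i, ex_series (fun j => Rabs (g i j))) /\
  ex_series (fun i => Series (fun j => Rabs (g i j))).

Lemma asum_row g i : asum g -> ex_series (g i).
Proof. intros [H _]. apply ex_series_Rabs, H. Qed.

Lemma asum_total g : asum g -> ex_series (fun i => Series (g i)).
Proof.
  intros [H H']. apply ex_series_cmp with (2 := H'). intros i. apply Series_Rabs, H.
Qed.

Lemma asum_le g h : (forall i j, Rabs (g i j) <= Rabs (h i j)) -> asum h -> asum g.
Proof.
  intros H [H1 H2].
  assert (R1 : forall i, ex_series (fun j => Rabs (g i j))).
  { intros i. apply ex_series_cmp with (2 := H1 i). intros n. now rewrite Rabs_Rabsolu. }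
  split; [exact R1|]. apply ex_series_cmp with (2 := H2). intros i.
  eapply Rle_trans; [apply Series_Rabs|].
  - apply ex_series_ext with (2 := R1 i). intros n; now rewrite Rabs_Rabsolu.
  - apply Series_le; [|apply H1]. intros n. rewrite Rabs_Rabsolu. split; [apply Rabs_pos|auto].
Qed.

Lemma asum_abs g : asum g -> asum (fun i j => Rabs (g i j)).
Proof. apply asum_le. intros i j. rewrite Rabs_Rabsolu; lra. Qed.

Lemma asum_transpose g : asum g -> asum (fun j i => g i j).
Proof.
  intros [H H'].
  destruct (fubini_nonneg (fun i j => Rabs (g i j))) as (H1 & H2 & _); auto.
  - intros; apply Rabs_pos.
  - split; auto.
Qed.

(** Nonnegative arrays by the two inequalities of [fubini_nonneg], the general case by
    [g = (g + |g|) - |g|]. *)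
Lemma fubini g : asum g ->
  Series (fun i => Series (g i)) = Series (fun j => Series (fun i => g i j)).
Proof.
  intros Hg. pose proof (asum_transpose g Hg) as Ht.
  assert (E : forall h : nat -> nat -> R, (forall i j, 0 <= h i j) -> asum h ->
     Series (fun i => Series (h i)) = Series (fun j => Series (fun i => h i j))).
  { intros h Hp Hh.
    assert (A : forall i, ex_series (h i)) by (intros; now apply asum_row).
    destruct (fubini_nonneg h Hp A (asum_total h Hh)) as (H1 & H2 & H3).
    destruct (fubini_nonneg (fun j i => h i j) (fun _ _ => Hp _ _) H1 H2) as (_ & _ & H4).
    simpl in H4. apply Rle_antisym; [exact H4|exact H3]. }
  set (p := fun i j => g i j + Rabs (g i j)).
  assert (Hp : asum p).
  { apply asum_le with (fun i j => 2 * g i j).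
    - intros i j. unfold p. rewrite Rabs_mult, (Rabs_pos_eq 2) by lra.
      eapply Rle_trans; [apply Rabs_triang|]. rewrite Rabs_Rabsolu. lra.
    - destruct Hg as [G1 G2]. split.
      + intros i. apply ex_series_ext with (fun j => 2 * Rabs (g i j)).
        { intros j. rewrite Rabs_mult, (Rabs_pos_eq 2); lra. }
        apply (ex_series_scal (V := R_NormedModule)), G1.
      + apply ex_series_ext with (fun i => 2 * Series (fun j => Rabs (g i j))).
        { intros i. rewrite <- Series_scal_l. apply Series_ext; intros j.
          rewrite Rabs_mult, (Rabs_pos_eq 2); lra. }
        apply (ex_series_scal (V := R_NormedModule)), G2. }
  pose proof (asum_abs g Hg) as Ha.
  assert (S1 : forall h k : nat -> nat -> R, asum h -> asum k ->
    Series (fun i => Series (h i)) - Series (fun i => Series (k i)) =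
    Series (fun i => Series (fun j => h i j - k i j))).
  { intros h k Hh Hk. rewrite <- Series_minus by now apply asum_total.
    apply Series_ext; intros i. rewrite <- Series_minus; auto using asum_row. }
  assert (Q : forall i j, p i j - Rabs (g i j) = g i j) by (intros; unfold p; ring).
  transitivity (Series (fun i => Series (p i)) - Series (fun i => Series (fun j => Rabs (g i j)))).
  - rewrite S1 by auto. apply Series_ext; intros i; apply Series_ext; intros j; now rewrite Q.
  - rewrite (E p), (E (fun i j => Rabs (g i j))); auto.
    + rewrite (S1 (fun j i => p i j) (fun j i => Rabs (g i j))).
      * apply Series_ext; intros i; apply Series_ext; intros j; now rewrite Q.
      * now apply asum_transpose.
      * now apply (asum_transpose (fun i j => Rabs (g i j))).
    + intros; apply Rabs_pos.
    + intros i j. unfold p. pose proof (Rle_abs (- g i j)). rewrite Rabs_Ropp in *. lra.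
Qed.

Lemma asum_geom g C q : 0 <= q < 1 -> (forall i j, Rabs (g i j) <= C * q ^ i * q ^ j) -> asum g.
Proof.
  intros Hq Hg.
  assert (G : ex_series (fun n => q ^ n)) by (apply ex_series_geom; rewrite Rabs_pos_eq; lra).
  assert (H1 : forall i, ex_series (fun j => Rabs (g i j))).
  { intros i. apply ex_series_cmp with (fun j => C * q ^ i * q ^ j).
    - intros j. now rewrite Rabs_Rabsolu.
    - apply (ex_series_scal (V := R_NormedModule)), G. }
  split; [exact H1|].
  apply ex_series_cmp with (fun i => (C * Series (fun n => q ^ n)) * q ^ i).
  - intros i. rewrite Rabs_pos_eq.
    + replace (C * Series (fun n => q ^ n) * q ^ i) with (C * q ^ i * Series (fun n => q ^ n)) by ring.
      rewrite <- Series_scal_l. apply Series_le.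
      * intros j; split; [apply Rabs_pos|apply Hg].
      * apply (ex_series_scal (V := R_NormedModule)), G.
    + apply Rle_trans with (Rabs (g i O)); [apply Rabs_pos|].
      apply (series_ge_term (fun j => Rabs (g i j))); auto. intros; apply Rabs_pos.
  - apply (ex_series_scal (V := R_NormedModule)), G.
Qed.

Definition diag (g : nat -> nat -> R) (n : nat) : R :=
  sum_f_R0 (fun i => g i (n - i)%nat) n.

Lemma finite_series (a : nat -> R) n :
  (forall k, (n < k)%nat -> a k = 0) -> is_series a (sum_f_R0 a n).
Proof.
  intros H. unfold is_series. apply filterlim_ext_loc with (fun _ => sum_f_R0 a n).
  - exists n. intros m Hm. rewrite sum_n_Reals. induction Hm as [|m Hm IH]; [reflexivity|].
    simpl. rewrite <- IH, H by lia. ring.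
  - apply filterlim_const.
Qed.

(** Fubini for the sheared array with entry [g i (n - i)] for [i <= n] and 0 otherwise: its rows
    have the sums of the rows of [g], its columns are the finite antidiagonals. *)
Lemma sum_diag g : asum g ->
  is_series (diag g) (Series (fun i => Series (g i))).
Proof.
  intros [H1 H2].
  set (h := fun i n => if (i <=? n)%nat then g i (n - i)%nat else 0).
  assert (Hr : forall (k : R -> R), k 0 = 0 -> forall i,
     (forall j, k (h i (i + j)%nat) = k (g i j)) /\ forall j, (j < i)%nat -> k (h i j) = 0).
  { intros k Hk i. split; intros j; [|intros Hj]; unfold h.
    - replace (i <=? i + j)%nat with true by (symmetry; apply Nat.leb_le; lia).
      do 2 f_equal. lia.
    - replace (i <=? j)%nat with false by (symmetry; apply Nat.leb_gt; lia). exact Hk. }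
  assert (Hs : forall (k : R -> R), k 0 = 0 -> forall i,
    Series (fun n => k (h i n)) = Series (fun j => k (g i j))).
  { intros k Hk i. destruct (Hr k Hk i) as [A B].
    rewrite (Series_incr_n_aux _ i B). apply Series_ext; intros j; apply A. }
  assert (Hh : asum h).
  { split.
    - intros i. apply (ex_series_incr_n (V := R_NormedModule) _ i).
      apply ex_series_ext with (2 := H1 i). intros j. symmetry.
      apply (Hr Rabs Rabs_R0 i).
    - apply ex_series_ext with (2 := H2). intros i. symmetry; apply (Hs Rabs Rabs_R0). }
  assert (Hd : forall n, is_series (fun i => h i n) (diag g n)).
  { intros n. replace (diag g n) with (sum_f_R0 (fun i => h i n) n).
    - apply finite_series. intros i Hi. apply (Hr (fun x => x) eq_refl i). lia.
    - apply sum_eq. intros i Hi. unfold h.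
      replace (i <=? n)%nat with true by (symmetry; apply Nat.leb_le; lia). reflexivity. }
  replace (Series (fun i => Series (g i))) with (Series (diag g)).
  - apply Series_correct. apply ex_series_ext with (fun n => Series (fun i => h i n)).
    + intros n. now apply is_series_unique.
    + apply asum_total with (g := fun n i => h i n). now apply asum_transpose.
  - rewrite (Series_ext (diag g) (fun n => Series (fun i => h i n))).
    + rewrite <- (fubini h Hh). apply Series_ext; intros i. apply (Hs (fun x => x) eq_refl).
    + intros n. symmetry. now apply is_series_unique.
Qed.

(** * Power series in one variable *)

(** Radius of convergence at least [r], as Cauchy estimates at every [s < r]. Products and
    derivatives lose an arbitrarily small part of [s], hence nothing of [r]. *)
Definition cv1 (r : R) (a : ser1) : Prop :=
  forall s, 0 < s < r -> exists C, forall n, Rabs (a n) * s ^ n <= C.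

Lemma cv1_radius r a x : cv1 r a -> Rabs x < r -> Rbar_lt (Rabs x) (CV_radius a).
Proof.
  intros Ha Hx. pose proof (Rabs_pos x).
  apply Rbar_lt_le_trans with ((Rabs x + r) / 2); [simpl; lra|].
  destruct (Ha ((Rabs x + r) / 2) ltac:(lra)) as [C HC].
  apply CV_radius_bounded. exists C. intros n. rewrite Rabs_mult.
  rewrite <- RPow_abs, (Rabs_pos_eq ((Rabs x + r) / 2)) by lra. apply HC.
Qed.

Lemma cv1_ex r a x : cv1 r a -> Rabs x < r -> ex_pseries a x.
Proof. intros; apply CV_radius_inside; eapply cv1_radius; eauto. Qed.

Lemma cv1_radius_pos r a : 0 < r -> cv1 r a -> Rbar_lt 0 (CV_radius a).
Proof.
  intros Hr Ha. rewrite <- Rabs_R0. apply cv1_radius with r; auto. now rewrite Rabs_R0.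
Qed.

Lemma cv1_of_ex r a : (forall x, Rabs x < r -> ex_pseries a x) -> cv1 r a.
Proof.
  intros H s Hs.
  assert (Hl : is_lim_seq (fun n => a n * s ^ n) 0).
  { apply ex_series_lim_0. apply ex_pseries_R, H. rewrite Rabs_pos_eq; lra. }
  apply is_lim_seq_spec in Hl.
  assert (Hb : exists M, forall n, Rabs (a n * s ^ n) <= M).
  { destruct (Hl (mkposreal 1 Rlt_0_1)) as [N HN]. simpl in HN.
    assert (F : forall N, exists M, forall n, (n < N)%nat -> Rabs (a n * s ^ n) <= M).
    { clear. induction N as [|N [M HM]]; [exists 0; intros; lia|].
      exists (Rmax M (Rabs (a N * s ^ N))). intros n Hn.
      destruct (Nat.eq_dec n N) as [->|]; [apply Rmax_r|].
      eapply Rle_trans; [apply HM; lia|apply Rmax_l]. }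
    destruct (F N) as [M HM]. exists (Rmax M 1). intros n.
    destruct (Nat.lt_ge_cases n N) as [Hn|Hn].
    - eapply Rle_trans; [now apply HM|apply Rmax_l].
    - specialize (HN n Hn). rewrite Rminus_0_r in HN. apply Rle_trans with 1; [lra|apply Rmax_r]. }
  destruct Hb as [M HM]. exists M. intros n. specialize (HM n). rewrite Rabs_mult in HM.
  rewrite (Rabs_pos_eq (s ^ n)) in HM; [exact HM|apply pow_le; lra].
Qed.

Lemma cv1_le r r' a : r' <= r -> cv1 r a -> cv1 r' a.
Proof. intros Hr Ha s Hs. apply Ha; lra. Qed.

(** Bernoulli's inequality for [(1/q)^n], with [1/q = 1 + h]. *)
Lemma pow_linear_bounded q : 0 < q < 1 -> exists K, forall n, (INR n + 1) * q ^ n <= K.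
Proof.
  intros Hq. set (h := / q - 1).
  assert (Hh : 0 < h).
  { unfold h. assert (1 < / q); [|lra]. rewrite <- Rinv_1. apply Rinv_lt_contravar; lra. }
  exists (1 + / h). intros n. pose proof (pos_INR n) as Hn.
  assert (B : 1 + INR n * h <= (/ q) ^ n).
  { replace (/ q) with (1 + h) by (unfold h; ring). apply poly. exact Hh. }
  assert (Hp : 0 < q ^ n) by (apply pow_lt; lra).
  assert (E : (/ q) ^ n * q ^ n = 1).
  { rewrite <- Rpow_mult_distr, Rinv_l, pow1; lra. }
  assert (H1 : q ^ n <= 1) by (rewrite <- (pow1 n); apply pow_incr; lra).
  assert (H2 : INR n * h * q ^ n <= 1) by nra.
  assert (H3 : INR n * q ^ n <= / h).
  { apply Rmult_le_reg_r with h; [lra|]. rewrite Rinv_l by lra. lra. }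
  lra.
Qed.

Lemma absorb_linear_factor s t : 0 < s < t -> exists K, 0 <= K /\ forall n, (INR n + 1) * s ^ n <= K * t ^ n.
Proof.
  intros Hs. destruct (pow_linear_bounded (s / t)) as [K HK].
  { split; [apply Rdiv_lt_0_compat; lra|]. apply Rlt_div_l; lra. }
  exists K. split.
  - specialize (HK O). simpl in HK. lra.
  - intros n. specialize (HK n). unfold Rdiv in HK. rewrite Rpow_mult_distr in HK.
    assert (Ht : 0 < t ^ n) by (apply pow_lt; lra).
    rewrite pow_inv in HK.
    apply Rmult_le_reg_r with (/ t ^ n); [now apply Rinv_0_lt_compat|].
    rewrite Rmult_assoc with (r2 := t ^ n), Rinv_r, Rmult_1_r by lra.
    rewrite Rmult_assoc. exact HK.
Qed.

Lemma mul1_geom C C' x n :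
  mul1 (fun k => C * x ^ k) (fun k => C' * x ^ k) n = C * C' * (INR n + 1) * x ^ n.
Proof.
  revert C; induction n as [|n IH]; intros C; unfold mul1; simpl conv.
  - simpl. ring.
  - change (shift (fun k => C * x ^ k)) with (fun k => C * (x * x ^ k)).
    replace (fun k => C * (x * x ^ k)) with (fun k => C * x * x ^ k)
      by (apply functional_extensionality; intros; ring).
    change (C * x ^ 0 * (C' * x ^ S n) + mul1 (fun k => C * x * x ^ k) (fun k => C' * x ^ k) n
      = C * C' * (INR (S n) + 1) * x ^ S n).
    rewrite IH, S_INR. simpl. ring.
Qed.

Lemma mul2_geom C C' x j i :
  mul2 (fun l k => C * x ^ (k + l)) (fun l k => C' * x ^ (k + l)) j i =
  C * C' * (INR j + 1) * (INR i + 1) * x ^ (i + j).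
Proof.
  assert (R0 : forall D l, (fun k => D * x ^ (k + l)) = (fun k => (D * x ^ l) * x ^ k)).
  { intros D l. apply functional_extensionality; intros k. rewrite pow_add; ring. }
  revert C; induction j as [|j IH]; intros C; unfold mul2; simpl conv.
  - rewrite !R0, mul1_geom. rewrite Nat.add_0_r. simpl. ring.
  - change (shift (fun l k => C * x ^ (k + l))) with (fun l k => C * x ^ (k + S l)).
    replace (fun l k => C * x ^ (k + S l)) with (fun l k => C * x * x ^ (k + l)).
    2:{ apply functional_extensionality; intros l; apply functional_extensionality; intros k.
        rewrite Nat.add_succ_r. simpl. ring. }
    change (mul1 (fun k => C * x ^ (k + 0)) (fun k => C' * x ^ (k + S j)) i +
      mul2 (fun l k => C * x * x ^ (k + l)) (fun l k => C' * x ^ (k + l)) j i =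
      C * C' * (INR (S j) + 1) * (INR i + 1) * x ^ (i + S j)).
    rewrite IH, !R0, mul1_geom, S_INR, Nat.add_succ_r, pow_add. simpl. rewrite pow_add. ring.
Qed.

Lemma cv1_geom r a s : cv1 r a -> 0 < s < r ->
  exists C, 0 <= C /\ forall n, Rabs (a n) <= C * (/ s) ^ n.
Proof.
  intros Ha Hs. destruct (Ha s Hs) as [C HC]. exists C. split.
  - specialize (HC O). pose proof (Rabs_pos (a O)). simpl in HC. lra.
  - intros n. rewrite pow_inv. apply Rle_div_r; [apply pow_lt; lra|]. apply HC.
Qed.

Lemma cv1_add r a b : cv1 r a -> cv1 r b -> cv1 r (add1 a b).
Proof.
  intros Ha Hb s Hs. destruct (Ha s Hs) as [C HC]; destruct (Hb s Hs) as [C' HC'].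
  exists (C + C'). intros n. unfold add1, lift2. specialize (HC n); specialize (HC' n).
  assert (0 < s ^ n) by (apply pow_lt; lra). pose proof (Rabs_triang (a n) (b n)). nra.
Qed.

Lemma cv1_mul r a b : cv1 r a -> cv1 r b -> cv1 r (mul1 a b).
Proof.
  (* An intermediate radius absorbs the factor [n + 1] that the product of two geometric series
     produces. *)
  intros Ha Hb s Hs. set (t := (s + r) / 2).
  assert (Ht : 0 < t < r) by (unfold t; lra).
  destruct (cv1_geom r a t Ha Ht) as (C & HC0 & HC).
  destruct (cv1_geom r b t Hb Ht) as (C' & HC0' & HC').
  destruct (absorb_linear_factor s t) as (K & HK0 & HK); [unfold t; lra|].
  exists (C * C' * K). intros n.
  pose proof (mul1_dom a b _ _ n HC HC') as H. rewrite mul1_geom in H.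
  assert (Hp : 0 < s ^ n) by (apply pow_lt; lra).
  assert (Ht' : 0 < t ^ n) by (apply pow_lt; lra).
  apply Rle_trans with (C * C' * (INR n + 1) * (/ t) ^ n * s ^ n); [apply Rmult_le_compat_r; lra|].
  replace (C * C' * (INR n + 1) * (/ t) ^ n * s ^ n) with
    (C * C' * (((INR n + 1) * s ^ n) * / t ^ n)) by (rewrite pow_inv; ring).
  rewrite (Rmult_assoc C C' K), (Rmult_assoc C C').
  apply Rmult_le_compat_l; [lra|]. apply Rmult_le_compat_l; [lra|].
  apply Rle_div_l; [lra|]. apply HK.
Qed.

Lemma PSeries_bound a s C u : 0 < s -> (forall n, Rabs (a n) * s ^ n <= C) -> Rabs u < s ->
  Rabs (PSeries a u) <= C * / (1 - Rabs u / s).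
Proof.
  intros Hs Ha Hu. pose proof (Rabs_pos u).
  set (q := Rabs u / s).
  assert (Hq : 0 <= q < 1).
  { unfold q; split; [apply Rmult_le_pos; [lra|apply Rlt_le, Rinv_0_lt_compat; lra]|].
    apply Rlt_div_l; lra. }
  assert (G : ex_series (fun n => C * q ^ n)).
  { apply (ex_series_scal (V := R_NormedModule)), ex_series_geom. rewrite Rabs_pos_eq; lra. }
  assert (B : forall n, Rabs (a n * u ^ n) <= C * q ^ n).
  { intros n. rewrite Rabs_mult, <- RPow_abs.
    replace (Rabs u ^ n) with (s ^ n * q ^ n).
    - rewrite <- Rmult_assoc. apply Rmult_le_compat_r; [apply pow_le; lra|apply Ha].
    - rewrite <- Rpow_mult_distr. f_equal. unfold q. field. lra. }
  unfold PSeries. eapply Rle_trans; [apply Series_Rabs|].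
  - apply ex_series_cmp with (2 := G). intros n. rewrite Rabs_Rabsolu. apply B.
  - rewrite <- Series_geom by (rewrite Rabs_pos_eq; lra). rewrite <- Series_scal_l.
    apply Series_le; [|exact G]. intros n; split; [apply Rabs_pos|apply B].
Qed.

(** * Power series in two variables *)

Definition cv (r : R) (a : ser2) : Prop :=
  forall s, 0 < s < r -> exists C, forall j i, Rabs (a j i) * s ^ (i + j) <= C.

(** An iterated sum with [u] inside: the [v]-derivative and the restriction to [v = 0] become
    one-variable facts, and [ev_tr] exchanges the roles of the variables. *)
Definition ev (a : ser2) (u v : R) : R := PSeries (fun j => PSeries (a j) u) v.

Definition tr (a : ser2) : ser2 := fun i j => a j i.

Lemma cv_le r r' a : r' <= r -> cv r a -> cv r' a.
Proof. intros Hr Ha s Hs. apply Ha; lra. Qed.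

Lemma cv_tr r a : cv r a -> cv r (tr a).
Proof.
  intros Ha s Hs. destruct (Ha s Hs) as [C HC]. exists C. intros j i. unfold tr.
  rewrite Nat.add_comm. apply HC.
Qed.

Lemma cv_geom r a s : cv r a -> 0 < s < r ->
  exists C, 0 <= C /\ forall j i, Rabs (a j i) <= C * (/ s) ^ (i + j).
Proof.
  intros Ha Hs. destruct (Ha s Hs) as [C HC]. exists C. split.
  - specialize (HC O O). pose proof (Rabs_pos (a O O)). simpl in HC. lra.
  - intros j i. rewrite pow_inv. apply Rle_div_r; [apply pow_lt; lra|]. apply HC.
Qed.

Lemma cv_of_geom r C x a : 0 < x -> r <= / x ->
  (forall j i, Rabs (a j i) <= C * x ^ (i + j)) -> cv r a.
Proof.
  intros Hx Hr Ha s Hs. exists C. intros j i.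
  assert (HC : 0 <= C).
  { specialize (Ha O O). pose proof (Rabs_pos (a O O)). simpl in Ha. lra. }
  assert (Hp : 0 < s ^ (i + j)) by (apply pow_lt; lra).
  apply Rle_trans with (C * x ^ (i + j) * s ^ (i + j)); [apply Rmult_le_compat_r; auto; lra|].
  rewrite Rmult_assoc, <- Rpow_mult_distr. rewrite <- (Rmult_1_r C) at 2.
  apply Rmult_le_compat_l; [exact HC|]. rewrite <- (pow1 (i + j)). apply pow_incr.
  split; [apply Rmult_le_pos; lra|]. apply Rle_trans with (x * / x); [|rewrite Rinv_r; lra].
  apply Rmult_le_compat_l; lra.
Qed.

Lemma cv_add r a b : cv r a -> cv r b -> cv r (add2 a b).
Proof.
  intros Ha Hb s Hs. destruct (Ha s Hs) as [C HC]; destruct (Hb s Hs) as [C' HC'].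
  exists (C + C'). intros j i. unfold add2, add1, lift2. specialize (HC j i); specialize (HC' j i).
  assert (0 < s ^ (i + j)) by (apply pow_lt; lra). pose proof (Rabs_triang (a j i) (b j i)). nra.
Qed.

Lemma cv_opp r a : cv r a -> cv r (opp2 a).
Proof.
  intros Ha s Hs. destruct (Ha s Hs) as [C HC]. exists C. intros j i.
  unfold opp2, opp1. rewrite Rabs_Ropp. apply HC.
Qed.

Lemma sub2_opp a b : sub2 a b = add2 a (opp2 b).
Proof. ring. Qed.

Lemma cv_sub r a b : cv r a -> cv r b -> cv r (sub2 a b).
Proof. intros; rewrite sub2_opp; apply cv_add; auto; now apply cv_opp. Qed.

Lemma cv_cst r c : cv r (cst2 c).
Proof.
  intros s Hs. exists (Rabs c). intros j i.
  pose proof (Rabs_pos c). destruct j as [|j]; [destruct i as [|i]|]; simpl; unfold zero1.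
  - lra.
  - rewrite Rabs_R0; lra.
  - rewrite Rabs_R0; lra.
Qed.

Lemma cv_mul r a b : cv r a -> cv r b -> cv r (mul2 a b).
Proof.
  intros Ha Hb s Hs. set (t := (s + r) / 2).
  assert (Ht : 0 < t < r) by (unfold t; lra).
  destruct (cv_geom r a t Ha Ht) as (C & HC0 & HC).
  destruct (cv_geom r b t Hb Ht) as (C' & HC0' & HC').
  destruct (absorb_linear_factor s t) as (K & HK0 & HK); [unfold t; lra|].
  exists (C * C' * (K * K)). intros j i.
  pose proof (mul2_dom a b _ _ j i HC HC') as H. rewrite mul2_geom in H.
  assert (Hp : 0 < s ^ (i + j)) by (apply pow_lt; lra).
  assert (Hti : 0 < t ^ i) by (apply pow_lt; lra).
  assert (Htj : 0 < t ^ j) by (apply pow_lt; lra).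
  assert (Hsi : 0 < s ^ i) by (apply pow_lt; lra).
  assert (Hsj : 0 < s ^ j) by (apply pow_lt; lra).
  eapply Rle_trans; [apply Rmult_le_compat_r; [lra|exact H]|].
  replace (C * C' * (INR j + 1) * (INR i + 1) * (/ t) ^ (i + j) * s ^ (i + j)) with
    (C * C' * ((((INR i + 1) * s ^ i) * / t ^ i) * (((INR j + 1) * s ^ j) * / t ^ j)))
    by (rewrite pow_inv, !pow_add; field; lra).
  apply Rmult_le_compat_l; [nra|].
  pose proof (pos_INR i). pose proof (pos_INR j).
  apply Rmult_le_compat.
  - apply Rmult_le_pos; [nra|apply Rlt_le, Rinv_0_lt_compat; lra].
  - apply Rmult_le_pos; [nra|apply Rlt_le, Rinv_0_lt_compat; lra].
  - apply Rle_div_l; [lra|]. apply HK.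
  - apply Rle_div_l; [lra|]. apply HK.
Qed.

Lemma cv_Du r a : cv r a -> cv r (Du a).
Proof.
  intros Ha s Hs. set (t := (s + r) / 2).
  destruct (Ha t) as [C HC]; [unfold t; lra|].
  destruct (absorb_linear_factor s t) as (K & HK0 & HK); [unfold t; lra|].
  assert (Ht : 0 < t) by (unfold t; lra).
  exists (K * C / t). intros j i. unfold Du, D1. rewrite Rabs_mult, Rabs_pos_eq by apply pos_INR.
  rewrite S_INR. specialize (HC j (S i)). specialize (HK i). simpl in HC.
  pose proof (Rabs_pos (a j (S i))).
  assert (Hsj : 0 < s ^ j) by (apply pow_lt; lra).
  assert (Hst : s ^ j <= t ^ j) by (apply pow_incr; unfold t; lra).
  assert (Hti : 0 < t ^ i) by (apply pow_lt; lra).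
  apply (proj1 (Rle_div_r _ _ t Ht)). rewrite !pow_add in *.
  replace ((INR i + 1) * Rabs (a j (S i)) * (s ^ i * s ^ j) * t) with
    (Rabs (a j (S i)) * t * (((INR i + 1) * s ^ i) * s ^ j)) by ring.
  apply Rle_trans with (Rabs (a j (S i)) * t * ((K * t ^ i) * t ^ j)).
  - apply Rmult_le_compat_l; [nra|]. pose proof (pos_INR i).
    assert (0 < s ^ i) by (apply pow_lt; lra).
    apply Rmult_le_compat; nra.
  - replace (Rabs (a j (S i)) * t * (K * t ^ i * t ^ j)) with
      (K * (Rabs (a j (S i)) * (t * (t ^ i * t ^ j)))) by ring.
    apply Rmult_le_compat_l; lra.
Qed.

Lemma Dv_tr a : Dv a = tr (Du (tr a)).
Proof. reflexivity. Qed.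

Lemma cv_Dv r a : cv r a -> cv r (Dv a).
Proof. intros H. rewrite Dv_tr. now apply cv_tr, cv_Du, cv_tr. Qed.

Lemma cv_row r a j : cv r a -> cv1 r (a j).
Proof.
  intros Ha s Hs. destruct (Ha s Hs) as [C HC]. exists (C / s ^ j). intros i.
  assert (0 < s ^ j) by (apply pow_lt; lra).
  apply (Rle_div_r _ _ (s ^ j)); [lra|]. rewrite Rmult_assoc, <- pow_add. apply HC.
Qed.

Lemma cv_rows r a u : cv r a -> Rabs u < r -> cv1 r (fun j => PSeries (a j) u).
Proof.
  intros Ha Hu s Hs. pose proof (Rabs_pos u).
  set (t := (Rmax s (Rabs u) + r) / 2).
  assert (Hm : Rmax s (Rabs u) < r) by (apply Rmax_lub_lt; lra).
  pose proof (Rmax_l s (Rabs u)). pose proof (Rmax_r s (Rabs u)).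
  assert (Ht : 0 < t < r) by (unfold t; lra).
  assert (Hut : Rabs u < t) by (unfold t; lra).
  destruct (Ha t Ht) as [C HC].
  exists (C * / (1 - Rabs u / t)). intros j.
  assert (Htj : 0 < t ^ j) by (apply pow_lt; lra).
  assert (B : Rabs (PSeries (a j) u) <= C / t ^ j * / (1 - Rabs u / t)).
  { apply PSeries_bound; [lra| |exact Hut]. intros i. apply (Rle_div_r _ _ (t ^ j)); [lra|].
    rewrite Rmult_assoc, <- pow_add. apply HC. }
  apply Rle_trans with (Rabs (PSeries (a j) u) * t ^ j).
  - apply Rmult_le_compat_l; [apply Rabs_pos|]. apply pow_incr; unfold t; lra.
  - apply Rmult_le_compat_r with (r := t ^ j) in B; [|lra].
    eapply Rle_trans; [exact B|]. right. field. lra.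
Qed.

Lemma cv_asum r a u v : cv r a -> Rabs u < r -> Rabs v < r ->
  asum (fun j i => a j i * u ^ i * v ^ j).
Proof.
  intros Ha Hu Hv. pose proof (Rabs_pos u). pose proof (Rabs_pos v).
  set (m := Rmax (Rabs v) (Rabs u)).
  assert (Hm : m < r) by (apply Rmax_lub_lt; lra).
  pose proof (Rmax_l (Rabs v) (Rabs u)) as M1. pose proof (Rmax_r (Rabs v) (Rabs u)) as M2.
  fold m in M1, M2. set (t := (m + r) / 2).
  assert (Ht : 0 < t < r) by (unfold t; lra).
  destruct (Ha t Ht) as [C HC].
  apply asum_geom with C (m / t).
  - split; [apply Rmult_le_pos; [lra|apply Rlt_le, Rinv_0_lt_compat; lra]|].
    apply Rlt_div_l; unfold t; lra.
  - intros j i. rewrite !Rabs_mult, <- !RPow_abs. specialize (HC j i).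
    replace (C * (m / t) ^ j * (m / t) ^ i) with (C * / t ^ (i + j) * (m ^ i * m ^ j)).
    2:{ unfold Rdiv. rewrite !Rpow_mult_distr, !pow_inv, pow_add. field.
        split; apply pow_nonzero; lra. }
    rewrite Rmult_assoc. apply Rmult_le_compat.
    + apply Rabs_pos.
    + apply Rmult_le_pos; apply pow_le; lra.
    + apply Rle_div_r; [apply pow_lt; lra|exact HC].
    + apply Rmult_le_compat; try (apply pow_le; lra); apply pow_incr; lra.
Qed.

Lemma ev_series a u v :
  ev a u v = Series (fun j => Series (fun i => a j i * u ^ i * v ^ j)).
Proof.
  unfold ev, PSeries. apply Series_ext; intros j. now rewrite <- Series_scal_r.
Qed.

Lemma ev_tr r a u v : cv r a -> Rabs u < r -> Rabs v < r -> ev (tr a) v u = ev a u v.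
Proof.
  intros Ha Hu Hv. rewrite !ev_series, (fubini _ (cv_asum r a u v Ha Hu Hv)).
  apply Series_ext; intros i; apply Series_ext; intros j. unfold tr. ring.
Qed.

Lemma ev_ex r a u v : cv r a -> Rabs u < r -> Rabs v < r ->
  ex_pseries (fun j => PSeries (a j) u) v.
Proof. intros. apply cv1_ex with r; auto. now apply cv_rows. Qed.

Lemma ev_add r a b u v : cv r a -> cv r b -> Rabs u < r -> Rabs v < r ->
  ev (add2 a b) u v = ev a u v + ev b u v.
Proof.
  intros Ha Hb Hu Hv. unfold ev. rewrite <- PSeries_plus by (eapply ev_ex; eauto).
  apply PSeries_ext; intros j. unfold PS_plus, plus; simpl.
  rewrite <- PSeries_plus by (eapply cv1_ex; eauto; now apply cv_row).
  apply PSeries_ext; reflexivity.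
Qed.

Lemma ev_opp a u v : ev (opp2 a) u v = - ev a u v.
Proof.
  unfold ev. rewrite <- PSeries_opp. apply PSeries_ext; intros j.
  unfold PS_opp, opp; simpl. rewrite <- PSeries_opp. apply PSeries_ext; reflexivity.
Qed.

Lemma ev_sub r a b u v : cv r a -> cv r b -> Rabs u < r -> Rabs v < r ->
  ev (sub2 a b) u v = ev a u v - ev b u v.
Proof.
  intros Ha Hb Hu Hv. rewrite sub2_opp, (ev_add r), ev_opp; auto. now apply cv_opp.
Qed.

Lemma PSeries_cst c u : PSeries (cst 0 c) u = c.
Proof.
  rewrite <- (Rmult_1_r c) at 2. unfold PSeries. apply is_series_unique.
  apply (finite_series (fun k => cst 0 c k * u ^ k) 0).
  intros [|k] Hk; [lia|]. simpl. ring.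
Qed.

Lemma ev_cst c u v : ev (cst2 c) u v = c.
Proof.
  unfold ev. transitivity (PSeries (cst 0 c) v); [|apply PSeries_cst].
  apply PSeries_ext. intros [|j]; simpl.
  - apply PSeries_cst.
  - apply PSeries_const_0.
Qed.

Lemma ev_zero2 u v : ev zero2 u v = 0.
Proof.
  transitivity (ev (cst2 0) u v); [|apply ev_cst]. f_equal.
  apply functional_extensionality; intros [|j]; [|reflexivity].
  apply functional_extensionality; intros [|i]; reflexivity.
Qed.

Lemma fsum_sum_f_R0 f n : fsum R Rplus f n = sum_f_R0 f n.
Proof. induction n as [|n IH]; simpl; [reflexivity|]. now rewrite IH. Qed.

Lemma mul1_PS_mult a b n : PS_mult a b n = mul1 a b n.
Proof.
  unfold PS_mult, mul1. rewrite (conv_fsum _ _ _ _ _ _ _ RTheory).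
  symmetry; apply fsum_sum_f_R0.
Qed.

Lemma PSeries_mul1 r a b x : cv1 r a -> cv1 r b -> Rabs x < r ->
  PSeries (mul1 a b) x = PSeries a x * PSeries b x.
Proof.
  intros Ha Hb Hx. rewrite <- PSeries_mult by (eapply cv1_radius; eauto).
  apply PSeries_ext; intros n. symmetry; apply mul1_PS_mult.
Qed.

Lemma mul2_rows r a b u j : (forall l, cv1 r (a l)) -> (forall l, cv1 r (b l)) -> Rabs u < r ->
  cv1 r (mul2 a b j) /\
  PSeries (mul2 a b j) u = mul1 (fun l => PSeries (a l) u) (fun l => PSeries (b l) u) j.
Proof.
  intros Ha Hb Hu. revert a Ha; induction j as [|j IH]; intros a Ha.
  - split; [apply (cv1_mul r (a O) (b O)); auto|]. apply (PSeries_mul1 r); auto.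
  - destruct (IH (shift a) (fun l => Ha (S l))) as [H1 H2].
    pose proof (cv1_mul r (a O) (b (S j)) (Ha O) (Hb (S j))) as H3. split.
    + exact (cv1_add r _ _ H3 H1).
    + change (PSeries (add1 (mul1 (a O) (b (S j))) (mul2 (shift a) b j)) u =
        PSeries (a O) u * PSeries (b (S j)) u +
        mul1 (fun l => PSeries (shift a l) u) (fun l => PSeries (b l) u) j).
      rewrite <- H2, <- (PSeries_mul1 r) by auto.
      rewrite <- PSeries_plus by (eapply cv1_ex; eauto). apply PSeries_ext; reflexivity.
Qed.

Lemma ev_mul r a b u v : cv r a -> cv r b -> Rabs u < r -> Rabs v < r ->
  ev (mul2 a b) u v = ev a u v * ev b u v.
Proof.
  intros Ha Hb Hu Hv. unfold ev.
  rewrite <- (PSeries_mul1 r) by (auto; now apply cv_rows).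
  apply PSeries_ext; intros j. apply (mul2_rows r); auto; intros l; now apply cv_row.
Qed.

Lemma ev_derive_v r a u v : cv r a -> Rabs u < r -> Rabs v < r ->
  is_derive (fun s => ev a u s) v (ev (Dv a) u v).
Proof.
  intros Ha Hu Hv. unfold ev.
  replace (PSeries (fun j => PSeries (Dv a j) u) v) with
    (PSeries (PS_derive (fun j => PSeries (a j) u)) v).
  - apply is_derive_PSeries. apply cv1_radius with r; auto. now apply cv_rows.
  - apply PSeries_ext; intros j. unfold PS_derive, Dv. rewrite <- PSeries_scal.
    apply PSeries_ext; reflexivity.
Qed.

Lemma locally_R (x : R) (P : R -> Prop) d :
  0 < d -> (forall y, Rabs (y - x) < d -> P y) -> locally x P.
Proof. intros Hd H. exists (mkposreal d Hd). intros y Hy. apply H, Hy. Qed.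

Lemma ev_derive_u r a u v : cv r a -> Rabs u < r -> Rabs v < r ->
  is_derive (fun s => ev a s v) u (ev (Du a) u v).
Proof.
  intros Ha Hu Hv.
  rewrite <- (ev_tr r (Du a)); auto using cv_Du.
  change (tr (Du a)) with (Dv (tr a)).
  apply is_derive_ext_loc with (fun s => ev (tr a) v s).
  - apply (locally_R u _ (r - Rabs u)); [lra|]. intros s Hs. apply (ev_tr r); auto.
    pose proof (Rabs_triang (s - u) u) as T. replace (s - u + u) with s in T by ring. lra.
  - apply (ev_derive_v r); auto. now apply cv_tr.
Qed.

(** The one-variable identity theorem twice, in [v] at fixed [u] and then in [u] for each
    coefficient. *)
Lemma ev_zero r a : 0 < r -> cv r a ->
  (forall u v, Rabs u < r -> Rabs v < r -> ev a u v = 0) -> a = zero2.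
Proof.
  intros Hr Ha H.
  assert (L : forall f : R -> R, (forall x, Rabs x < r -> f x = 0) ->
     locally 0 (fun x : R_UniformSpace => f x = PSeries (fun _ => 0) x)).
  { intros f Hf. apply (locally_R 0 _ r Hr). intros x Hx. rewrite PSeries_const_0. apply Hf.
    now rewrite Rminus_0_r in Hx. }
  assert (Z : Rbar_lt 0 (CV_radius (fun _ => 0))) by (rewrite CV_radius_const_0; exact I).
  apply functional_extensionality; intros j; apply functional_extensionality; intros i.
  apply (PSeries_ext_recip (a j) (fun _ => 0)); auto.
  - apply cv1_radius_pos with r; auto. now apply cv_row.
  - apply L. intros u Hu.
    apply (PSeries_ext_recip (fun j => PSeries (a j) u) (fun _ => 0)); auto.
    + apply cv1_radius_pos with r; auto. now apply cv_rows.
    + apply L. intros v Hv. now apply H.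
Qed.

Lemma ev_v0 a u : ev a u 0 = PSeries (a O) u.
Proof. unfold ev. apply PSeries_0. Qed.

Lemma ev_00 a : ev a 0 0 = a O O.
Proof. rewrite ev_v0. apply PSeries_0. Qed.

Lemma ev_diag r a u v : cv r a -> Rabs u < r -> Rabs v < r ->
  ex_series (fun n => sum_f_R0 (fun i =>
    Rabs (a (n - i)%nat i) * Rabs u ^ i * Rabs v ^ (n - i)) n) /\
  is_series (fun n => sum_f_R0 (fun i => a (n - i)%nat i * u ^ i * v ^ (n - i)) n) (ev a u v).
Proof.
  intros Ha Hu Hv. pose proof (asum_transpose _ (cv_asum r a u v Ha Hu Hv)) as H.
  split.
  - pose proof (sum_diag _ (asum_abs _ H)) as D.
    eexists. eapply is_series_ext; [|exact D]. intros n. apply sum_eq. intros i Hi.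
    now rewrite !Rabs_mult, !RPow_abs.
  - pose proof (sum_diag _ H) as D. simpl in D.
    rewrite <- (fubini _ (cv_asum r a u v Ha Hu Hv)), <- ev_series in D. exact D.
Qed.

(** [analytic2] speaks of sums grouped by total degree; with absolute values inside, each term is at
    most the sum of its group, hence at most the total. *)
Lemma cv_of_diag r a :
  (forall s, 0 < s < r -> ex_series (fun n => sum_f_R0 (fun i =>
    Rabs (a (n - i)%nat i) * s ^ i * s ^ (n - i)) n)) -> cv r a.
Proof.
  intros H s Hs. specialize (H s Hs).
  set (d := fun n => sum_f_R0 (fun i => Rabs (a (n - i)%nat i) * s ^ i * s ^ (n - i)) n) in *.
  assert (T : forall n i, 0 <= Rabs (a (n - i)%nat i) * s ^ i * s ^ (n - i)).
  { intros n i. repeat apply Rmult_le_pos; try (apply pow_le; lra). apply Rabs_pos. }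
  assert (Q : forall f k, (forall i, 0 <= f i) -> 0 <= sum_f_R0 f k).
  { intros f k Hf. induction k; simpl; [apply Hf|]. specialize (Hf (S k)). lra. }
  exists (Series d). intros j i.
  apply Rle_trans with (d (i + j)%nat).
  - unfold d. set (f := fun i0 => Rabs (a (i + j - i0)%nat i0) * s ^ i0 * s ^ (i + j - i0)).
    assert (E : Rabs (a j i) * s ^ (i + j) = f i).
    { unfold f. replace (i + j - i)%nat with j by lia. rewrite pow_add; ring. }
    rewrite E. clear E. assert (L : forall k, (i <= k)%nat -> f i <= sum_f_R0 f k).
    { intros k Hk. induction Hk as [|k Hk IH].
      - destruct i; simpl; [lra|]. pose proof (Q f i (T _)). lra.
      - simpl. pose proof (T (i + j)%nat (S k)) as P. fold (f (S k)) in P. lra. }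
    apply L; lia.
  - apply series_ge_term; [|exact H]. intros n. apply Q, T.
Qed.

(** * Continuity at the centre *)

(** At half the radius of convergence each of the two geometric sums is at most 2. *)
Lemma ev_bound C x a u v : 0 < x -> (forall j i, Rabs (a j i) <= C * x ^ (i + j)) ->
  Rabs u <= / (2 * x) -> Rabs v <= / (2 * x) -> Rabs (ev a u v) <= 4 * C.
Proof.
  intros Hx Ha Hu Hv.
  assert (HC : 0 <= C).
  { specialize (Ha O O). pose proof (Rabs_pos (a O O)). simpl in Ha. lra. }
  assert (E : / (2 * x) = / x / 2) by (field; lra).
  assert (Hix : 0 < / x) by (apply Rinv_0_lt_compat; lra).
  assert (Hp : forall n, x ^ n * (/ x) ^ n = 1).
  { intros n. rewrite <- Rpow_mult_distr, Rinv_r, pow1; lra. }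
  assert (G : forall w, Rabs w <= / (2 * x) -> / (1 - Rabs w / (/ x)) <= 2).
  { intros w Hw. replace 2 with (/ / 2) by field. apply Rinv_le_contravar; [lra|].
    assert (Rabs w / / x <= / 2); [|lra]. apply Rle_div_l; [lra|]. lra. }
  assert (P : forall w, Rabs w <= / (2 * x) -> 0 < / (1 - Rabs w / (/ x))).
  { intros w Hw. apply Rinv_0_lt_compat. assert (Rabs w / / x <= / 2); [|lra].
    apply Rle_div_l; [lra|]. lra. }
  apply Rle_trans with (2 * C * / (1 - Rabs v / (/ x))).
  - apply PSeries_bound; [lra| |lra]. intros j.
    apply Rle_trans with (C * x ^ j * / (1 - Rabs u / (/ x)) * (/ x) ^ j).
    + apply Rmult_le_compat_r; [apply pow_le; lra|].
      apply PSeries_bound; [lra| |lra]. intros i.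
      apply Rle_trans with (C * x ^ (i + j) * (/ x) ^ i).
      * apply Rmult_le_compat_r; [apply pow_le; lra|apply Ha].
      * rewrite pow_add. right.
        replace (C * (x ^ i * x ^ j) * (/ x) ^ i) with (C * x ^ j * (x ^ i * (/ x) ^ i)) by ring.
        rewrite Hp. ring.
    + replace (C * x ^ j * / (1 - Rabs u / / x) * (/ x) ^ j) with
        (/ (1 - Rabs u / / x) * C * (x ^ j * (/ x) ^ j)) by ring.
      rewrite Hp, Rmult_1_r. apply Rmult_le_compat_r; auto.
  - specialize (G v Hv). specialize (P v Hv). nra.
Qed.

Lemma cv_shrink r a : 0 < r -> cv r a -> a O O = 0 ->
  exists K, 0 <= K /\ forall rho, 4 / r <= rho -> bnd rho (K / rho) a.
Proof.
  intros Hr Ha H0. destruct (cv_geom r a (r / 2) Ha) as (C & HC & H); [lra|].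
  assert (Hi : / (r / 2) = 2 / r) by (field; lra). rewrite Hi in H.
  assert (Hp : 0 < 2 / r) by (apply Rdiv_lt_0_compat; lra).
  exists (8 * C * (2 / r)). split; [nra|].
  intros rho Hrho.
  assert (E : 4 / r = 2 * (2 / r)) by (field; lra).
  apply bnd_geom_0; auto; lra.
Qed.

(** Without its constant term the series has norm [K / rho], so its sum is at most [4 K / rho] on
    the square of half-side [1/(8 rho)], and [rho] may be as large as desired. *)
Lemma ev_near r a eps : 0 < r -> cv r a -> 0 < eps ->
  exists d, 0 < d <= r /\ forall u v, Rabs u < d -> Rabs v < d ->
    Rabs (ev a u v - a O O) < eps.
Proof.
  intros Hr Ha He. set (b := sub2 a (cst2 (a O O))).
  assert (Hb : cv r b) by (apply cv_sub; auto; apply cv_cst).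
  destruct (cv_shrink r b Hr Hb) as (K & HK & HB).
  { unfold b, sub2, sub1, lift2; simpl; ring. }
  set (rho := 4 / r + 8 * K / eps).
  assert (H4 : 0 < 4 / r) by (apply Rdiv_lt_0_compat; lra).
  assert (H8 : 0 <= 8 * K / eps).
  { apply Rmult_le_pos; [lra|apply Rlt_le, Rinv_0_lt_compat; lra]. }
  assert (Hrho : 0 < rho) by (unfold rho; lra).
  specialize (HB rho ltac:(unfold rho; lra)).
  assert (HB' : forall j i, Rabs (b j i) <= K / rho * (4 * rho) ^ (i + j)).
  { intros j i. eapply Rle_trans; [apply HB|]. apply Rmult_le_compat_l.
    - apply Rmult_le_pos; [lra|apply Rlt_le, Rinv_0_lt_compat; lra].
    - now apply bw_le. }
  set (d := / (2 * (4 * rho))).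
  assert (Hd : 0 < d) by (apply Rinv_0_lt_compat; lra).
  assert (Hdr : d <= r).
  { unfold d. rewrite <- (Rinv_inv r). apply Rinv_le_contravar; [now apply Rinv_0_lt_compat|].
    unfold rho. unfold Rdiv in *. nra. }
  exists d. split; [lra|]. intros u v Hu Hv.
  replace (ev a u v - a O O) with (ev b u v).
  2:{ unfold b. rewrite (ev_sub r), ev_cst; auto; try lra. apply cv_cst. }
  eapply Rle_lt_trans; [apply (ev_bound (K / rho) (4 * rho)); auto; unfold d in *; lra|].
  replace (4 * (K / rho)) with (4 * K / rho) by (field; lra).
  apply Rlt_div_l; [lra|]. 
  assert (E : eps * rho = eps * (4 / r) + 8 * K) by (unfold rho; field; lra).
  rewrite E. nra.
Qed.

(** * Recentring *)

(** The binomial coefficient cut off at [k > n], where the factorial formula with truncated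
    subtraction does not vanish. *)
Definition bc (n k : nat) : R := if (k <=? n)%nat then Binomial.C n k else 0.

Lemma bc_nonneg n k : 0 <= bc n k.
Proof.
  unfold bc. destruct (Nat.leb_spec k n); [|lra]. unfold Binomial.C.
  apply Rlt_le, Rdiv_lt_0_compat; [|apply Rmult_lt_0_compat]; apply INR_fact_lt_0.
Qed.

Lemma bc_series x y n : is_series (fun k => bc n k * x ^ (n - k) * y ^ k) ((x + y) ^ n).
Proof.
  rewrite Rplus_comm, binomial.
  replace (sum_f_R0 (fun i => Binomial.C n i * y ^ i * x ^ (n - i)) n) with
    (sum_f_R0 (fun k => bc n k * x ^ (n - k) * y ^ k) n).
  - apply finite_series. intros k Hk. unfold bc.
    replace (k <=? n)%nat with false by (symmetry; apply Nat.leb_gt; lia). ring.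
  - apply sum_eq. intros k Hk. unfold bc.
    replace (k <=? n)%nat with true by (symmetry; apply Nat.leb_le; lia). ring.
Qed.

Lemma bc_le x y n k : 0 <= x -> 0 <= y -> bc n k * x ^ (n - k) * y ^ k <= (x + y) ^ n.
Proof.
  intros Hx Hy. pose proof (bc_series x y n) as H.
  rewrite <- (is_series_unique _ _ H).
  apply (series_ge_term (fun k => bc n k * x ^ (n - k) * y ^ k)).
  - intros i. pose proof (bc_nonneg n i).
    repeat apply Rmult_le_pos; auto; apply pow_le; auto.
  - eexists; exact H.
Qed.

(** Re-expansion at [(0, v0)] by the binomial expansion of [(v0 + s)^j]. Only [v] moves; [u] is
    handled by transposition in [ev_recentre2]. *)
Definition recentre (v0 : R) (a : ser2) : ser2 :=
  fun k i => Series (fun j => bc j k * v0 ^ (j - k) * a j i).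

(** One term of the binomial expansion of [t^j], with [t = s + |v0|], bounds
    [bc j k |v0|^(j-k) s^k]; the sum over [j] is then geometric of ratio [t / t']. *)
Lemma cv_recentre r v0 a : cv r a -> Rabs v0 < r -> cv (r - Rabs v0) (recentre v0 a).
Proof.
  intros Ha Hv s Hs. pose proof (Rabs_pos v0).
  set (t := s + Rabs v0). set (t' := (t + r) / 2).
  assert (Ht : 0 < t < t') by (unfold t', t; lra). assert (Ht' : t' < r) by (unfold t', t; lra).
  destruct (cv_geom r a t' Ha ltac:(lra)) as (C & HC0 & HC).
  set (q := t / t').
  assert (Hq : 0 <= q < 1).
  { unfold q; split; [apply Rlt_le, Rdiv_lt_0_compat; lra|apply Rlt_div_l; lra]. }
  assert (G : ex_series (fun n => C * q ^ n)).
  { apply (ex_series_scal (V := R_NormedModule)), ex_series_geom. rewrite Rabs_pos_eq; lra. }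
  exists (C * / (1 - q)). intros k i. unfold recentre.
  assert (Hsp : forall n, 0 < s ^ n) by (intros; apply pow_lt; lra).
  rewrite <- (Rabs_pos_eq (s ^ (i + k))) by (apply Rlt_le, Hsp).
  rewrite <- Rabs_mult, <- Series_scal_r.
  assert (B : forall j, Rabs (bc j k * v0 ^ (j - k) * a j i * s ^ (i + k)) <= C * q ^ j).
  { intros j. rewrite !Rabs_mult, <- !RPow_abs, (Rabs_pos_eq (bc j k)) by apply bc_nonneg.
    rewrite (Rabs_pos_eq s) by lra. rewrite pow_add.
    replace (bc j k * Rabs v0 ^ (j - k) * Rabs (a j i) * (s ^ i * s ^ k)) with
      ((bc j k * Rabs v0 ^ (j - k) * s ^ k) * (Rabs (a j i) * s ^ i)) by ring.
    replace (C * q ^ j) with (t ^ j * (C * / t' ^ j))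
      by (unfold q, Rdiv; rewrite Rpow_mult_distr, pow_inv; ring).
    pose proof (bc_nonneg j k).
    apply Rmult_le_compat.
    - repeat apply Rmult_le_pos; auto; apply pow_le; lra.
    - apply Rmult_le_pos; [apply Rabs_pos|apply pow_le; lra].
    - unfold t. rewrite Rplus_comm. apply bc_le; lra.
    - apply Rle_trans with (C * (/ t') ^ (i + j) * s ^ i).
      + apply Rmult_le_compat_r; [apply pow_le; lra|apply HC].
      + rewrite pow_inv, pow_add.
        assert (Hti : 0 < t' ^ i) by (apply pow_lt; lra).
        assert (Htj : 0 < t' ^ j) by (apply pow_lt; lra).
        replace (C * / (t' ^ i * t' ^ j) * s ^ i) with (C * / t' ^ j * (s ^ i / t' ^ i)) by (field; lra).
        rewrite <- (Rmult_1_r (C * / t' ^ j)) at 2. apply Rmult_le_compat_l.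
        * apply Rmult_le_pos; [lra|apply Rlt_le, Rinv_0_lt_compat; lra].
        * apply Rle_div_l; [lra|]. rewrite Rmult_1_l. apply pow_incr; unfold t', t; lra. }
  eapply Rle_trans; [apply Series_Rabs|].
  - apply ex_series_cmp with (2 := G). intros n; rewrite Rabs_Rabsolu; apply B.
  - rewrite <- Series_geom by (rewrite Rabs_pos_eq; lra). rewrite <- Series_scal_l.
    apply Series_le; [|exact G]. intros n; split; [apply Rabs_pos|apply B].
Qed.

(** Two interchanges of sums: [j] with the power [k] of [s], and then, at fixed [k], [j] with the
    power [i] of [u]. *)
Lemma ev_recentre r v0 a u s : cv r a -> Rabs v0 < r -> Rabs u < r -> Rabs s < r - Rabs v0 ->
  ev a u (v0 + s) = ev (recentre v0 a) u s.
Proof.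
  intros Ha Hv Hu Hs. pose proof (Rabs_pos v0). pose proof (Rabs_pos s).
  set (al := fun j => PSeries (a j) u).
  assert (Hal : cv1 r al) by now apply cv_rows.
  set (g := fun j k => al j * (bc j k * v0 ^ (j - k) * s ^ k)).
  assert (Hg : asum g).
  { assert (A : forall j, is_series (fun k => Rabs (g j k))
       (Rabs (al j) * (Rabs v0 + Rabs s) ^ j)).
    { intros j. apply is_series_ext with
        (fun k => Rabs (al j) * (bc j k * Rabs v0 ^ (j - k) * Rabs s ^ k)).
      - intros k. unfold g. rewrite !Rabs_mult, <- !RPow_abs, (Rabs_pos_eq (bc j k)); auto.
        apply bc_nonneg.
      - apply (is_series_scal (V := R_NormedModule)), bc_series. }
    split.
    - intros j. eexists; apply A.
    - apply ex_series_eq with (fun j => Rabs (al j * (Rabs v0 + Rabs s) ^ j)).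
      + intros j. rewrite (is_series_unique _ _ (A j)), Rabs_mult.
        f_equal. apply Rabs_pos_eq, pow_le; lra.
      + apply CV_disk_inside. apply cv1_radius with r; auto. rewrite Rabs_pos_eq; lra. }
  transitivity (Series (fun j => Series (g j))).
  - unfold ev. fold al. unfold PSeries. apply Series_ext; intros j. unfold g.
    rewrite Series_scal_l. f_equal. symmetry. apply is_series_unique, bc_series.
  - rewrite (fubini g Hg). unfold ev. unfold PSeries at 1. apply Series_ext; intros k.
    transitivity (Series (fun j => bc j k * v0 ^ (j - k) * al j) * s ^ k).
    { rewrite <- Series_scal_r. apply Series_ext; intros j. unfold g. ring. }
    f_equal. unfold al. set (t := (r - Rabs v0) / 2). assert (Ht : 0 < t) by (unfold t; lra).
    set (h := fun j i => bc j k * v0 ^ (j - k) * (a j i * u ^ i)).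
    assert (Hh : asum h).
    (* The factor [t^k] turns the weight into one binomial term of [(|v0| + t)^j], and
       [|v0| + t < r] permits comparison with the original double series. *)
    { assert (Hh' : asum (fun j i => t ^ k * h j i)).
      { apply asum_le with (2 := cv_asum r a u (Rabs v0 + t) Ha Hu
          ltac:(rewrite Rabs_pos_eq; unfold t; lra)).
        intros j i. unfold h.
        rewrite !Rabs_mult, <- !RPow_abs, (Rabs_pos_eq (bc j k)) by apply bc_nonneg.
        rewrite (Rabs_pos_eq t), (Rabs_pos_eq (Rabs v0 + t)) by lra.
        replace (t ^ k * (bc j k * Rabs v0 ^ (j - k) * (Rabs (a j i) * Rabs u ^ i)))
          with (Rabs (a j i) * Rabs u ^ i * (bc j k * Rabs v0 ^ (j - k) * t ^ k)) by ring.
        apply Rmult_le_compat_l.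
        - apply Rmult_le_pos; [apply Rabs_pos|apply pow_le, Rabs_pos].
        - apply bc_le; lra. }
      assert (Htk : 0 < t ^ k) by (apply pow_lt; lra).
      destruct Hh' as [A B]. split.
      - intros j. apply ex_series_eq with (fun i => / t ^ k * Rabs (t ^ k * h j i)).
        + intros i. rewrite Rabs_mult, (Rabs_pos_eq (t ^ k)) by lra. field. lra.
        + apply (ex_series_scal (V := R_NormedModule)), A.
      - apply ex_series_eq with (fun j => / t ^ k * Series (fun i => Rabs (t ^ k * h j i))).
        + intros j. rewrite <- Series_scal_l. apply Series_ext; intros i.
          rewrite Rabs_mult, (Rabs_pos_eq (t ^ k)) by lra. field. lra.
        + apply (ex_series_scal (V := R_NormedModule)), B. }
    transitivity (Series (fun j => Series (h j))).
    + apply Series_ext; intros j. unfold PSeries, h. now rewrite <- Series_scal_l.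
    + rewrite (fubini h Hh). unfold PSeries, recentre. apply Series_ext; intros i.
      rewrite <- Series_scal_r. apply Series_ext; intros j. unfold h. ring.
Qed.

Lemma ev_recentre2 r a u0 v0 : cv r a -> Rabs u0 + Rabs v0 < r ->
  exists b, cv (r - Rabs u0 - Rabs v0) b /\
    forall s t, Rabs s < r - Rabs u0 - Rabs v0 -> Rabs t < r - Rabs u0 - Rabs v0 ->
      ev a (u0 + s) (v0 + t) = ev b s t.
Proof.
  intros Ha H. pose proof (Rabs_pos u0). pose proof (Rabs_pos v0).
  set (a1 := recentre u0 (tr a)).
  assert (Ha1 : cv (r - Rabs u0) a1) by (apply cv_recentre; [now apply cv_tr|lra]).
  exists (recentre v0 (tr a1)). split.
  - apply cv_recentre; [now apply cv_tr|lra].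
  - intros s t Hs Ht.
    pose proof (Rabs_triang v0 t). pose proof (Rabs_triang u0 s).
    rewrite <- (ev_tr r a) by (auto; lra).
    rewrite (ev_recentre r) by (try apply cv_tr; auto; lra). fold a1.
    rewrite <- (ev_tr (r - Rabs u0) a1) by (auto; lra).
    apply (ev_recentre (r - Rabs u0)); try apply cv_tr; auto; lra.
Qed.

(** * Composition with a power series in one variable *)

Lemma cv_pow r a n : cv r a -> cv r (pow2 a n).
Proof. intros H; induction n as [|n IH]; simpl; [apply (cv_cst r 1)|now apply cv_mul]. Qed.

Lemma ev_pow r a n u v : cv r a -> Rabs u < r -> Rabs v < r ->
  ev (pow2 a n) u v = ev a u v ^ n.
Proof.
  intros Ha Hu Hv; induction n as [|n IH]; simpl; [apply (ev_cst 1)|].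
  rewrite (ev_mul r), IH; auto. now apply cv_pow.
Qed.

(** The sum over [n], [j], [i] converges absolutely near the origin: the weighted norm gives ratio
    1/2 in [n], and [4 rho |u|], [4 rho |v|] at most 1/2 give ratio 1/2 in [i] and [j]. Two
    interchanges then bring [n] outside. *)
Lemma ev_comp r rc c z : 0 < r -> 0 < rc -> cv r z -> z O O = 0 -> cv1 rc c ->
  exists r', 0 < r' <= r /\ cv r' (comp c z) /\ forall u v, Rabs u < r' -> Rabs v < r' ->
    Rabs (ev z u v) < rc /\ ev (comp c z) u v = PSeries c (ev z u v).
Proof.
  intros Hr Hrc Hz H0 Hc.
  destruct (ev_near r z rc Hr Hz Hrc) as (d & Hd & Hnear). rewrite H0 in Hnear.
  destruct (cv1_geom rc c (rc / 2) Hc) as (C & HC0 & HC); [lra|].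
  set (sg := / (rc / 2)) in *.
  assert (Hsg : 0 < sg) by (apply Rinv_0_lt_compat; lra).
  destruct (cv_shrink r z Hr Hz H0) as (K & HK & HB).
  (* The first term is the threshold of [cv_shrink], the second yields [8 (K / rho) sg <= 1/2]. *)
  set (rho := 4 / r + 16 * K * sg).
  assert (H4 : 0 < 4 / r) by (apply Rdiv_lt_0_compat; lra).
  assert (HKs : 0 <= 16 * K * sg) by (apply Rmult_le_pos; lra).
  assert (Hrho : 0 < rho) by (unfold rho; lra).
  specialize (HB rho ltac:(unfold rho; lra)).
  assert (Hsmall : 8 * (K / rho) * sg <= / 2).
  { replace (8 * (K / rho) * sg) with (8 * K * sg / rho) by (field; lra).
    apply Rle_div_l; [lra|]. unfold rho; lra. }
  destruct (bnd_comp rho Hrho C sg c (K / rho) z (Rlt_le _ _ Hsg) HC Hsmall HB) as [_ Hcb].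
  assert (H8 : 0 < / (8 * rho)) by (apply Rinv_0_lt_compat; lra).
  set (r' := Rmin d (/ (8 * rho))).
  assert (Hr' : 0 < r') by (apply Rmin_glb_lt; lra).
  assert (Hrd : r' <= d) by apply Rmin_l. assert (Hr8 : r' <= / (8 * rho)) by apply Rmin_r.
  exists r'. split; [lra|]. split.
  - apply cv_of_geom with (2 * C) (4 * rho); [lra| |].
    + apply Rle_trans with (1 := Hr8). apply Rinv_le_contravar; lra.
    + intros j i. eapply Rle_trans; [apply Hcb|]. apply Rmult_le_compat_l; [lra|now apply bw_le].
  - intros u v Hu Hv.
    assert (Hzn : Rabs (ev z u v) < rc).
    { rewrite <- (Rminus_0_r (ev z u v)). apply Hnear; lra. }
    split; [exact Hzn|].
    set (T := fun n j i => c n * pow2 z n j i * u ^ i * v ^ j).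
    assert (HT : forall n j i, Rabs (T n j i) <= C * (/ 2) ^ n * (/ 2) ^ j * (/ 2) ^ i).
    { intros n j i. unfold T. rewrite !Rabs_mult, <- !RPow_abs.
      assert (Hw : forall w, Rabs w < r' -> forall k, (4 * rho) ^ k * Rabs w ^ k <= (/ 2) ^ k).
      { intros w Hw k. rewrite <- Rpow_mult_distr. apply pow_incr. pose proof (Rabs_pos w).
        split; [apply Rmult_le_pos; lra|].
        apply Rle_trans with (4 * rho * / (8 * rho)); [|right; field; lra].
        apply Rmult_le_compat_l; lra. }
      pose proof (bnd_pow rho Hrho (K / rho) z n HB j i) as P.
      pose proof (bw_le rho Hrho j i) as Q. pose proof (bw_pos rho Hrho j i) as Q0.
      assert (HKr : 0 <= 8 * (K / rho)).
      { apply Rmult_le_pos; [lra|]. apply Rmult_le_pos; [lra|apply Rlt_le, Rinv_0_lt_compat; lra]. }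
      apply Rle_trans with (C * sg ^ n * ((8 * (K / rho)) ^ n * (4 * rho) ^ (i + j)) * Rabs u ^ i * Rabs v ^ j).
      - apply Rmult_le_compat_r; [apply pow_le, Rabs_pos|].
        apply Rmult_le_compat_r; [apply pow_le, Rabs_pos|].
        apply Rmult_le_compat; try apply Rabs_pos; auto.
        eapply Rle_trans; [exact P|]. apply Rmult_le_compat_l; [apply pow_le; lra|exact Q].
      - replace (C * sg ^ n * ((8 * (K / rho)) ^ n * (4 * rho) ^ (i + j)) * Rabs u ^ i * Rabs v ^ j)
          with (C * (8 * (K / rho) * sg) ^ n * ((4 * rho) ^ j * Rabs v ^ j) * ((4 * rho) ^ i * Rabs u ^ i))
          by (rewrite pow_add, (Rpow_mult_distr (8 * (K / rho))); ring).
        assert (Hpp : forall k, 0 <= (4 * rho) ^ k) by (intros; apply pow_le; lra).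
        apply Rmult_le_compat; auto.
        + apply Rmult_le_pos; [apply Rmult_le_pos; [lra|apply pow_le]|
            apply Rmult_le_pos; auto; apply pow_le, Rabs_pos].
          apply Rmult_le_pos; lra.
        + apply Rmult_le_pos; auto; apply pow_le, Rabs_pos.
        + apply Rmult_le_compat; auto.
          * apply Rmult_le_pos; [lra|apply pow_le]. apply Rmult_le_pos; lra.
          * apply Rmult_le_pos; auto; apply pow_le, Rabs_pos.
          * apply Rmult_le_compat_l; [lra|]. apply pow_incr. split; [|lra].
            apply Rmult_le_pos; lra. }
    assert (G : ex_series (fun k => (/ 2) ^ k)) by (apply ex_series_geom; rewrite Rabs_pos_eq; lra).
    assert (A1 : forall j, asum (fun n i => T n j i)).
    { intros j. apply asum_geom with (C * (/ 2) ^ j) (/ 2); [lra|].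
      intros n i. eapply Rle_trans; [apply HT|]. right; ring. }
    assert (A2 : asum (fun n j => Series (fun i => T n j i))).
    { apply asum_geom with (2 * C) (/ 2); [lra|]. intros n j.
      eapply Rle_trans; [apply Series_Rabs, (A1 j)|].
      apply Rle_trans with (Series (fun i => C * (/ 2) ^ n * (/ 2) ^ j * (/ 2) ^ i)).
      - apply Series_le.
        + intros i; split; [apply Rabs_pos|apply HT].
        + apply (ex_series_scal (V := R_NormedModule)), G.
      - rewrite Series_scal_l, Series_geom by (rewrite Rabs_pos_eq; lra). right; field. }
    rewrite ev_series.
    transitivity (Series (fun j => Series (fun n => Series (fun i => T n j i)))).
    { apply Series_ext; intros j. rewrite (fubini _ (A1 j)). apply Series_ext; intros i.
      unfold comp. rewrite Rmult_assoc, <- Series_scal_r. apply Series_ext; intros n.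
      unfold T. ring. }
    rewrite <- (fubini _ A2). unfold PSeries. apply Series_ext; intros n.
    rewrite <- (ev_pow r) by (auto; lra). rewrite ev_series, <- Series_scal_l.
    apply Series_ext; intros j. rewrite <- Series_scal_l. apply Series_ext; intros i.
    unfold T. ring.
Qed.

(** * Functions represented by a power series at the origin *)

Definition rep (r : R) (a : ser2) (f : R -> R -> R) : Prop :=
  cv r a /\ forall u v, Rabs u < r -> Rabs v < r -> f u v = ev a u v.

Lemma rep_ev r a : cv r a -> rep r a (ev a).
Proof. intros H; split; auto. Qed.

Lemma rep_le r r' a f : r' <= r -> rep r a f -> rep r' a f.
Proof.
  intros Hr [H1 H2]; split; [now apply cv_le with r|]. intros u v Hu Hv; apply H2; lra.
Qed.

Lemma rep_add r a b f g : rep r a f -> rep r b g ->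
  rep r (add2 a b) (fun u v => f u v + g u v).
Proof.
  intros [H1 H2] [H3 H4]; split; [now apply cv_add|].
  intros u v Hu Hv. rewrite (ev_add r), H2, H4; auto.
Qed.

Lemma rep_sub r a b f g : rep r a f -> rep r b g ->
  rep r (sub2 a b) (fun u v => f u v - g u v).
Proof.
  intros [H1 H2] [H3 H4]; split; [now apply cv_sub|].
  intros u v Hu Hv. rewrite (ev_sub r), H2, H4; auto.
Qed.

Lemma rep_mul r a b f g : rep r a f -> rep r b g ->
  rep r (mul2 a b) (fun u v => f u v * g u v).
Proof.
  intros [H1 H2] [H3 H4]; split; [now apply cv_mul|].
  intros u v Hu Hv. rewrite (ev_mul r), H2, H4; auto.
Qed.

Lemma rep_cst r c : rep r (cst2 c) (fun _ _ => c).
Proof. split; [apply cv_cst|]. intros; now rewrite ev_cst. Qed.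

Lemma rep_du r a f : rep r a f -> rep r (Du a) (d_u f).
Proof.
  intros [H1 H2]; split; [now apply cv_Du|]. intros u v Hu Hv. unfold d_u.
  apply is_derive_unique. apply is_derive_ext_loc with (fun s => ev a s v).
  - apply (locally_R u _ (r - Rabs u)); [lra|]. intros s Hs. symmetry; apply H2; auto.
    pose proof (Rabs_triang (s - u) u) as T. replace (s - u + u) with s in T by ring. lra.
  - now apply (ev_derive_u r).
Qed.

Lemma rep_dv r a f : rep r a f -> rep r (Dv a) (d_v f).
Proof.
  intros [H1 H2]; split; [now apply cv_Dv|]. intros u v Hu Hv. unfold d_v.
  apply is_derive_unique. apply is_derive_ext_loc with (fun s => ev a u s).
  - apply (locally_R v _ (r - Rabs v)); [lra|]. intros s Hs. symmetry; apply H2; auto.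
    pose proof (Rabs_triang (s - v) v) as T. replace (s - v + v) with s in T by ring. lra.
  - now apply (ev_derive_v r).
Qed.

Lemma rep_zero r a f : 0 < r -> rep r a f ->
  (forall u v, Rabs u < r -> Rabs v < r -> f u v = 0) -> a = zero2.
Proof.
  intros Hr [H1 H2] H. apply (ev_zero r); auto. intros u v Hu Hv. rewrite <- H2; auto.
Qed.

Lemma cv1_zero r a : 0 < r -> cv1 r a ->
  (forall x, Rabs x < r -> PSeries a x = 0) -> a = zero1.
Proof.
  intros Hr Ha H. apply functional_extensionality; intros n.
  apply (PSeries_ext_recip a zero1).
  - now apply cv1_radius_pos with r.
  - unfold zero1; rewrite CV_radius_const_0; exact I.
  - apply (locally_R 0 _ r Hr). intros x Hx. rewrite Rminus_0_r in Hx.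
    unfold zero1; rewrite PSeries_const_0. now apply H.
Qed.

Lemma cv1_opp r a : cv1 r a -> cv1 r (opp1 a).
Proof.
  intros Ha s Hs. destruct (Ha s Hs) as [C HC]. exists C. intros n. unfold opp1.
  rewrite Rabs_Ropp. apply HC.
Qed.

Lemma PSeries_opp1 a x : PSeries (opp1 a) x = - PSeries a x.
Proof. rewrite <- PSeries_opp. apply PSeries_ext; reflexivity. Qed.

Lemma PSeries_add1 r a b x : cv1 r a -> cv1 r b -> Rabs x < r ->
  PSeries (add1 a b) x = PSeries a x + PSeries b x.
Proof.
  intros Ha Hb Hx. rewrite <- PSeries_plus by (eapply cv1_ex; eauto).
  apply PSeries_ext; reflexivity.
Qed.

Lemma cv1_ext r a b : 0 < r -> cv1 r a -> cv1 r b ->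
  (forall x, Rabs x < r -> PSeries a x = PSeries b x) -> a = b.
Proof.
  intros Hr Ha Hb H. assert (E : add1 a (opp1 b) = zero1).
  { apply (cv1_zero r); auto; [now apply cv1_add, cv1_opp|]. intros x Hx.
    rewrite (PSeries_add1 r), PSeries_opp1, H; auto; [ring|now apply cv1_opp]. }
  transitivity (add1 (add1 a (opp1 b)) b); [ring|]. rewrite E. ring.
Qed.

Lemma cv1_D1 r a : cv1 r a -> cv1 r (D1 a).
Proof.
  intros Ha. apply cv1_of_ex. intros x Hx.
  apply (ex_pseries_derive a x). now apply cv1_radius with r.
Qed.

Lemma is_derive_PSeries1 r a x : cv1 r a -> Rabs x < r ->
  is_derive (PSeries a) x (PSeries (D1 a) x).
Proof. intros Ha Hx. apply (is_derive_PSeries a x). now apply cv1_radius with r. Qed.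

Lemma rep_row0 r a b f g : 0 < r -> rep r a f -> rep r b g ->
  (forall u, Rabs u < r -> f u 0 = g u 0) -> a O = b O.
Proof.
  intros Hr [H1 H2] [H3 H4] H. apply (cv1_ext r); auto; try now apply cv_row.
  intros u Hu. rewrite <- !ev_v0, <- H2, <- H4; auto; rewrite Rabs_R0; lra.
Qed.

(** * Power series of the data *)

Lemma analytic1_cv1 S f t0 : analytic1 S f -> S t0 -> exists r c, 0 < r /\ cv1 r c /\
  forall t, Rabs (t - t0) < r -> f t = PSeries c (t - t0).
Proof.
  intros H Ht. destruct (H t0 Ht) as (r & Hr & c & Hc). exists r, c.
  assert (P : forall t, Rabs (t - t0) < r -> is_pseries c (t - t0) (f t)).
  { intros t Ht'. apply is_pseries_R. now apply Hc. }
  split; [exact Hr|]. split.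
  - apply cv1_of_ex. intros x Hx. exists (f (x + t0)).
    specialize (P (x + t0)). replace (x + t0 - t0) with x in P by ring. now apply P.
  - intros t Ht'. symmetry. now apply is_pseries_unique, P.
Qed.

Lemma analytic1_derive S f t0 : analytic1 S f -> S t0 -> exists r c, 0 < r /\ cv1 r c /\
  forall t, Rabs (t - t0) < r -> Derive f t = PSeries c (t - t0).
Proof.
  intros H Ht. destruct (analytic1_cv1 S f t0 H Ht) as (r & c & Hr & Hc & E).
  exists r, (D1 c). split; [exact Hr|]. split; [now apply cv1_D1|].
  intros t Ht'. apply is_derive_unique.
  apply is_derive_ext_loc with (fun s => PSeries c (s - t0)).
  - apply (locally_R t _ (r - Rabs (t - t0))); [lra|]. intros s Hs. symmetry; apply E.
    pose proof (Rabs_triang (s - t) (t - t0)) as T.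
    replace (s - t + (t - t0)) with (s - t0) in T by ring. lra.
  - rewrite <- (Rmult_1_l (PSeries (D1 c) (t - t0))).
    apply (is_derive_comp (V := R_NormedModule) (PSeries c) (fun s => s - t0)).
    + now apply (is_derive_PSeries1 r).
    + auto_derive; [exact I|ring].
Qed.

(** [cos x] is defined as a series in [x^2], and [sin x] as [x] times such a series; interleaving
    them with zeros gives series in [x]. *)
Lemma sin_cos_series : exists sn cs, (forall r, cv1 r sn) /\ (forall r, cv1 r cs) /\
  (forall x, sin x = PSeries sn x) /\ (forall x, cos x = PSeries cs x).
Proof.
  assert (Hc : forall x, is_pseries cos_n (x ^ 2) (cos x)).
  { intros x. apply is_pseries_R, is_series_Reals. unfold cos.
    destruct (exist_cos (Rsqr x)) as [l Hl]. rewrite <- Rsqr_pow2. exact Hl. }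
  assert (Hs : forall x, exists l, is_pseries sin_n (x ^ 2) l /\ sin x = x * l).
  { intros x. unfold sin. destruct (exist_sin (Rsqr x)) as [l Hl]. exists l. split; [|reflexivity].
    apply is_pseries_R, is_series_Reals. rewrite <- Rsqr_pow2. exact Hl. }
  set (sn := fun n => if Nat.even n then 0 else sin_n (Nat.div2 n)).
  set (cs := fun n => if Nat.even n then cos_n (Nat.div2 n) else 0).
  assert (Ev : forall n, Nat.even (2 * n) = true) by (intros; rewrite Nat.even_mul; reflexivity).
  assert (Od : forall n, Nat.even (2 * n + 1) = false)
    by (intros; rewrite Nat.even_add, Nat.even_mul; reflexivity).
  assert (D0 : forall n, Nat.div2 (2 * n) = n) by (intros; apply Nat.div2_double).
  assert (D1' : forall n, Nat.div2 (2 * n + 1) = n)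
    by (intros; rewrite Nat.add_1_r; apply Nat.div2_succ_double).
  assert (Z : forall x : R, is_pseries (fun _ => 0) x 0).
  { intros x. apply is_pseries_R. apply (is_series_ext (fun _ => 0)); [intros n; symmetry; apply Rmult_0_l|].
    apply (finite_series (fun _ => 0) 0). reflexivity. }
  assert (Ps : forall x, is_pseries sn x (sin x)).
  { intros x. destruct (Hs x) as (l & Hl & ->). rewrite <- (Rplus_0_l (x * l)).
    apply is_pseries_odd_even.
    - apply is_pseries_ext with (2 := Z _). intros n. unfold sn. now rewrite Ev.
    - apply is_pseries_ext with (2 := Hl). intros n. unfold sn. now rewrite Od, D1'. }
  assert (Pc : forall x, is_pseries cs x (cos x)).
  { intros x. replace (cos x) with (cos x + x * 0) by ring.
    apply is_pseries_odd_even.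
    - apply is_pseries_ext with (2 := Hc x). intros n. unfold cs. now rewrite Ev, D0.
    - apply is_pseries_ext with (2 := Z _). intros n. unfold cs. now rewrite Od. }
  exists sn, cs. repeat split.
  - intros r. apply cv1_of_ex. intros x _. eexists; apply Ps.
  - intros r. apply cv1_of_ex. intros x _. eexists; apply Pc.
  - intros x. symmetry; now apply is_pseries_unique.
  - intros x. symmetry; now apply is_pseries_unique.
Qed.

(** * Analytic functions of two variables *)

Lemma analytic2_rep U f : analytic2 U f -> U 0 0 -> exists r a, 0 < r /\ rep r a f.
Proof.
  intros H HU. destruct (H 0 0 HU) as (r & Hr & c & Hc). exists r, (fun j i => c i j).
  assert (Ha : cv r (fun j i => c i j)).
  { apply cv_of_diag. intros s Hs.
    destruct (Hc s s) as [E _]; rewrite ?Rminus_0_r, ?Rabs_pos_eq by lra; try lra.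
    rewrite Rminus_0_r, Rabs_pos_eq in E by lra. exact E. }
  split; [exact Hr|]. split; [exact Ha|]. intros u v Hu Hv.
  destruct (Hc u v) as [_ E]; rewrite ?Rminus_0_r; auto. rewrite !Rminus_0_r in E.
  destruct (ev_diag r _ u v Ha Hu Hv) as [_ E'].
  rewrite <- (is_series_unique _ _ E), <- (is_series_unique _ _ E'). reflexivity.
Qed.

(** Recentring at [(u0, v0)] costs [|u0| + |v0|], which stays below [r] on a disk of radius at most
    [r / 2]. *)
Lemma ev_analytic2 r a R0 : cv r a -> 0 < R0 <= r / 2 -> analytic2 (disk R0) (ev a).
Proof.
  intros Ha HR u0 v0 Hd. unfold disk in Hd.
  pose proof (Rabs_pos u0). pose proof (Rabs_pos v0).
  assert (Hu : Rabs u0 < R0).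
  { rewrite <- (Rabs_pos_eq R0) by lra. apply Rsqr_lt_abs_0.
    unfold Rsqr. nra. }
  assert (Hv : Rabs v0 < R0).
  { rewrite <- (Rabs_pos_eq R0) by lra. apply Rsqr_lt_abs_0. unfold Rsqr. nra. }
  destruct (ev_recentre2 r a u0 v0 Ha) as (b & Hb & E); [lra|].
  set (rr := r - Rabs u0 - Rabs v0) in *.
  exists rr. split; [unfold rr; lra|]. exists (fun i j => b j i).
  intros u v Hu' Hv'. destruct (ev_diag rr b (u - u0) (v - v0) Hb Hu' Hv') as [D1 D2].
  split; [exact D1|]. rewrite <- E in D2 by auto.
  replace (u0 + (u - u0)) with u in D2 by ring. replace (v0 + (v - v0)) with v in D2 by ring.
  exact D2.
Qed.

(** * Analytic continuation along a segment *)

Lemma left_zero_O r c : 0 < r -> cv1 r c ->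
  (forall x, - r < x < 0 -> PSeries c x = 0) -> c O = 0.
Proof.
  intros Hr Hc H. destruct (Req_dec (c O) 0) as [E|E]; [exact E|exfalso].
  assert (Hcont : continuity_pt (PSeries c) 0).
  { apply PSeries_continuity. apply cv1_radius with r; auto. rewrite Rabs_R0; lra. }
  destruct (Hcont (Rabs (c O))) as (d & Hd & Hn); [now apply Rabs_pos_lt|].
  set (x := - Rmin (d / 2) (r / 2)).
  assert (Hx : 0 < Rmin (d / 2) (r / 2)) by (apply Rmin_glb_lt; lra).
  pose proof (Rmin_l (d / 2) (r / 2)). pose proof (Rmin_r (d / 2) (r / 2)).
  assert (B : R_dist (PSeries c x) (PSeries c 0) < Rabs (c O)).
  { apply Hn. split.
    - split; [exact I|]. unfold x; lra.
    - simpl. unfold R_dist, x. rewrite Rminus_0_r, Rabs_Ropp, Rabs_pos_eq; lra. }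
  rewrite H, PSeries_0 in B by (unfold x; lra).
  unfold R_dist in B. rewrite Rminus_0_l, Rabs_Ropp in B. lra.
Qed.

(** Continuity at 0 kills the constant coefficient and division by [x] reduces to the next one. A
    one-sided version is required because, at the supremum of an interval of zeros, vanishing is
    known only to the left. *)
Lemma left_zero_coef r c n : 0 < r -> cv1 r c ->
  (forall x, - r < x < 0 -> PSeries c x = 0) -> c n = 0.
Proof.
  intros Hr. revert c. induction n as [|n IH]; intros c Hc H.
  - now apply left_zero_O with r.
  - apply (IH (PS_decr_1 c)).
    + intros s Hs. destruct (Hc s Hs) as [C HC]. exists (C / s). intros k.
      apply (Rle_div_r _ _ s); [lra|]. unfold PS_decr_1.
      rewrite Rmult_assoc, (Rmult_comm (s ^ k)). apply (HC (S k)).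
    + pose proof (left_zero_O r c Hr Hc H) as H0. intros x Hx. specialize (H x Hx).
      rewrite PSeries_decr_1_aux in H by exact H0.
      apply Rmult_integral in H. destruct H; [lra|assumption].
Qed.

(** Let [m] be the supremum of the [t] in [[0, 1]] such that [g] vanishes on [[0, t]]. The expansion
    at [m] vanishes on the left, so all its coefficients do, and [g] vanishes beyond [m]; hence
    [m = 1]. *)
Lemma segment_identity (g : R -> R) d :
  0 < d -> (forall t, 0 <= t < d -> g t = 0) ->
  (forall t0, 0 <= t0 <= 1 -> exists r c, 0 < r /\ cv1 r c /\
     forall t, Rabs (t - t0) < r -> g t = PSeries c (t - t0)) ->
  g 1 = 0.
Proof.
  intros Hd H0 Hg.
  set (E := fun t => 0 <= t <= 1 /\ forall s, 0 <= s <= t -> g s = 0).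
  assert (E0 : E 0).
  { split; [lra|]. intros s Hs. apply H0; lra. }
  destruct (completeness E) as [m [Hub Hlub]].
  { exists 1. intros t [Ht _]; lra. }
  { now exists 0. }
  assert (Hm : 0 <= m <= 1).
  { split; [now apply Hub|]. apply Hlub. intros t [Ht _]; lra. }
  assert (Hlt : forall s, 0 <= s < m -> g s = 0).
  { intros s Hs. destruct (Req_dec (g s) 0) as [G|G]; [exact G|exfalso].
    assert (m <= s); [|lra]. apply Hlub. intros t [Ht Ht'].
    destruct (Rle_lt_dec t s); [assumption|]. exfalso; apply G, Ht'; lra. }
  destruct (Hg m Hm) as (r & c & Hr & Hc & Hgc).
  assert (Hext : exists e, 0 < e /\ forall s, 0 <= s < m + e -> g s = 0).
  (* At [m = 0] nothing is known to the left, and the vanishing on [[0, d)] takes over. *)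
  { destruct (Rle_lt_dec m 0) as [Hm0|Hm0].
    - exists d. split; [exact Hd|]. intros s Hs. apply H0; lra.
    - assert (Hz : forall n, c n = 0).
      { intros n. apply left_zero_coef with (Rmin r m).
        - now apply Rmin_glb_lt.
        - apply cv1_le with (2 := Hc). apply Rmin_l.
        - pose proof (Rmin_l r m). pose proof (Rmin_r r m). intros x Hx.
          replace x with (m + x - m) by ring. rewrite <- Hgc.
          + apply Hlt; lra.
          + replace (m + x - m) with x by ring. apply Rabs_def1; lra. }
      exists r. split; [exact Hr|]. intros s Hs.
      destruct (Rlt_le_dec s m); [now apply Hlt|].
      rewrite Hgc by (apply Rabs_def1; lra).
      rewrite (PSeries_ext c (fun _ => 0)) by exact Hz. apply PSeries_const_0. }
  destruct Hext as (e & He & Hs).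
  destruct (Rle_lt_dec 1 m) as [H1|H1]; [apply Hs; lra|exfalso].
  set (t := Rmin 1 (m + e / 2)).
  pose proof (Rmin_l 1 (m + e / 2)). pose proof (Rmin_r 1 (m + e / 2)).
  assert (Hmt : m < t) by (apply Rmin_glb_lt; lra).
  assert (Ht : E t).
  { split; [fold t in H; lra|]. intros s Hs'. apply Hs. fold t in H2; lra. }
  specialize (Hub t Ht). lra.
Qed.

(** Along a ray [(t - t0)^n] factors out of the part of total degree [n], so the sums over
    antidiagonals are the coefficients of a series in [t - t0]. *)
Lemma analytic2_ray U f u v t0 : analytic2 U f -> U (t0 * u) (t0 * v) ->
  exists r c, 0 < r /\ cv1 r c /\
    forall t, Rabs (t - t0) < r -> f (t * u) (t * v) = PSeries c (t - t0).
Proof.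
  intros H HU. destruct (H _ _ HU) as (r & Hr & c & Hc).
  pose proof (Rabs_pos u). pose proof (Rabs_pos v).
  set (r' := r / (Rabs u + Rabs v + 1)).
  assert (Hr' : 0 < r') by (apply Rdiv_lt_0_compat; lra).
  set (e := fun n => sum_f_R0 (fun i => c i (n - i)%nat * u ^ i * v ^ (n - i)) n).
  assert (P : forall t, Rabs (t - t0) < r' -> is_pseries e (t - t0) (f (t * u) (t * v))).
  { intros t Ht. assert (Hb : Rabs (t - t0) * (Rabs u + Rabs v + 1) < r).
    { apply Rlt_div_r; [lra|exact Ht]. }
    pose proof (Rabs_pos (t - t0)).
    destruct (Hc (t * u) (t * v)) as [_ S0].
    - replace (t * u - t0 * u) with ((t - t0) * u) by ring. rewrite Rabs_mult. nra.
    - replace (t * v - t0 * v) with ((t - t0) * v) by ring. rewrite Rabs_mult. nra.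
    - apply is_pseries_R. apply is_series_ext with (2 := S0). intros n.
      unfold e. rewrite (Rmult_comm _ ((t - t0) ^ n)), scal_sum. apply sum_eq. intros i Hi.
      replace (t * u - t0 * u) with ((t - t0) * u) by ring.
      replace (t * v - t0 * v) with ((t - t0) * v) by ring.
      replace ((t - t0) ^ n) with ((t - t0) ^ i * (t - t0) ^ (n - i))
        by (rewrite <- pow_add; f_equal; lia).
      rewrite !Rpow_mult_distr. ring. }
  exists r', e. split; [exact Hr'|]. split.
  - apply cv1_of_ex. intros x Hx. eexists. specialize (P (x + t0)).
    replace (x + t0 - t0) with x in P by ring. apply P, Hx.
  - intros t Ht. symmetry. now apply is_pseries_unique, P.
Qed.

Lemma disk_identity R0 f g d : 0 < d -> analytic2 (disk R0) f -> analytic2 (disk R0) g ->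
  (forall u v, Rabs u < d -> Rabs v < d -> f u v = g u v) ->
  forall u v, disk R0 u v -> f u v = g u v.
Proof.
  intros Hd Hf Hg H u v Huv. apply Rminus_diag_uniq.
  pose proof (Rabs_pos u). pose proof (Rabs_pos v).
  set (d' := d / (Rabs u + Rabs v + 1)).
  assert (Hd' : 0 < d') by (apply Rdiv_lt_0_compat; lra).
  assert (G : (fun t => f (t * u) (t * v) - g (t * u) (t * v)) 1 = 0).
  { apply (segment_identity (fun t => f (t * u) (t * v) - g (t * u) (t * v)) d'); auto.
    - intros t Ht. assert (Hb : t * (Rabs u + Rabs v + 1) < d).
      { apply Rlt_div_r; [lra|apply Ht]. }
      rewrite H; [ring| |]; rewrite Rabs_mult, (Rabs_pos_eq t) by lra; nra.
    - intros t0 Ht0. assert (Hin : disk R0 (t0 * u) (t0 * v)).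
      { unfold disk in *. assert (t0 * t0 <= 1) by nra.
        pose proof (pow2_ge_0 u). pose proof (pow2_ge_0 v).
        replace ((t0 * u) ^ 2 + (t0 * v) ^ 2) with ((t0 * t0) * (u ^ 2 + v ^ 2)) by ring. nra. }
      destruct (analytic2_ray _ f u v t0 Hf Hin) as (r1 & c1 & ? & C1 & E1).
      destruct (analytic2_ray _ g u v t0 Hg Hin) as (r2 & c2 & ? & C2 & E2).
      exists (Rmin r1 r2), (add1 c1 (opp1 c2)).
      pose proof (Rmin_l r1 r2). pose proof (Rmin_r r1 r2).
      apply (cv1_le _ (Rmin r1 r2)) in C1; auto. apply (cv1_le _ (Rmin r1 r2)) in C2; auto.
      split; [now apply Rmin_glb_lt|]. split; [now apply cv1_add, cv1_opp|].
      intros t Ht. rewrite E1, E2 by lra.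
      rewrite (PSeries_add1 (Rmin r1 r2)), PSeries_opp1; auto. now apply cv1_opp. }
  simpl in G. now rewrite !Rmult_1_l in G.
Qed.

(** The square shrinks until [z] stays within [rc] of [z0], where the expansion of [phi'] is
    valid. *)
Lemma rep_dphi phi rc c z0 r Z z :
  0 < rc -> cv1 rc c -> (forall t, Rabs (t - z0) < rc -> Derive phi t = PSeries c (t - z0)) ->
  0 < r -> rep r Z z -> Z O O = z0 ->
  exists r', 0 < r' <= r /\ rep r' (comp c (sub2 Z (cst2 z0))) (fun u v => Derive phi (z u v)).
Proof.
  intros Hrc Hc Hphi Hr [HZ Hz] H0.
  assert (HZ' : cv r (sub2 Z (cst2 z0))) by (apply cv_sub; [exact HZ|apply cv_cst]).
  destruct (ev_comp r rc c _ Hr Hrc HZ') as (r' & Hr' & Hcv & H); auto.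
  { unfold sub2, sub1, lift2; simpl. lra. }
  exists r'. split; [exact Hr'|]. split; [exact Hcv|]. intros u v Hu Hv.
  destruct (H u v Hu Hv) as [B E]. rewrite E.
  rewrite (ev_sub r), ev_cst in B |- * by (try apply cv_cst; auto; lra).
  rewrite Hz by lra. now apply Hphi.
Qed.

Lemma rep_lap r X x : rep r X x -> rep r (add2 (Du (Du X)) (Dv (Dv X))) (lap x).
Proof.
  intros H. exact (rep_add r _ _ _ _ (rep_du r _ _ (rep_du r _ _ H)) (rep_dv r _ _ (rep_dv r _ _ H))).
Qed.

Lemma rep_grad_dot r X Y x y : rep r X x -> rep r Y y ->
  rep r (add2 (mul2 (Du X) (Du Y)) (mul2 (Dv X) (Dv Y))) (grad_dot x y).
Proof.
  intros HX HY.
  exact (rep_add r _ _ _ _ (rep_mul r _ _ _ _ (rep_du r _ _ HX) (rep_du r _ _ HY))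
    (rep_mul r _ _ _ _ (rep_dv r _ _ HX) (rep_dv r _ _ HY))).
Qed.

Lemma rep_pde_lin r G X Z g x z : rep r G g -> rep r X x -> rep r Z z ->
  rep r (pde_lin G X Z) (fun u v => lap x u v + g u v * grad_dot x z u v).
Proof.
  intros HG HX HZ. apply rep_add; [now apply rep_lap|].
  apply rep_mul; [exact HG|now apply rep_grad_dot].
Qed.

Lemma rep_pde_z r G X Y Z g x y z : rep r G g -> rep r X x -> rep r Y y -> rep r Z z ->
  rep r (pde_z G X Y Z) (fun u v => lap z u v + / 2 * (g u v *
    (grad_dot z z u v - (grad_dot x x u v + grad_dot y y u v)))).
Proof.
  intros HG HX HY HZ. apply rep_add; [now apply rep_lap|].
  apply rep_mul; [apply rep_cst|]. apply rep_mul; [exact HG|].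
  apply rep_sub; [now apply rep_grad_dot|]. apply rep_add; now apply rep_grad_dot.
Qed.

Lemma disk_abs R0 u v : 0 < R0 -> disk R0 u v -> Rabs u < R0 /\ Rabs v < R0.
Proof.
  unfold disk. intros HR H. rewrite <- (Rabs_pos_eq R0) by lra.
  split; apply Rsqr_lt_abs_0; unfold Rsqr; nra.
Qed.

Lemma disk_square R0 r u v : 0 < R0 -> r <= R0 / 2 -> Rabs u < r -> Rabs v < r -> disk R0 u v.
Proof.
  intros HR Hr Hu Hv. unfold disk.
  rewrite <- (pow2_abs u), <- (pow2_abs v). pose proof (Rabs_pos u). pose proof (Rabs_pos v). nra.
Qed.

(** * Uniqueness of the analytic solution *)

Section Uniqueness.

Variables (phi : R -> R) (Ia Ib : Rbar) (A B : R -> R) (p1 p2 p3 R0 rc : R) (c : ser1).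
Hypotheses (HR0 : 0 < R0) (Hrc : 0 < rc) (Hc : cv1 rc c)
  (Hphi : forall t, Rabs (t - p3) < rc -> Derive phi t = PSeries c (t - p3)).

(** On a small square both sides of each equation have expansions; the series of their difference
    sums to zero there, hence vanishes coefficientwise. *)
Lemma local_expansion x y z : cauchy_solution phi Ia Ib A B p1 p2 p3 R0 x y z ->
  exists r X Y Z, 0 < r <= R0 / 2 /\ rep r X x /\ rep r Y y /\ rep r Z z /\
    formal_solution c X Y Z.
Proof.
  intros (Ax & Ay & Az & _ & Hpde & Hini).
  assert (H00 : disk R0 0 0) by (unfold disk; nra).
  destruct (analytic2_rep _ _ Ax H00) as (rx & X & Hrx & HX).
  destruct (analytic2_rep _ _ Ay H00) as (ry & Y & Hry & HY).
  destruct (analytic2_rep _ _ Az H00) as (rz & Z & Hrz & HZ).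
  assert (EZ : Z O O = p3).
  { destruct (Hini 0) as (_ & _ & Ez & _); [rewrite Rabs_R0; lra|].
    rewrite RInt_point in Ez. unfold zero in Ez; simpl in Ez. rewrite Rplus_0_r in Ez.
    rewrite <- Ez, <- ev_00. symmetry. apply HZ; rewrite Rabs_R0; lra. }
  destruct (rep_dphi phi rc c p3 rz Z z Hrc Hc Hphi Hrz HZ EZ) as (rg & Hrg & HG).
  set (r := Rmin (Rmin rx ry) (Rmin rg (R0 / 2))).
  assert (Hr : 0 < r) by (repeat apply Rmin_glb_lt; lra).
  pose proof (Rmin_l (Rmin rx ry) (Rmin rg (R0 / 2))) as L1.
  pose proof (Rmin_r (Rmin rx ry) (Rmin rg (R0 / 2))) as L2.
  pose proof (Rmin_l rx ry) as L3. pose proof (Rmin_r rx ry) as L4.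
  pose proof (Rmin_l rg (R0 / 2)) as L5. pose proof (Rmin_r rg (R0 / 2)) as L6.
  fold r in L1, L2.
  apply (rep_le _ r) in HX; [|lra]. apply (rep_le _ r) in HY; [|lra].
  apply (rep_le _ r) in HZ; [|lra]. apply (rep_le _ r) in HG; [|lra].
  exists r, X, Y, Z. split; [lra|]. repeat (split; [assumption|]).
  unfold formal_solution. cbv zeta. rewrite EZ.
  split; [|split].
  - apply (rep_zero r _ _ Hr (rep_pde_lin r _ _ _ _ _ _ HG HX HZ)). intros u v Hu Hv.
    destruct (Hpde u v) as (E & _); [apply disk_square with r; auto; lra|]. rewrite E. ring.
  - apply (rep_zero r _ _ Hr (rep_pde_lin r _ _ _ _ _ _ HG HY HZ)). intros u v Hu Hv.
    destruct (Hpde u v) as (_ & E & _); [apply disk_square with r; auto; lra|]. rewrite E. ring.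
  - apply (rep_zero r _ _ Hr (rep_pde_z r _ _ _ _ _ _ _ _ HG HX HY HZ)). intros u v Hu Hv.
    destruct (Hpde u v) as (_ & _ & E); [apply disk_square with r; auto; lra|]. rewrite E. field.
Qed.

Lemma cauchy_unique x y z x' y' z' :
  cauchy_solution phi Ia Ib A B p1 p2 p3 R0 x y z ->
  cauchy_solution phi Ia Ib A B p1 p2 p3 R0 x' y' z' ->
  forall u v, disk R0 u v -> x' u v = x u v /\ y' u v = y u v /\ z' u v = z u v.
Proof.
  intros HS HS'.
  destruct (local_expansion x y z HS) as (r1 & X & Y & Z & Hr1 & HX & HY & HZ & HF).
  destruct (local_expansion x' y' z' HS') as (r2 & X' & Y' & Z' & Hr2 & HX' & HY' & HZ' & HF').
  set (r := Rmin r1 r2). assert (Hr : 0 < r) by (apply Rmin_glb_lt; lra).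
  pose proof (Rmin_l r1 r2 : r <= r1) as L1. pose proof (Rmin_r r1 r2 : r <= r2) as L2.
  apply (rep_le _ r) in HX; [|exact L1]. apply (rep_le _ r) in HY; [|exact L1].
  apply (rep_le _ r) in HZ; [|exact L1]. apply (rep_le _ r) in HX'; [|exact L2].
  apply (rep_le _ r) in HY'; [|exact L2]. apply (rep_le _ r) in HZ'; [|exact L2].
  destruct HS as (Ax & Ay & Az & _ & _ & Hi). destruct HS' as (Ax' & Ay' & Az' & _ & _ & Hi').
  (* Row 0 is the restriction to the axis and row 1 that of the [v]-derivative, so the Cauchy data
     fix the series modulo [v^2]. *)
  assert (AG : forall F f F' f', rep r F f -> rep r F' f' ->
    (forall u, Rabs u < R0 -> f u 0 = f' u 0 /\ d_v f u 0 = d_v f' u 0) -> agree 2 F F').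
  { intros F f F' f' H H' E.
    assert (E0 : F O = F' O).
    { apply (rep_row0 r F F' f f' Hr H H'). intros u Hu. apply E; lra. }
    assert (E1 : Dv F O = Dv F' O).
    { apply (rep_row0 r _ _ _ _ Hr (rep_dv r _ _ H) (rep_dv r _ _ H')). intros u Hu. apply E; lra. }
    apply agree_S_Dv; [intros i; now rewrite E0|]. intros [|j] Hj; [exact E1|lia]. }
  assert (Hrow : forall u, Rabs u < R0 ->
    (x u 0 = x' u 0 /\ d_v x u 0 = d_v x' u 0) /\ (y u 0 = y' u 0 /\ d_v y u 0 = d_v y' u 0) /\
    (z u 0 = z' u 0 /\ d_v z u 0 = d_v z' u 0)).
  { intros u Hu. destruct (Hi u Hu) as (-> & -> & -> & -> & -> & ->).
    destruct (Hi' u Hu) as (-> & -> & -> & -> & -> & ->). tauto. }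
  destruct (formal_unique c X Y Z X' Y' Z' HF HF') as (EX & EY & EZ).
  - apply (AG _ _ _ _ HX HX'). intros u Hu; apply (Hrow u Hu).
  - apply (AG _ _ _ _ HY HY'). intros u Hu; apply (Hrow u Hu).
  - apply (AG _ _ _ _ HZ HZ'). intros u Hu; apply (Hrow u Hu).
  - subst X' Y' Z'. intros u v Huv.
    destruct HX as [_ HX], HY as [_ HY], HZ as [_ HZ], HX' as [_ HX'], HY' as [_ HY'], HZ' as [_ HZ'].
    split; [|split]; apply (disk_identity R0) with r; auto; intros s t Hs Ht.
    + now rewrite HX, HX'. + now rewrite HY, HY'. + now rewrite HZ, HZ'.
Qed.

End Uniqueness.

(** * The geometry along the axis *)

Definition prim (p : R) (a : ser1) : ser1 :=
  fun n => match n with O => p | S m => a m / INR (S m) end.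

Lemma D1_prim p a : D1 (prim p a) = a.
Proof.
  apply functional_extensionality; intros n. unfold D1, prim. field. apply not_0_INR; lia.
Qed.

Lemma cv1_prim r p a : cv1 r a -> cv1 r (prim p a).
Proof.
  intros Ha s Hs. destruct (Ha s Hs) as [C HC]. pose proof (Rabs_pos p).
  assert (HC0 : 0 <= C).
  { specialize (HC O). pose proof (Rabs_pos (a O)). simpl in HC. lra. }
  exists (Rabs p + C * s). intros [|n].
  - simpl. nra.
  - change (prim p a (S n)) with (a n / INR (S n)). specialize (HC n).
    assert (Hn : 1 <= INR (S n)) by (rewrite S_INR; pose proof (pos_INR n); lra).
    unfold Rdiv. rewrite Rabs_mult, (Rabs_pos_eq (/ INR (S n)))
      by (apply Rlt_le, Rinv_0_lt_compat; lra).
    assert (Hi : / INR (S n) <= 1) by (rewrite <- Rinv_1; apply Rinv_le_contravar; lra).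
    assert (Hi0 : 0 < / INR (S n)) by (apply Rinv_0_lt_compat; lra).
    simpl pow. pose proof (Rabs_pos (a n)). assert (0 < s ^ n) by (apply pow_lt; lra).
    replace (Rabs (a n) * / INR (S n) * (s * s ^ n)) with
      (/ INR (S n) * (Rabs (a n) * s ^ n * s)) by ring.
    assert (Hb : 0 <= Rabs (a n) * s ^ n * s <= C * s).
    { split; [apply Rmult_le_pos; [apply Rmult_le_pos|]; lra|]. apply Rmult_le_compat_r; lra. }
    nra.
Qed.

Lemma PSeries_prim r p a f u : cv1 r a -> (forall t, Rabs t < r -> f t = PSeries a t) ->
  Rabs u < r -> PSeries (prim p a) u = p + RInt f 0 u.
Proof.
  intros Ha Hf Hu.
  assert (Hin : forall t, Rmin 0 u <= t <= Rmax 0 u -> Rabs t < r).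
  { intros t [H1 H2]. eapply Rle_lt_trans; [|exact Hu]. revert H1 H2.
    unfold Rmin, Rmax. destruct (Rle_dec 0 u); intros.
    - rewrite !Rabs_pos_eq; lra.
    - rewrite !Rabs_left1; lra. }
  assert (HI : is_RInt (PSeries a) 0 u (minus (PSeries (prim p a) u) (PSeries (prim p a) 0))).
  { apply (is_RInt_derive (V := R_CompleteNormedModule) (PSeries (prim p a)) (PSeries a)); intros t Ht.
    - rewrite <- (D1_prim p a) at 2. apply (is_derive_PSeries1 r); [now apply cv1_prim|now apply Hin].
    - apply continuity_pt_filterlim, PSeries_continuity, (cv1_radius r); auto. }
  rewrite (RInt_ext f (PSeries a)).
  - rewrite (is_RInt_unique _ _ _ _ HI), PSeries_0. unfold minus, plus, opp; simpl. ring.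
  - intros t Ht. apply Hf, Hin; lra.
Qed.

Lemma cv1_geo1 r a : 0 < r -> cv1 r a -> geo1 a.
Proof.
  intros Hr Ha. destruct (cv1_geom r a (r / 2) Ha) as (C & _ & H); [lra|].
  exists C, (/ (r / 2)). split; [apply Rinv_0_lt_compat; lra|exact H].
Qed.

Section InitialRows.

(** [a], [b], [sn], [cs] stand for the expansions of [A], [B], [sin], [cos] at 0; computations on
    the axis become [ring] identities modulo [sn^2 + cs^2 = 1]. *)
Variables (a b sn cs : ser1) (G X Y Z : ser2).
Hypotheses (Hsc : add1 (mul1 sn sn) (mul1 cs cs) = one1)
  (Dsn : D1 sn = cs) (Dcs : D1 cs = opp1 sn)
  (X0 : D1 (X O) = mul1 b sn) (Y0 : D1 (Y O) = mul1 b cs) (Z0 : D1 (Z O) = a)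
  (X1 : X 1%nat = opp1 (mul1 a sn)) (Y1 : Y 1%nat = opp1 (mul1 a cs)) (Z1 : Z 1%nat = b).

Lemma Dv_O (F : ser2) : Dv F O = F 1%nat.
Proof. apply functional_extensionality; intros i. unfold Dv. simpl. ring. Qed.

(** [|psi_u|^2]; the next series, [normal3], is the third component of the cross product of [psi_u]
    and [psi_v]. *)
Definition energy : ser2 :=
  add2 (mul2 (Du X) (Du X)) (add2 (mul2 (Du Y) (Du Y)) (mul2 (Du Z) (Du Z))).
Definition normal3 : ser2 := sub2 (mul2 (Du X) (Dv Y)) (mul2 (Du Y) (Dv X)).

Ltac rows := rewrite ?Dv_O, ?X1, ?Y1, ?Z1, ?X0, ?Y0, ?Z0.

Lemma conf_P_row0 : conf_P X Y Z O = zero1.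
Proof.
  change (sub1 (add1 (mul1 (D1 (X O)) (D1 (X O))) (add1 (mul1 (D1 (Y O)) (D1 (Y O))) (mul1 (D1 (Z O)) (D1 (Z O)))))
    (add1 (mul1 (Dv X O) (Dv X O)) (add1 (mul1 (Dv Y O) (Dv Y O)) (mul1 (Dv Z O) (Dv Z O)))) = zero1).
  rows. transitivity (mul1 (sub1 (mul1 b b) (mul1 a a)) (sub1 (add1 (mul1 sn sn) (mul1 cs cs)) one1));
    [ring|rewrite Hsc; ring].
Qed.

Lemma conf_S_row0 : conf_S X Y Z O = zero1.
Proof.
  change (add1 (mul1 (D1 (X O)) (Dv X O)) (add1 (mul1 (D1 (Y O)) (Dv Y O)) (mul1 (D1 (Z O)) (Dv Z O))) = zero1).
  rows. transitivity (mul1 (mul1 a b) (sub1 one1 (add1 (mul1 sn sn) (mul1 cs cs))));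
    [ring|rewrite Hsc; ring].
Qed.

Lemma energy_row0 : energy O = add1 (mul1 a a) (mul1 b b).
Proof.
  change (add1 (mul1 (D1 (X O)) (D1 (X O))) (add1 (mul1 (D1 (Y O)) (D1 (Y O))) (mul1 (D1 (Z O)) (D1 (Z O))))
    = add1 (mul1 a a) (mul1 b b)).
  rows. transitivity (add1 (mul1 a a) (mul1 (mul1 b b) (add1 (mul1 sn sn) (mul1 cs cs))));
    [ring|rewrite Hsc; ring].
Qed.

(** On the axis the horizontal parts of [psi_u] and [psi_v] are both multiples of [(sin u, cos u)],
    so the normal is horizontal. *)
Lemma normal3_row0 : normal3 O = zero1.
Proof.
  change (sub1 (mul1 (D1 (X O)) (Dv Y O)) (mul1 (D1 (Y O)) (Dv X O)) = zero1).
  rows. ring.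
Qed.

(* On the axis [<grad x, grad z> = <grad y, grad z> = 0], hence [x_vv = - x_uu], [y_vv = - y_uu]. *)
Lemma normal3_row1 : pde_lin G X Z = zero2 -> pde_lin G Y Z = zero2 ->
  normal3 1%nat = add1 (mul1 a a) (mul1 b b).
Proof.
  intros HX HY. rewrite <- (Dv_O normal3). unfold normal3.
  rewrite Dv_sub, !Dv_mul, <- !Du_Dv.
  assert (VX : Dv (Dv X) O = opp1 (D1 (mul1 b sn))).
  { apply (f_equal (fun F : ser2 => F O)) in HX.
    change (add1 (add1 (D1 (D1 (X O))) (Dv (Dv X) O))
      (mul1 (G O) (add1 (mul1 (D1 (X O)) (D1 (Z O))) (mul1 (Dv X O) (Dv Z O)))) = zero1) in HX.
    rewrite (Dv_O X), (Dv_O Z), X1, Z1, X0, Z0 in HX.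
    transitivity (sub1 (add1 (add1 (D1 (mul1 b sn)) (Dv (Dv X) O))
      (mul1 (G O) (add1 (mul1 (mul1 b sn) a) (mul1 (opp1 (mul1 a sn)) b)))) (D1 (mul1 b sn)));
    [ring|rewrite HX; ring]. }
  assert (VY : Dv (Dv Y) O = opp1 (D1 (mul1 b cs))).
  { apply (f_equal (fun F : ser2 => F O)) in HY.
    change (add1 (add1 (D1 (D1 (Y O))) (Dv (Dv Y) O))
      (mul1 (G O) (add1 (mul1 (D1 (Y O)) (D1 (Z O))) (mul1 (Dv Y O) (Dv Z O)))) = zero1) in HY.
    rewrite (Dv_O Y), (Dv_O Z), Y1, Z1, Y0, Z0 in HY.
    transitivity (sub1 (add1 (add1 (D1 (mul1 b cs)) (Dv (Dv Y) O))
      (mul1 (G O) (add1 (mul1 (mul1 b cs) a) (mul1 (opp1 (mul1 a cs)) b)))) (D1 (mul1 b cs)));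
    [ring|rewrite HY; ring]. }
  change (sub1 (add1 (mul1 (D1 (Dv X O)) (Dv Y O)) (mul1 (D1 (X O)) (Dv (Dv Y) O)))
     (add1 (mul1 (D1 (Dv Y O)) (Dv X O)) (mul1 (D1 (Y O)) (Dv (Dv X) O)))
     = add1 (mul1 a a) (mul1 b b)).
  rewrite VX, VY, (Dv_O X), (Dv_O Y), X1, Y1, X0, Y0.
  assert (Dopp : forall f, D1 (opp1 f) = opp1 (D1 f)).
  { intros f. apply functional_extensionality; intros n. unfold D1, opp1. ring. }
  rewrite !Dopp, !D1_mul, Dsn, Dcs.
  transitivity (mul1 (add1 (mul1 a a) (mul1 b b)) (add1 (mul1 sn sn) (mul1 cs cs)));
    [ring|rewrite Hsc; ring].
Qed.

End InitialRows.

(** * Existence of the solution on a small square *)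

Lemma ev_shift_v r a u v : cv r a -> a O = zero1 ->
  cv r (shift a) /\ ev a u v = v * ev (shift a) u v.
Proof.
  intros Ha H0. split.
  - intros s Hs. destruct (Ha s Hs) as [C HC]. exists (C / s). intros j i.
    apply (Rle_div_r _ _ s); [lra|]. specialize (HC (S j) i).
    rewrite Nat.add_succ_r in HC. simpl in HC. unfold shift.
    rewrite Rmult_assoc, (Rmult_comm (s ^ (i + j))). exact HC.
  - unfold ev. rewrite PSeries_decr_1_aux; [reflexivity|].
    rewrite H0. apply PSeries_const_0.
Qed.

(** Identities between functions pass to the coefficients by uniqueness of expansions. *)
Lemma trig_series_relations sn cs :
  (forall r, cv1 r sn) -> (forall r, cv1 r cs) ->
  (forall x, sin x = PSeries sn x) -> (forall x, cos x = PSeries cs x) ->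
  add1 (mul1 sn sn) (mul1 cs cs) = one1 /\ D1 sn = cs /\ D1 cs = opp1 sn.
Proof.
  intros Hs Hc Es Ec. split; [|split]; apply (cv1_ext 1); try lra.
  - apply cv1_add; now apply cv1_mul.
  - apply (cv_row 1 (cst2 1) O), cv_cst.
  - intros x Hx. rewrite (PSeries_add1 1), !(PSeries_mul1 1) by (try apply cv1_mul; auto).
    rewrite <- Es, <- Ec. pose proof (sin2_cos2 x) as H. unfold Rsqr in H. rewrite H.
    symmetry; apply PSeries_cst.
  - now apply cv1_D1.
  - auto.
  - intros x Hx. rewrite <- Ec.
    rewrite <- (is_derive_unique _ _ _ (is_derive_PSeries1 1 sn x (Hs 1) Hx)).
    rewrite (Derive_ext _ sin) by (intros; now rewrite Es).
    apply is_derive_unique, is_derive_sin.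
  - now apply cv1_D1.
  - now apply cv1_opp.
  - intros x Hx. rewrite PSeries_opp1, <- Es.
    rewrite <- (is_derive_unique _ _ _ (is_derive_PSeries1 1 cs x (Hc 1) Hx)).
    rewrite (Derive_ext _ cos) by (intros; now rewrite Ec).
    apply is_derive_unique, is_derive_cos.
Qed.

Lemma rbar_interval_open Ia Ib t : rbar_open_interval Ia Ib t ->
  exists d, 0 < d /\ forall s, Rabs (s - t) < d -> rbar_open_interval Ia Ib s.
Proof.
  intros [H1 H2].
  assert (L : exists d, 0 < d /\ forall s, Rabs (s - t) < d -> Rbar_lt Ia s).
  { destruct Ia as [x| |]; simpl in H1.
    - exists (t - x). split; [lra|]. intros s Hs. apply Rabs_def2 in Hs. simpl; lra.
    - contradiction.
    - exists 1. split; [lra|]. intros; exact I. }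
  assert (U : exists d, 0 < d /\ forall s, Rabs (s - t) < d -> Rbar_lt s Ib).
  { destruct Ib as [x| |]; simpl in H2.
    - exists (x - t). split; [lra|]. intros s Hs. apply Rabs_def2 in Hs. simpl; lra.
    - exists 1. split; [lra|]. intros; exact I.
    - contradiction. }
  destruct L as (d1 & ? & L), U as (d2 & ? & U). exists (Rmin d1 d2).
  split; [now apply Rmin_glb_lt|]. intros s Hs.
  pose proof (Rmin_l d1 d2). pose proof (Rmin_r d1 d2). split; [apply L|apply U]; lra.
Qed.

(** The series are exported along with the solution because conformality and the angle function are
    read off from them; [rc] and [c] are what the uniqueness argument takes as input. *)
Lemma existence (phi : R -> R) (Ia Ib : Rbar) (eps : R) (A B : R -> R) (p1 p2 p3 : R) :
  analytic1 (rbar_open_interval Ia Ib) phi -> 0 < eps ->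
  analytic1 (fun t => - eps < t < eps) A -> analytic1 (fun t => - eps < t < eps) B ->
  (forall t, - eps < t < eps -> 0 < A t ^ 2 + B t ^ 2) ->
  rbar_open_interval Ia Ib p3 ->
  exists r rc c X Y Z, 0 < r <= eps /\ 0 < rc /\ cv1 rc c /\
    (forall t, Rabs (t - p3) < rc -> Derive phi t = PSeries c (t - p3)) /\
    cv r X /\ cv r Y /\ cv r Z /\
    (forall R0, 0 < R0 <= r / 2 ->
      cauchy_solution phi Ia Ib A B p1 p2 p3 R0 (ev X) (ev Y) (ev Z)) /\
    conf_P X Y Z = zero2 /\ conf_S X Y Z = zero2 /\ normal3 X Y O = zero1 /\
    (forall u v, Rabs u < r -> Rabs v < r -> 0 < ev (energy X Y Z) u v) /\
    (forall u v, Rabs u < r -> Rabs v < r -> 0 < ev (shift (normal3 X Y)) u v) /\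
    (forall u, Rabs u < r -> ev (shift (normal3 X Y)) u 0 = ev (energy X Y Z) u 0).
Proof.
  intros Hphi Heps HA HB Hpos Hp3.
  destruct (analytic1_derive _ _ _ Hphi Hp3) as (rc & c & Hrc & Hc & Ec).
  destruct (analytic1_cv1 _ _ 0 HA ltac:(lra)) as (ra & a & Hra & Ha & Ea).
  destruct (analytic1_cv1 _ _ 0 HB ltac:(lra)) as (rb & b & Hrb & Hb & Eb).
  destruct sin_cos_series as (sn & cs & Hsn & Hcs & Esn & Ecs).
  destruct (trig_series_relations sn cs Hsn Hcs Esn Ecs) as (Hsc & Dsn & Dcs).
  set (rd := Rmin (Rmin ra rb) eps).
  assert (Hrd : 0 < rd) by (repeat apply Rmin_glb_lt; lra).
  assert (Lrd : rd <= ra /\ rd <= rb /\ rd <= eps).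
  { unfold rd. pose proof (Rmin_l (Rmin ra rb) eps). pose proof (Rmin_r (Rmin ra rb) eps).
    pose proof (Rmin_l ra rb). pose proof (Rmin_r ra rb). lra. }
  apply (cv1_le _ rd) in Ha; [|lra]. apply (cv1_le _ rd) in Hb; [|lra].
  assert (EA : forall t, Rabs t < rd -> A t = PSeries a t).
  { intros t Ht. rewrite Ea, Rminus_0_r; [reflexivity|rewrite Rminus_0_r; lra]. }
  assert (EB : forall t, Rabs t < rd -> B t = PSeries b t).
  { intros t Ht. rewrite Eb, Rminus_0_r; [reflexivity|rewrite Rminus_0_r; lra]. }
  clear Ea Eb.
  assert (Has := cv1_mul rd a sn Ha (Hsn rd)). assert (Hac := cv1_mul rd a cs Ha (Hcs rd)).
  assert (Hbs := cv1_mul rd b sn Hb (Hsn rd)). assert (Hbc := cv1_mul rd b cs Hb (Hcs rd)).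
  destruct (formal_exists c (prim p1 (mul1 b sn)) (opp1 (mul1 a sn))
    (prim p2 (mul1 b cs)) (opp1 (mul1 a cs)) (prim p3 a) b)
    as (rho & M & X & Y & Z & Hrho & HF & EX0 & EX1 & EY0 & EY1 & EZ0 & EZ1 & BX & BY & BZ);
    try (apply (cv1_geo1 rd); auto using cv1_prim, cv1_opp; fail).
  { now apply (cv1_geo1 rc). }
  assert (HM : 0 <= M) by now apply bnd_nonneg with rho X.
  assert (Hcv : forall F, bnd rho M F -> cv (/ (4 * rho)) F).
  { intros F HFb. apply cv_of_geom with M (4 * rho); [lra|lra|].
    intros j i. eapply Rle_trans; [apply HFb|]. apply Rmult_le_compat_l; [lra|now apply bw_le]. }
  assert (H4 : 0 < / (4 * rho)) by (apply Rinv_0_lt_compat; lra).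
  set (r0 := Rmin rd (/ (4 * rho))).
  assert (Hr0 : 0 < r0) by (apply Rmin_glb_lt; lra).
  assert (L1 : r0 <= rd) by apply Rmin_l. assert (L2 : r0 <= / (4 * rho)) by apply Rmin_r.
  assert (CX := cv_le _ r0 X L2 (Hcv X BX)). assert (CY := cv_le _ r0 Y L2 (Hcv Y BY)).
  assert (CZ := cv_le _ r0 Z L2 (Hcv Z BZ)).
  assert (Z00 : Z O O = p3) by (rewrite EZ0; reflexivity).
  destruct (rep_dphi phi rc c p3 r0 Z (ev Z) Hrc Hc Ec Hr0 (rep_ev r0 Z CZ) Z00)
    as (rg & Hrg & HG).
  unfold formal_solution in HF. cbv zeta in HF. rewrite Z00 in HF.
  set (G := comp c (sub2 Z (cst2 p3))) in *. destruct HF as (F1 & F2 & F3).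
  assert (DX0 : D1 (X O) = mul1 b sn) by (rewrite EX0; apply D1_prim).
  assert (DY0 : D1 (Y O) = mul1 b cs) by (rewrite EY0; apply D1_prim).
  assert (DZ0 : D1 (Z O) = a) by (rewrite EZ0; apply D1_prim).
  destruct (conf_zero G X Y Z F1 F2 F3) as [HP HS].
  { apply (conf_P_row0 a b sn cs); auto. }
  { apply (conf_S_row0 a b sn cs); auto. }
  pose proof (energy_row0 a b sn cs X Y Z Hsc DX0 DY0 DZ0) as HE0.
  pose proof (normal3_row0 a b sn cs X Y DX0 DY0 EX1 EY1) as HN0.
  pose proof (normal3_row1 a b sn cs G X Y Z Hsc Dsn Dcs DX0 DY0 DZ0 EX1 EY1 EZ1 F1 F2) as HN1.
  assert (CE : cv r0 (energy X Y Z))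
    by (unfold energy; repeat first [apply cv_add | apply cv_mul | apply cv_Du]; assumption).
  assert (CN : cv r0 (normal3 X Y))
    by (unfold normal3; repeat first [apply cv_sub | apply cv_mul | apply cv_Du | apply cv_Dv]; assumption).
  assert (CK := proj1 (ev_shift_v r0 _ 0 0 CN HN0)).
  assert (Q : forall u, Rabs u < rd -> PSeries (add1 (mul1 a a) (mul1 b b)) u = A u ^ 2 + B u ^ 2).
  { intros u Hu. rewrite (PSeries_add1 rd), !(PSeries_mul1 rd) by (try apply cv1_mul; auto).
    rewrite EA, EB by auto. ring. }
  assert (Q0 : 0 < A 0 ^ 2 + B 0 ^ 2) by (apply Hpos; lra).
  assert (E00 : energy X Y Z O O = A 0 ^ 2 + B 0 ^ 2).
  { rewrite HE0, <- Q, PSeries_0 by (rewrite Rabs_R0; lra). reflexivity. }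
  assert (K00 : shift (normal3 X Y) O O = A 0 ^ 2 + B 0 ^ 2).
  { unfold shift. rewrite HN1, <- Q, PSeries_0 by (rewrite Rabs_R0; lra). reflexivity. }
  (* [energy] and [normal3 / v] share the value [A(0)^2 + B(0)^2] at the origin; staying within that
     distance of it keeps both positive. *)
  destruct (ev_near r0 _ _ Hr0 CE Q0) as (d1 & Hd1 & N1). rewrite E00 in N1.
  destruct (ev_near r0 _ _ Hr0 CK Q0) as (d2 & Hd2 & N2). rewrite K00 in N2.
  destruct (rbar_interval_open Ia Ib p3 Hp3) as (di & Hdi & HI).
  destruct (ev_near r0 Z di Hr0 CZ Hdi) as (d3 & Hd3 & N3). rewrite Z00 in N3.
  set (r := Rmin (Rmin d1 d2) (Rmin d3 rg)).
  assert (Hr : 0 < r) by (repeat apply Rmin_glb_lt; lra).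
  assert (Lr : r <= d1 /\ r <= d2 /\ r <= d3 /\ r <= rg).
  { unfold r. pose proof (Rmin_l (Rmin d1 d2) (Rmin d3 rg)). pose proof (Rmin_r (Rmin d1 d2) (Rmin d3 rg)).
    pose proof (Rmin_l d1 d2). pose proof (Rmin_r d1 d2).
    pose proof (Rmin_l d3 rg). pose proof (Rmin_r d3 rg). lra. }
  assert (Lr0 : r <= r0) by lra.
  exists r, rc, c, X, Y, Z.
  split; [lra|]. split; [exact Hrc|]. split; [exact Hc|]. split; [exact Ec|].
  split; [now apply cv_le with r0|]. split; [now apply cv_le with r0|].
  split; [now apply cv_le with r0|].
  split.
  { intros R0 HR0.
    assert (RX := rep_ev r X (cv_le _ _ _ Lr0 CX)). assert (RY := rep_ev r Y (cv_le _ _ _ Lr0 CY)).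
    assert (RZ := rep_ev r Z (cv_le _ _ _ Lr0 CZ)).
    apply (rep_le _ r) in HG; [|lra].
    repeat (split; [apply (ev_analytic2 r); [apply cv_le with r0; assumption|lra]|]).
    split; [|split].
    - intros u v Huv. apply disk_abs in Huv; [|lra]. apply HI, N3; lra.
    - intros u v Huv. apply disk_abs in Huv; [|lra].
      pose proof (rep_pde_lin r _ _ _ _ _ _ HG RX RZ) as [_ P1].
      pose proof (rep_pde_lin r _ _ _ _ _ _ HG RY RZ) as [_ P2].
      pose proof (rep_pde_z r _ _ _ _ _ _ _ _ HG RX RY RZ) as [_ P3].
      specialize (P1 u v ltac:(lra) ltac:(lra)). specialize (P2 u v ltac:(lra) ltac:(lra)).
      specialize (P3 u v ltac:(lra) ltac:(lra)).
      rewrite F1, ev_zero2 in P1. rewrite F2, ev_zero2 in P2. rewrite F3, ev_zero2 in P3.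
      repeat split; lra.
    - intros u Hu. assert (Hu' : Rabs u < r) by lra.
      assert (H0 : Rabs 0 < r) by (rewrite Rabs_R0; lra).
      assert (VX := proj2 (rep_dv r _ _ RX) u 0 Hu' H0).
      assert (VY := proj2 (rep_dv r _ _ RY) u 0 Hu' H0).
      assert (VZ := proj2 (rep_dv r _ _ RZ) u 0 Hu' H0).
      rewrite ev_v0, Dv_O in VX, VY, VZ. rewrite VX, VY, VZ, !ev_v0, EX0, EX1, EY0, EY1, EZ0, EZ1.
      rewrite !PSeries_opp1, !(PSeries_mul1 rd) by (auto; lra).
      rewrite <- Esn, <- Ecs, <- EA, <- EB by lra.
      repeat split; try ring.
      + apply (PSeries_prim rd); [exact Hbs| |lra]. intros t Ht.
        now rewrite (PSeries_mul1 rd), <- EB, <- Esn by auto.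
      + apply (PSeries_prim rd); [exact Hbc| |lra]. intros t Ht.
        now rewrite (PSeries_mul1 rd), <- EB, <- Ecs by auto.
      + apply (PSeries_prim rd); [exact Ha|exact EA|lra]. }
  split; [exact HP|]. split; [exact HS|]. split; [exact HN0|].
  split; [|split].
  - intros u v Hu Hv. specialize (N1 u v ltac:(lra) ltac:(lra)). apply Rabs_def2 in N1. lra.
  - intros u v Hu Hv. specialize (N2 u v ltac:(lra) ltac:(lra)). apply Rabs_def2 in N2. lra.
  - intros u Hu. rewrite !ev_v0. unfold shift. now rewrite HN1, HE0.
Qed.

(** * The angle function of a conformal solution *)

Section AngleFunction.

Variables (r : R) (X Y Z : ser2).
Hypotheses (CX : cv r X) (CY : cv r Y) (CZ : cv r Z)
  (HP : conf_P X Y Z = zero2) (HS : conf_S X Y Z = zero2) (HN : normal3 X Y O = zero1)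
  (HE : forall u v, Rabs u < r -> Rabs v < r -> 0 < ev (energy X Y Z) u v).

Lemma conformal_relations u v : Rabs u < r -> Rabs v < r ->
  let x := ev X in let y := ev Y in let z := ev Z in
  d_u x u v * d_v x u v + d_u y u v * d_v y u v + d_u z u v * d_v z u v = 0 /\
  d_u x u v ^ 2 + d_u y u v ^ 2 + d_u z u v ^ 2 = ev (energy X Y Z) u v /\
  d_v x u v ^ 2 + d_v y u v ^ 2 + d_v z u v ^ 2 = ev (energy X Y Z) u v.
Proof.
  intros Hu Hv x y z.
  assert (RX := rep_ev r X CX). assert (RY := rep_ev r Y CY). assert (RZ := rep_ev r Z CZ).
  assert (RS := rep_add r _ _ _ _ (rep_mul r _ _ _ _ (rep_du r _ _ RX) (rep_dv r _ _ RX))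
    (rep_add r _ _ _ _ (rep_mul r _ _ _ _ (rep_du r _ _ RY) (rep_dv r _ _ RY)) (rep_mul r _ _ _ _ (rep_du r _ _ RZ) (rep_dv r _ _ RZ)))).
  assert (RE := rep_add r _ _ _ _ (rep_mul r _ _ _ _ (rep_du r _ _ RX) (rep_du r _ _ RX))
    (rep_add r _ _ _ _ (rep_mul r _ _ _ _ (rep_du r _ _ RY) (rep_du r _ _ RY)) (rep_mul r _ _ _ _ (rep_du r _ _ RZ) (rep_du r _ _ RZ)))).
  assert (RV := rep_add r _ _ _ _ (rep_mul r _ _ _ _ (rep_dv r _ _ RX) (rep_dv r _ _ RX))
    (rep_add r _ _ _ _ (rep_mul r _ _ _ _ (rep_dv r _ _ RY) (rep_dv r _ _ RY)) (rep_mul r _ _ _ _ (rep_dv r _ _ RZ) (rep_dv r _ _ RZ)))).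
  assert (RP := rep_sub r _ _ _ _ RE RV).
  apply proj2 in RS. apply proj2 in RE. apply proj2 in RP.
  specialize (RS u v Hu Hv). specialize (RE u v Hu Hv). specialize (RP u v Hu Hv).
  fold (conf_S X Y Z) in RS. fold (conf_P X Y Z) in RP.
  fold (energy X Y Z) in RE. rewrite HS, ev_zero2 in RS. rewrite HP, ev_zero2 in RP.
  fold x y z in RS, RE, RP. repeat split; lra.
Qed.

(** By Lagrange's identity and conformality the cross product of [psi_u] and [psi_v] has length
    [|psi_u|^2]; its third component vanishes on the axis, which lets [v] factor out. *)
Lemma angle_formula u v : Rabs u < r -> Rabs v < r ->
  angle_fun (ev X) (ev Y) (ev Z) u v =
  v * (ev (shift (normal3 X Y)) u v / ev (energy X Y Z) u v).
Proof.
  intros Hu Hv. destruct (conformal_relations u v Hu Hv) as (E1 & E2 & E3).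
  assert (RX := rep_ev r X CX). assert (RY := rep_ev r Y CY).
  assert (RN := rep_sub r _ _ _ _ (rep_mul r _ _ _ _ (rep_du r _ _ RX) (rep_dv r _ _ RY))
    (rep_mul r _ _ _ _ (rep_du r _ _ RY) (rep_dv r _ _ RX))).
  destruct RN as [CN RN]. specialize (RN u v Hu Hv).
  fold (normal3 X Y) in RN, CN.
  rewrite (proj2 (ev_shift_v r _ u v CN HN)) in RN.
  pose proof (HE u v Hu Hv) as HE'.
  unfold angle_fun, cross3.
  match goal with |- _ / sqrt ?q = _ => assert (Hq : q = ev (energy X Y Z) u v ^ 2) end.
  { transitivity ((d_u (ev X) u v ^ 2 + d_u (ev Y) u v ^ 2 + d_u (ev Z) u v ^ 2) *
      (d_v (ev X) u v ^ 2 + d_v (ev Y) u v ^ 2 + d_v (ev Z) u v ^ 2) -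
      (d_u (ev X) u v * d_v (ev X) u v + d_u (ev Y) u v * d_v (ev Y) u v +
       d_u (ev Z) u v * d_v (ev Z) u v) ^ 2); [ring|].
    rewrite E1, E2, E3. ring. }
  rewrite Hq, sqrt_pow2, RN by lra. field. lra.
Qed.

Lemma angle_derivative u : Rabs u < r ->
  d_v (angle_fun (ev X) (ev Y) (ev Z)) u 0 =
  ev (shift (normal3 X Y)) u 0 / ev (energy X Y Z) u 0.
Proof.
  intros Hu. pose proof (Rabs_pos u). assert (H0 : Rabs 0 < r) by (rewrite Rabs_R0; lra).
  assert (CE : cv r (energy X Y Z))
    by (unfold energy; repeat first [apply cv_add | apply cv_mul | apply cv_Du]; assumption).
  assert (CN : cv r (normal3 X Y))
    by (unfold normal3; repeat first [apply cv_sub | apply cv_mul | apply cv_Du | apply cv_Dv]; assumption).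
  assert (CK := proj1 (ev_shift_v r _ 0 0 CN HN)).
  unfold d_v. apply is_derive_unique.
  apply is_derive_ext_loc with
    (fun s => s * (ev (shift (normal3 X Y)) u s / ev (energy X Y Z) u s)).
  - apply (locally_R 0 _ r); [lra|]. intros s Hs. rewrite Rminus_0_r in Hs.
    symmetry; now apply angle_formula.
  - assert (HE0 := HE u 0 Hu H0).
    pose proof (is_derive_div _ _ 0 _ _ (ev_derive_v r _ u 0 CK Hu H0)
      (ev_derive_v r _ u 0 CE Hu H0) ltac:(lra)) as D.
    pose proof (is_derive_mult (fun s : R => s) _ 0 _ _ (is_derive_id 0) D Rmult_comm) as D'.
    (* The derivative of the quotient is multiplied by [s = 0], so only the quotient itself
       remains. *)
    replace (ev (shift (normal3 X Y)) u 0 / ev (energy X Y Z) u 0) with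
      (plus (mult one (ev (shift (normal3 X Y)) u 0 / ev (energy X Y Z) u 0))
        (mult 0 ((ev (Dv (shift (normal3 X Y))) u 0 * ev (energy X Y Z) u 0 -
          ev (shift (normal3 X Y)) u 0 * ev (Dv (energy X Y Z)) u 0) / ev (energy X Y Z) u 0 ^ 2))).
    + exact D'.
    + unfold plus, mult, one; simpl. field. lra.
Qed.

End AngleFunction.

Theorem theorem5 (phi : R -> R) (Ia Ib : Rbar) (eps : R) (A B : R -> R)
  (p1 p2 p3 : R) :
  Rbar_lt Ia Ib ->
  analytic1 (rbar_open_interval Ia Ib) phi ->
  0 < eps ->
  analytic1 (fun t => - eps < t < eps) A ->
  analytic1 (fun t => - eps < t < eps) B ->
  (forall t, - eps < t < eps -> 0 < A t ^ 2 + B t ^ 2) ->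
  rbar_open_interval Ia Ib p3 ->
  exists R1, 0 < R1 /\ forall R0, 0 < R0 <= R1 ->
    exists x y z : R -> R -> R,
      cauchy_solution phi Ia Ib A B p1 p2 p3 R0 x y z /\
      (forall x' y' z', cauchy_solution phi Ia Ib A B p1 p2 p3 R0 x' y' z' ->
         forall u v, disk R0 u v -> x' u v = x u v /\ y' u v = y u v /\ z' u v = z u v) /\
      conformal_phi_e3_minimal phi (disk R0) x y z /\
      (forall u v, disk R0 u v -> v <> 0 -> angle_fun x y z u v <> 0) /\
      (forall u, Rabs u < R0 ->
         angle_fun x y z u 0 = 0 /\ d_v (angle_fun x y z) u 0 = 1).
Proof.
  intros _ Hphi Heps HA HB Hpos Hp3.
  destruct (existence phi Ia Ib eps A B p1 p2 p3 Hphi Heps HA HB Hpos Hp3)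
    as (r & rc & c & X & Y & Z & Hr & Hrc & Hc & Ec & CX & CY & CZ & Hsol & HP & HS & HN & HE & HK & HKE).
  exists (r / 2). split; [lra|]. intros R0 HR0.
  exists (ev X), (ev Y), (ev Z).
  pose proof (Hsol R0 HR0) as HS0.
  assert (Hd : forall u v, disk R0 u v -> Rabs u < r /\ Rabs v < r).
  { intros u v Huv. apply disk_abs in Huv; lra. }
  split; [exact HS0|]. split; [|split; [|split]].
  - intros x' y' z' H'. now apply (cauchy_unique phi Ia Ib A B p1 p2 p3 R0 rc c).
  - split.
    + intros u v Huv. destruct (Hd u v Huv) as [Hu Hv].
      destruct (conformal_relations r X Y Z CX CY CZ HP HS u v Hu Hv) as (E1 & E2 & E3).
      pose proof (HE u v Hu Hv). cbv zeta in *. rewrite E2, E3. auto.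
    + intros u v Huv. destruct HS0 as (_ & _ & _ & _ & Hpde & _).
      destruct (Hpde u v Huv) as (-> & -> & ->). unfold grad_dot. repeat split; field.
  - intros u v Huv Hv0. destruct (Hd u v Huv) as [Hu Hv].
    rewrite (angle_formula r); auto.
    pose proof (HE u v Hu Hv). pose proof (HK u v Hu Hv).
    apply Rmult_integral_contrapositive_currified; [exact Hv0|].
    apply Rgt_not_eq, Rdiv_lt_0_compat; lra.
  - intros u Hu. assert (Hu' : Rabs u < r) by lra.
    assert (H0 : Rabs 0 < r) by (rewrite Rabs_R0; lra). split.
    + rewrite (angle_formula r); auto. ring.
    + rewrite (angle_derivative r); auto. rewrite HKE by exact Hu'. field.
      pose proof (HE u 0 Hu' H0). lra.
Qed.
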